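(* Let $v\in S_\infty$ and let $1\le p\le k$ be integers. Then $$\mathcal G_v(x)\,\mathcal G_{(1^p)}(x_1,\ldots,x_k)\;=\;\sum_{w}(-1)^{\ell(w)-\ell(v)-p}\binom{\ell(w)-\ell(v)-f(v,w)-p(v,w)}{p-f(v,w)}\,\mathcal G_w(x),$$ where the sum is over all permutations $w\in S_\infty$ such that $v\xrightarrow{\,c(k)\,}w$.
   Context: $S_\infty=\bigcup_n S_n$ under the usual inclusions $S_n\hookrightarrow S_{n+1}$; $\ell(w)$ is the number of inversions of a permutation $w$. Permutations multiply so that $w(a,b)$ is obtained from $w$ by exchanging the values in positions $a$ and $b$. Grothendieck polynomials: on $\mathbb Z[x_1,x_2,\ldots]$ let $s_i$ act by interchanging $x_i$ and $x_{i+1}$, let $\partial_i f=(f-s_if)/(x_i-x_{i+1})$ and $\pi_i f=\partial_i\big((1-x_{i+1})f\big)=f+(1-x_i)\partial_i f$. Set $\mathcal G_{\omega_0}(x)=x_1^{n-1}x_2^{n-2}\cdots x_{n-1}$ for $\omega_0=n\cdots21$ the longest element of $S_n$, and $\mathcal G_{ws_i}(x)=\pi_i\mathcal G_w(x)$ whenever $\ell(ws_i)=\ell(w)-1$, where in $ws_i$ the symbol $s_i$ is the transposition $(i,i+1)$. These are well defined and independent of $n$, so $\mathcal G_w(x)$ is defined for $w\in S_\infty$; they form a basis of $\mathbb Z[x_1,x_2,\ldots]$. For $1\le p\le k$, $\mathcal G_{(1^p)}(x_1,\ldots,x_k):=\mathcal G_{c_{[k,p]}}(x)$, where $c_{[k,p]}$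 is the cycle $(k-p+1,k-p+2,\ldots,k+1)$, i.e. the permutation with $c(i)=i+1$ for $k-p+1\le i\le k$, $c(k+1)=k-p+1$, and $c(i)=i$ otherwise. The $k$-Bruhat order is the suborder of the Bruhat order on $S_\infty$ whose covers are $u\lessdot u(a,b)$ with $a\le k<b$ and $\ell(u(a,b))=\ell(u)+1$; such a cover is written $u\xrightarrow{(a,b)}u(a,b)$. On pairs of positive integers define $(a,b)\prec(c,d)$ iff $b>d$, or $b=d$ and $a<c$. For a saturated chain $\gamma$: $v=v_0\xrightarrow{(a_1,b_1)}v_1\xrightarrow{(a_2,b_2)}\cdots\xrightarrow{(a_q,b_q)}v_q=w$ in the $k$-Bruhat order, with $q=\ell(\gamma)$, consider the conditions: (P0) For $i=2,\ldots,q-1$, if $a_j=a_i$ for some $j<i$, then $(a_i,b_i)\prec(a_{i+1},b_{i+1})$. (P1) $b_1\ge b_2\ge\cdots\ge b_q$. Write $v\xrightarrow{\,c(k)\,}w$ when there is a saturated chain $\gamma$ from $v$ to $w$ in the $k$-Bruhat order satisfying (P0) and (P1); such a chain is unique when it exists. Consider markings of a subset of the covers of $\gamma$ subject to: (P2) If the $i$th cover is marked, then $a_j\ne a_i$ for all $j<i$. (P3) If the $i$th cover is not marked and $i+1\le q$, then $(a_i,b_i)\prec(a_{i+1},b_{i+1})$. (P4) If $b_1=\cdots=b_r$ and $a_1>\cdots>a_r$ for some $r\ge1$, then the $r$th cover is marked. If $v\xrightarrow{\,c(k)\,}w$ with chain $\gamma$, then $f(v,w)$ is the number of covers of $\gamma$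 forced to be marked by these conditions (i.e. the $i$th covers with $i+1\le q$ and $(a_i,b_i)\not\prec(a_{i+1},b_{i+1})$, together with the $r$th covers for every $r\ge1$ with $b_1=\cdots=b_r$ and $a_1>\cdots>a_r$), and $p(v,w)$ is the number of covers prohibited from being marked (i.e. the $i$th covers with $a_j=a_i$ for some $j<i$). The binomial coefficient $\binom nk$ is set to $0$ if $0\le k\le n$ does not hold. *)

(* Defs.v *)
(* Variables, positions and values are numbered from 0: position [i : nat]
   stands for the usual position i + 1, and ['x_i] for x_(i+1).

   Notions specified by a uniquely satisfied property are obtained with
   Stdlib's [epsilon]. *)
From mathcomp Require Import all_boot all_algebra.
From mathcomp Require Import finmap.
From mathcomp.multinomials Require Import monalg.
From Stdlib Require Import ClassicalEpsilon.

Set Implicit Arguments.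
Unset Strict Implicit.
Unset Printing Implicit Defensive.

Import GRing.Theory.

Local Open Scope fset_scope.
Local Open Scope ring_scope.

(* {fsfun nat -> nat} is the type of functions that are the identity outside a
   finite set; an injective one is bijective. *)
Definition Sinf := {f : {fsfun nat -> nat} | fsinjectiveb f}.

Definition app (w : Sinf) : nat -> nat := val w.
Coercion app : Sinf >-> Funclass.

Definition mulS (u v : Sinf) : Sinf :=
  exist _ (fsfun_comp (val u) (val v))
    (introT fsinjectiveP (fscomp_inj (elimT fsinjectiveP (valP v))
                                     (elimT fsinjectiveP (valP u)))).

Lemma mulSE (u v : Sinf) i : mulS u v i = u (v i).
Proof. exact: fscompE. Qed.

Lemma Sinf_inj (w : Sinf) : injective w.
Proof. exact/fsinjectiveP/(valP w). Qed.

Lemma Sinf_eqP (u v : Sinf) : u =1 v -> u = v.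
Proof. by move=> uv; apply/val_inj/fsfunP. Qed.

Section MkS.
Variables (n : nat) (f : nat -> nat).
Hypothesis f_inj : injective f.
Hypothesis f_id : forall i, (n <= i)%N -> f i = i.

Let g : {fsfun nat -> nat} := [fsfun i in [fset j in iota 0 n] => f i].

Let gE : g =1 f.
Proof.
move=> i; rewrite fsfunE !inE mem_iota add0n /=.
by case: ltnP => // /f_id.
Qed.

Lemma mkS_subproof : fsinjectiveb g.
Proof. by apply/fsinjectiveP => i j; rewrite !gE => /f_inj. Qed.

Definition mkS : Sinf := exist _ g mkS_subproof.

Lemma mkSE : mkS =1 f.
Proof. exact: gE. Qed.
End MkS.

Definition trfun (a b i : nat) : nat :=
  if i == a then b else if i == b then a else i.

Lemma trfunK a b : involutive (trfun a b).
Proof.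
move=> i; rewrite /trfun; case: (eqVneq i a) => [->|ia].
  by rewrite eqxx; case: eqP.
case: (eqVneq i b) => [->|ib]; first by rewrite eqxx.
by rewrite (negbTE ia) (negbTE ib).
Qed.

Lemma trfun_id a b i : ((maxn a b).+1 <= i)%N -> trfun a b i = i.
Proof.
rewrite gtn_max => /andP[ai bi].
by rewrite /trfun (gtn_eqF ai) (gtn_eqF bi).
Qed.

Definition trS (a b : nat) : Sinf := mkS (inv_inj (trfunK a b)) (@trfun_id a b).

Definition w0fun (n i : nat) : nat := if (i < n)%N then (n - i.+1)%N else i.

Lemma w0funK n : involutive (w0fun n).
Proof.
move=> i; rewrite /w0fun; case: (ltnP i n) => [lt_in|le_ni]; last first.
  by rewrite ltnNge le_ni.
by rewrite ltn_subrL /= (leq_trans _ lt_in) // subnSK // subKn // ltnW.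
Qed.

Lemma w0fun_id n i : (n <= i)%N -> w0fun n i = i.
Proof. by rewrite /w0fun leqNgt => /negbTE->. Qed.

Definition w0S (n : nat) : Sinf := mkS (inv_inj (w0funK n)) (@w0fun_id n).

(* The cycle c_[k,p] = (k-p+1, ..., k+1). *)
Definition cycfun (k p i : nat) : nat :=
  if (k - p <= i < k)%N then i.+1 else if i == k then (k - p)%N else i.

Lemma cycfun_inj k p : injective (cycfun k p).
Proof.
move=> i j; rewrite /cycfun.
case: (boolP (k - p <= i < k)%N) => [/andP[i1 i2]|Ni];
  case: (boolP (k - p <= j < k)%N) => [/andP[j1 j2]|Nj].
- by case.
- case: (eqVneq j k) => [->|jk] e; first by rewrite -e ltnn in i1 *.
  case/negP: Nj; rewrite -e (leq_trans i1) //=.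
  by rewrite ltn_neqAle i2 andbT e.
- case: (eqVneq i k) => [->|ik] e; first by rewrite e ltnn in j1 *.
  case/negP: Ni; rewrite e (leq_trans j1) //=.
  by rewrite ltn_neqAle j2 andbT -e.
- case: (eqVneq i k) => [->|ik]; case: (eqVneq j k) => [->|jk] // e.
  + by case/negP: Nj; rewrite -e leqnn /= ltn_neqAle e jk -e leq_subr.
  + by case/negP: Ni; rewrite e leqnn /= ltn_neqAle -e ik e leq_subr.
Qed.

Lemma cycfun_id k p i : (k.+1 <= i)%N -> cycfun k p i = i.
Proof.
by move=> ki; rewrite /cycfun [(i < k)%N]ltnNge (ltnW ki) andbF gtn_eqF.
Qed.

Definition cycS (k p : nat) : Sinf := mkS (@cycfun_inj k p) (@cycfun_id k p).

(* [w] fixes every [i >= boundS w]. *)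
Definition boundS (w : Sinf) : nat := \max_(i <- finsupp (val w)) i.+1.

Definition len (w : Sinf) : nat :=
  #|[set ij : 'I_(boundS w) * 'I_(boundS w) |
      (ij.1 < ij.2)%N && (w ij.2 < w ij.1)%N]|.

Definition ZX := {malg int[{cmonom nat}]}.

Definition varX (i : nat) : ZX := << ucm i >>.
Notation "''x_' i" := (varX i)
  (at level 8, i at level 2, format "''x_' i").

(* The ring endomorphism substituting ['x_(s j)] for ['x_j], for all [j]. *)
Definition actX (s : nat -> nat) (f : ZX) : ZX :=
  mmap (fun c : int => c%:~R)
       (fun m : {cmonom nat} => \prod_(j <- finsupp m) 'x_(s j) ^+ m j) f.

(* The exact quotient (f - s_i f) / (x_i - x_(i+1)) in Z[x]. *)
Definition divdiff (i : nat) (f : ZX) : ZX :=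
  epsilon (inhabits 0)
    (fun g : ZX => ('x_i - 'x_i.+1) * g = f - actX (trfun i i.+1) f).

Definition isobaric (i : nat) (f : ZX) : ZX := divdiff i ((1 - 'x_i.+1) * f).

Record is_grothendieck (G : Sinf -> ZX) : Prop := IsGrothendieck {
  grothendieck_w0 : forall n : nat,
    G (w0S n) = \prod_(i < n) 'x_i ^+ (n - i.+1);
  grothendieck_step : forall (w : Sinf) (i : nat),
    (len (mulS w (trS i i.+1))).+1 = len w ->
    G (mulS w (trS i i.+1)) = isobaric i (G w)
}.

(* The unique family with these properties. *)
Definition groth : Sinf -> ZX :=
  epsilon (inhabits (fun=> 0)) is_grothendieck.

(* G_(1^p)(x_1, ..., x_k). *)
Definition groth1 (p k : nat) : ZX := groth (cycS k p).

(* The cover u -> u(a,b); a 0-based position is among the first k iff < k. *)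
Definition kcover (k : nat) (u : Sinf) (ab : nat * nat) : bool :=
  (ab.1 < k <= ab.2)%N && (len (mulS u (trS ab.1 ab.2)) == (len u).+1).

(* A saturated chain is given by its starting point and the sequence of the
   labels of its covers. *)
Fixpoint kchain (k : nat) (v : Sinf) (g : seq (nat * nat)) (w : Sinf) : bool :=
  if g is ab :: g' then
    kcover k v ab && kchain k (mulS v (trS ab.1 ab.2)) g' w
  else v == w.

Definition prec (ab cd : nat * nat) : bool :=
  (cd.2 < ab.2)%N || (ab.2 == cd.2) && (ab.1 < cd.1)%N.

(* The label (a_i, b_i) is [lab g (i - 1)]. *)
Definition lab (g : seq (nat * nat)) (i : nat) : nat * nat := nth (0, 0)%N g i.

Definition a_repeats (g : seq (nat * nat)) (i : nat) : bool :=
  (lab g i).1 \in unzip1 (take i g).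

Definition condP0 (g : seq (nat * nat)) : Prop :=
  forall i, (0 < i)%N -> (i.+1 < size g)%N ->
    a_repeats g i -> prec (lab g i) (lab g i.+1).

Definition condP1 (g : seq (nat * nat)) : bool := sorted geq (unzip2 g).

Definition pieri_chain (k : nat) (v w : Sinf) (g : seq (nat * nat)) : Prop :=
  [/\ kchain k v g w, condP0 g & condP1 g].

(* v --c(k)--> w *)
Definition pieri (k : nat) (v w : Sinf) : Prop :=
  exists g, pieri_chain k v w g.

(* Relevant only when [pieri k v w], in which case it is the unique chain. *)
Definition the_chain (k : nat) (v w : Sinf) : seq (nat * nat) :=
  epsilon (inhabits [::]) (pieri_chain k v w).

(* b_1 = ... = b_r and a_1 > ... > a_r, where r = i + 1. *)
Definition decreasing_start (g : seq (nat * nat)) (i : nat) : bool :=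
  constant (unzip2 (take i.+1 g)) && sorted gtn (unzip1 (take i.+1 g)).

Definition forced (g : seq (nat * nat)) (i : nat) : bool :=
  (i.+1 < size g)%N && ~~ prec (lab g i) (lab g i.+1) || decreasing_start g i.

Definition nforced (k : nat) (v w : Sinf) : nat :=
  let g := the_chain k v w in count (forced g) (iota 0 (size g)).

Definition nprohibited (k : nat) (v w : Sinf) : nat :=
  let g := the_chain k v w in count (a_repeats g) (iota 0 (size g)).

Definition binz (n m : int) : int :=
  if 0 <= m <= n then ('C(`|n|, `|m|))%:Z else 0.

(* Main.v *)
Require Import Defs.
From HB Require Import structures.
From mathcomp Require Import all_boot all_algebra.
From mathcomp Require Import finmap.
From mathcomp.multinomials Require Import monalg.
From mathcomp Require Import zify ring.
From mathcomp Require boolp.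
From Stdlib Require Ncring Ncring_tac.
From Stdlib Require Import ClassicalEpsilon FunctionalExtensionality ProofIrrelevance.

(** Why the formula holds. Functions of a permutation carry the Bruhat operators
    [T a b], where [(T a b F) v] is [F (v(a,b))] if [v(a,b)] covers [v], and 0
    otherwise; a product of such operators is a sum over chains. They satisfy
    the Yang-Baxter equation [T_braid]. The product with the polynomials of all
    the cycles [cycS k p] is computed at once, by evaluating in two ways an
    average [Z] over colourings, with a parameter [t].

    Colour each of the values of [v] at the first [k] positions, the rows, by 0
    with weight [t] or by 1 with weight [1 - t]. For a fixed colouring, consider
    the chains in the [k]-Bruhat order with the following rule: a label [(a, b)]
    that moves a value of colour 1 to the right is followed by a larger label or
    ends the chain, and has the sign -1; a label that moves a value of colour 0
    is followed by a label in the same column [b] with a smaller row. The signed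
    sum of these chains factors over the columns ([As_wt]), and the factor of a
    column is the inverse of a short product of operators [1 + T a b] and
    projections.

    First evaluation. Adding a row to all columns is an elimination in the ring
    of operators, driven by the Yang-Baxter equation ([gauss_conj],
    [gauss_comm]). It gives the recursion [Z_rec], by which [Z] for [k + 1] rows
    is the operator [t + (1 - t) * Y] applied to [Z] for [k] rows, where [Y] is
    a product of operators [1 + T a k] and [1 - T k b]. On Grothendieck
    polynomials, [Y] is the multiplication by [1 - x k] ([monk]); this is proved
    by downward induction from the longest permutation, the relations between
    [Y] and the exchange of adjacent values being those between [1 - x k] and
    the isobaric operators. So [Z] is the multiplication by a product [Eprod]
    that does not depend on [v].

    Second evaluation. Average the weight of each single chain over the
    colourings ([csum_wt]). Only the chains that satisfy (P0) and (P1) survive: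
    by [spoiled], a row that is used again holds a value of colour 1. With
    [q > 0] covers, [f] of them forced to be marked and [m] prohibited, the
    weight times [- t] is
    [(1 - t) * (-1)^q * (- t)^f * (1 - t)^(q - f - m)]
    ([mean_wt_gf]). A chain is determined by its ends ([chain_unique]), so that
    the sum over chains is a sum over permutations.

    Comparing the evaluations at [v] and at the identity, where the chains end
    at the cycles [cycS k p], eliminates [Eprod]; dividing by [1 - t] and taking
    the coefficient of [t^p] gives the formula, the binomial coefficient coming
    from the power of [1 - t]. *)

Set Implicit Arguments.
Unset Strict Implicit.
Unset Printing Implicit Defensive.
Import GRing.Theory.
Local Open Scope ring_scope.

(** * Transpositions, length and covers *)

Local Open Scope nat_scope.

Definition tr (u : Sinf) (a b : nat) : Sinf := mulS u (trS a b).

Lemma trE u a b i : tr u a b i = u (trfun a b i).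
Proof. by rewrite /tr mulSE mkSE. Qed.

Lemma trEl u a b : tr u a b a = u b.
Proof. by rewrite trE /trfun eqxx. Qed.

Lemma trEr u a b : tr u a b b = u a.
Proof. by rewrite trE /trfun eqxx; case: eqP => // ->. Qed.

Lemma trEn u a b i : i != a -> i != b -> tr u a b i = u i.
Proof. by move=> ia ib; rewrite trE /trfun (negbTE ia) (negbTE ib). Qed.

Lemma trK u a b : tr (tr u a b) a b = u.
Proof. by apply: Sinf_eqP => i; rewrite !trE trfunK. Qed.

Lemma bound_id (u : Sinf) i : (boundS u <= i)%N -> u i = i.
Proof.
move=> h; apply: fsfun_dflt; apply/negP => hi.
by have /bigmax_leqP_seq/(_ i hi isT) := h; rewrite ltnn.
Qed.

Lemma bound_le (u : Sinf) n : (forall i, (n <= i)%N -> u i = i) -> (boundS u <= n)%N.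
Proof.
move=> h; apply/bigmax_leqP_seq => i hi _; rewrite ltnNge; apply/negP => /h e.
by move: hi; rewrite mem_finsupp => /eqP; apply; exact: e.
Qed.

(** A value [u i >= n] would be a fixed point of [u], against injectivity. *)
Lemma lt_bound (u : Sinf) n i : (boundS u <= n)%N -> (i < n)%N -> (u i < n)%N.
Proof.
move=> un lt_in; rewrite ltnNge; apply/negP => ni.
have := bound_id (leq_trans un ni) => /(@Sinf_inj u) e.
by move: ni; rewrite e leqNgt lt_in.
Qed.

Lemma tr_bound u a b n : (boundS u <= n)%N -> (a < n)%N -> (b < n)%N ->
  (boundS (tr u a b) <= n)%N.
Proof.
move=> un an bn; apply: bound_le => i ni.
by rewrite trEn ?gtn_eqF ?(leq_trans an) ?(leq_trans bn) //;
   apply: bound_id; exact: leq_trans ni.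
Qed.

(** Inversions are counted in a square that may exceed the support, so that
    the lengths of different permutations become comparable. *)
Definition inv2 (n : nat) (u : Sinf) : nat :=
  \sum_(i < n) \sum_(j < n) ((i < j) && (u j < u i))%N.

Lemma inv2S n (u : Sinf) : (boundS u <= n)%N -> inv2 n.+1 u = inv2 n u.
Proof.
move=> un; rewrite /inv2 big_ord_recr /= [X in (_ + X)%N]big1; last first.
  move=> j _; case: ltnP => //= lt_nj.
  by move: (ltn_ord j); rewrite ltnS leqNgt lt_nj.
rewrite addn0; apply: eq_bigr => i _; rewrite big_ord_recr /=.
have uin := lt_bound un (ltn_ord i).
by rewrite (bound_id un) [(n < u i)%N]ltnNge (ltnW uin) andbF addn0.
Qed.

Lemma lenE n u : (boundS u <= n)%N -> len u = inv2 n u.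
Proof.
have -> : len u = inv2 (boundS u) u.
  rewrite /inv2 pair_bigA /= /len -sum1dep_card big_mkcond /=.
  by apply: eq_bigr => -[i j] _ /=; case: ifP.
elim: n => [|n IHn]; first by rewrite leqn0 => /eqP ->.
rewrite leq_eqVlt => /predU1P[-> //|]; rewrite ltnS => un.
by rewrite (inv2S un) IHn.
Qed.

Lemma sum2_split n (f : 'I_n -> 'I_n -> nat) (a b : 'I_n) : a != b ->
  \sum_i \sum_j f i j =
  (f a a + f a b + f b a + f b b
   + \sum_(c | (c != a) && (c != b)) (f a c + f c a + f b c + f c b)
   + \sum_(i | (i != a) && (i != b)) \sum_(j | (j != a) && (j != b)) f i j)%N.
Proof.
move=> ab; have ba : b != a by rewrite eq_sym.
have split2 (g : 'I_n -> nat) : \sum_j g j =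
    (g a + g b + \sum_(j | (j != a) && (j != b)) g j)%N.
  by rewrite (bigD1 a) //= (bigD1 b) //= addnA.
rewrite (split2 (fun i => \sum_j f i j)) !split2.
rewrite (eq_bigr _ (fun i _ => split2 (f i))).
rewrite !big_split /=; lia.
Qed.

(** The exchange creates an inversion for the pair [(a, b)] itself and two for
    each position in between that carries an intermediate value; the other
    pairs of positions are permuted. *)
Lemma len_tr (u : Sinf) a b : (a < b)%N -> (u a < u b)%N ->
  exists d, len (tr u a b) = (len u + d.*2).+1 /\
    (d == 0)%N = [forall c : 'I_b, (a < c)%N ==> ~~ (u a < u c < u b)%N].
Proof.
move=> ab uab; pose n := maxn (boundS u) b.+1.
have un : (boundS u <= n)%N by rewrite leq_maxl.
have bn : (b < n)%N by rewrite leq_max leqnn orbT.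
have an : (a < n)%N by exact: (ltn_trans _ bn).
pose A := Ordinal an; pose B := Ordinal bn.
have AB : A != B by rewrite -val_eqE /= ltn_eqF.
pose d := \sum_(c | (c != A) && (c != B)) ((a < c < b) && (u a < u c < u b))%N.
exists d; split.
  rewrite (lenE un) (lenE (tr_bound un an bn)) /inv2.
  rewrite (sum2_split _ AB) [in RHS](sum2_split _ AB) /= !trEl !trEr.
  have -> : \sum_(i | (i != A) && (i != B)) \sum_(j | (j != A) && (j != B))
     ((i < j) && (tr u a b j < tr u a b i))%N =
     \sum_(i | (i != A) && (i != B)) \sum_(j | (j != A) && (j != B))
     ((i < j) && (u j < u i))%N.
    apply: eq_bigr => i /andP[iA iB]; apply: eq_bigr => j /andP[jA jB].
    by rewrite !trEn.
  have -> : \sum_(c | (c != A) && (c != B))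
     (((a < c) && (tr u a b c < u b)) + ((c < a) && (u b < tr u a b c))
       + ((b < c) && (tr u a b c < u a)) + ((c < b) && (u a < tr u a b c)))%N =
     (\sum_(c | (c != A) && (c != B))
     (((a < c) && (u c < u a)) + ((c < a) && (u a < u c))
       + ((b < c) && (u c < u b)) + ((c < b) && (u b < u c))) + d.*2)%N.
    rewrite /d -muln2 big_distrl -big_split /=; apply: eq_bigr => c /andP[cA cB].
    rewrite !trEn //.
    have ca : u c != u a by apply: contraNneq cA => /(@Sinf_inj u) e; apply/eqP/val_inj.
    have cb : u c != u b by apply: contraNneq cB => /(@Sinf_inj u) e; apply/eqP/val_inj.
    have ca' : (c : nat) != a by [].
    have cb' : (c : nat) != b by [].
    by lia.
  by rewrite !ltnn !ab uab /= ltnNge (ltnW ab) /= ltnNge (ltnW uab) /=; lia.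
rewrite /d sum_nat_eq0; apply/forallP/forallP => [h c|h c].
  have cn : (c < n)%N by exact: (ltn_trans _ bn).
  apply/implyP => ac; have := h (Ordinal cn).
  by rewrite -!val_eqE /= (gtn_eqF ac) (ltn_eqF (ltn_ord c)) /= ac ltn_ord /= eqb0.
apply/implyP => _; rewrite eqb0; apply/negP => /andP[/andP[ac cb]].
by apply/negP; have := h (Ordinal cb); rewrite ac.
Qed.

Definition cov (u : Sinf) (a b : nat) : bool :=
  (a < b)%N && (len (tr u a b) == (len u).+1).

Lemma covP (u : Sinf) a b : cov u a b <->
  [/\ (a < b)%N, (u a < u b)%N
    & forall c, (a < c)%N -> (c < b)%N -> (u c <= u a)%N || (u b <= u c)%N].
Proof.
rewrite /cov; case: (ltnP a b) => ab /=; last by split => // -[].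
have iff_all : [forall c : 'I_b, (a < c)%N ==> ~~ (u a < u c < u b)%N] <->
   forall c, (a < c)%N -> (c < b)%N -> (u c <= u a)%N || (u b <= u c)%N.
  split=> [/forallP h c ac cb|h].
    by have := h (Ordinal cb); rewrite /= ac /= negb_and -!leqNgt.
  by apply/forallP => c; apply/implyP => ac; rewrite negb_and -!leqNgt h.
case: (ltnP (u a) (u b)) => uab.
  have [d [-> hd]] := len_tr ab uab.
  rewrite eqSS -{2}[len u]addn0 eqn_add2l double_eq0 hd.
  by split=> [/iff_all|[_ _ /iff_all]].
split=> [|[]] // => /eqP e; exfalso.
have uba : (tr u a b a < tr u a b b)%N.
  rewrite trEl trEr ltn_neqAle uab andbT.
  by apply/eqP => /(@Sinf_inj u) e1; move: ab; rewrite e1 ltnn.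
by have [d []] := len_tr ab uba; rewrite trK e => e2; lia.
Qed.
Arguments covP {u a b}.

Lemma kcoverE k u ab : kcover k u ab = (ab.1 < k <= ab.2)%N && cov u ab.1 ab.2.
Proof.
rewrite /kcover /cov; case: (boolP (_ < k <= _)) => //= /andP[ak kb].
by rewrite (leq_trans ak kb).
Qed.

Lemma descentP (w : Sinf) i :
  (len (tr w i i.+1)).+1 = len w <-> (w i.+1 < w i)%N.
Proof.
have hc : cov (tr w i i.+1) i i.+1 <-> (w i.+1 < w i)%N.
  split=> [/covP[_]|h]; first by rewrite trEl trEr.
  by apply/covP; rewrite trEl trEr; split=> // c; lia.
rewrite -hc /cov ltnSn /= trK eq_sym; split=> [->|/eqP //].
by rewrite eqxx.
Qed.

Local Open Scope ring_scope.

(** * Operators on functions of a permutation *)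

Section NC.
Variable R : pzRingType.
Let sub (x y : R) : R := x - y.
(** The operators below form a noncommutative ring; these instances make the
    decision procedure for such rings available. *)
Definition ncops : @Ncring.Ring_ops R 0 1 +%R *%R sub -%R eq :=
  @Ncring.Build_Ring_ops _ _ _ _ _ _ _ _.
Lemma ncring : @Ncring.Ring R 0 1 +%R *%R sub -%R eq ncops.
Proof.
split; try exact _.
- exact: add0r.
- exact: addrC.
- exact: addrA.
- exact: mul1r.
- exact: mulr1.
- exact: mulrA.
- exact: mulrDl.
- by move=> x y z; exact: mulrDr.
- by [].
- exact: subrr.
Qed.
End NC.
#[export] Existing Instance ncops.
#[export] Existing Instance ncring.
Ltac ncr := Ncring_tac.non_commutative_ring.

Section OpDef.
Variable A : zmodType.

(** Operators on functions of a permutation that are natural in the values of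
    the functions: they commute with the application of additive maps to these
    values, such as multiplications and isobaric operators. *)
Record op := Op {
  opf :> (Sinf -> A) -> Sinf -> A;
  op_addP : forall F G v, opf (fun x => F x + G x) v = opf F v + opf G v;
  op_natP : forall h : A -> A, {morph h : x y / x + y} ->
     forall F v, opf (fun x => h (F x)) v = h (opf F v)
}.

Lemma op_ext (f g : op) : (forall F v, f F v = g F v) -> f = g.
Proof.
case: f g => f f1 f2 [g g1 g2] /= fg.
have e : f = g.
  by apply: functional_extensionality => F; apply: functional_extensionality => v.
by subst g; congr Op; apply: proof_irrelevance.
Qed.

Lemma morphD0 (h : A -> A) : {morph h : x y / x + y} -> h 0 = 0.
Proof. by move=> hD; apply: (addrI (h 0)); rewrite -hD !addr0. Qed.

Lemma morphDN (h : A -> A) : {morph h : x y / x + y} -> {morph h : x / - x}.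
Proof.
by move=> hD x; apply: (addrI (h x)); rewrite -hD !subrr morphD0.
Qed.

Program Definition op0 : op := @Op (fun _ _ => 0) _ _.
Next Obligation. by rewrite addr0. Qed.
Next Obligation. by rewrite morphD0. Qed.
Program Definition op1 : op := @Op (fun F => F) _ _.
Program Definition opD (f g : op) : op := @Op (fun F v => f F v + g F v) _ _.
Next Obligation. by rewrite !op_addP addrACA. Qed.
Next Obligation. by rewrite !op_natP // H. Qed.
Program Definition opN (f : op) : op := @Op (fun F v => - f F v) _ _.
Next Obligation. by rewrite !op_addP opprD. Qed.
Next Obligation. by rewrite !op_natP // morphDN. Qed.
Program Definition opM (f g : op) : op := @Op (fun F v => f (g F) v) _ _.
Next Obligation.
rewrite -op_addP; congr (f _ v).
by apply: functional_extensionality => x; rewrite op_addP.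
Qed.
Next Obligation.
rewrite -op_natP //; congr (f _ v).
by apply: functional_extensionality => x; rewrite op_natP.
Qed.
End OpDef.

HB.instance Definition _ (A : zmodType) := boolp.gen_eqMixin (op A).
HB.instance Definition _ (A : zmodType) := boolp.gen_choiceMixin (op A).

Section OpRing.
Variable A : zmodType.
Implicit Types f g h : op A.

Fact op_addA : associative (@opD A).
Proof. by move=> f g h; apply: op_ext => F v /=; rewrite addrA. Qed.
Fact op_addC : commutative (@opD A).
Proof. by move=> f g; apply: op_ext => F v /=; rewrite addrC. Qed.
Fact op_add0 : left_id (op0 A) (@opD A).
Proof. by move=> f; apply: op_ext => F v /=; rewrite add0r. Qed.
Fact op_addN : left_inverse (op0 A) (@opN A) (@opD A).
Proof. by move=> f; apply: op_ext => F v /=; rewrite addNr. Qed.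
HB.instance Definition _ :=
  GRing.isZmodule.Build (op A) op_addA op_addC op_add0 op_addN.

Fact op_mulA : associative (@opM A).
Proof. by move=> f g h; apply: op_ext. Qed.
Fact op_mul1 : left_id (op1 A) (@opM A).
Proof. by move=> f; apply: op_ext. Qed.
Fact op_mulr1 : right_id (op1 A) (@opM A).
Proof. by move=> f; apply: op_ext. Qed.
Fact op_mulDl : left_distributive (@opM A) (@opD A).
Proof. by move=> f g h; apply: op_ext. Qed.
Fact op_mulDr : right_distributive (@opM A) (@opD A).
Proof. by move=> f g h; apply: op_ext => F v /=; rewrite -op_addP. Qed.
HB.instance Definition _ := GRing.Zmodule_isPzRing.Build (op A)
  op_mulA op_mul1 op_mulr1 op_mulDl op_mulDr.

Lemma opME f g F v : (f * g) F v = f (g F) v. Proof. by []. Qed.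
Lemma opDE f g F v : (f + g) F v = f F v + g F v. Proof. by []. Qed.
Lemma opNE f F v : (- f) F v = - f F v. Proof. by []. Qed.
Lemma opBE f g F v : (f - g) F v = f F v - g F v. Proof. by []. Qed.
Lemma op1E F v : (1 : op A) F v = F v. Proof. by []. Qed.
Lemma op_sumE (I : Type) (r : seq I) P (f : I -> op A) F v :
  (\sum_(i <- r | P i) f i) F v = \sum_(i <- r | P i) f i F v.
Proof.
by elim/big_rec2: _ => // i x y _ <-.
Qed.

Lemma op_subF f F G v : f (fun x => F x - G x) v = f F v - f G v.
Proof.
rewrite (op_addP f F (fun x => - G x)); congr (_ + _).
by rewrite (@op_natP _ f -%R) // => x y; rewrite opprD.
Qed.

Lemma op_eq f F G v : F =1 G -> f F v = f G v.
Proof. by move=> FG; congr (f _ v); apply: functional_extensionality. Qed.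

(** The projection onto the functions supported on [p]. *)
Definition dg (p : Sinf -> bool) : op A.
Proof.
refine (@Op A (fun F v => if p v then F v else 0) _ _).
- by move=> F G v; case: ifP => //; rewrite addr0.
- by move=> h hD F v; case: ifP => //; rewrite morphD0.
Defined.

(** Composing pullbacks, [T a b * T c d] makes the step [(a, b)] first. *)
Definition T (a b : nat) : op A.
Proof.
refine (@Op A (fun F v => if cov v a b then F (tr v a b) else 0) _ _).
- by move=> F G v; case: ifP => //; rewrite addr0.
- by move=> h hD F v; case: ifP => //; rewrite morphD0.
Defined.

Lemma TE a b F v : T a b F v = if cov v a b then F (tr v a b) else 0.
Proof. by []. Qed.
Lemma dgE p F v : dg p F v = if p v then F v else 0.
Proof. by []. Qed.

End OpRing.

Arguments dg {A} p.
Arguments T {A} a b.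

Section Relations.
Variable A : zmodType.
Local Notation T := (@T A).

(** After the exchange, the values at [a] and [b] are in decreasing order, and
    a diagonal operator does not change that. *)
Lemma T_TT (p : Sinf -> bool) a b : T a b * dg p * T a b = 0.
Proof.
apply: op_ext => F v; rewrite !opME TE; case: ifP => // c1.
rewrite dgE; case: ifP => // _; rewrite TE; case: ifP => // /covP[_].
by rewrite trEl trEr; move/covP: c1 => [_ ? _]; lia.
Qed.

Lemma dg_T (p q : Sinf -> bool) a b :
  (forall v, cov v a b -> p (tr v a b) = q v) -> T a b * dg p = dg q * T a b.
Proof.
move=> pq; apply: op_ext => F v; rewrite !opME TE !dgE TE.
by case: ifP => [c1|]; rewrite ?pq //; case: ifP.
Qed.

End Relations.

(** * Relations between the Bruhat operators *)

Lemma Sinf_neq (u : Sinf) (i j : nat) : i != j -> u i != u j.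
Proof. by apply: contra_neq; apply: Sinf_inj. Qed.

Lemma trfun_cases a b i :
  (i = a /\ trfun a b i = b) \/ (i <> a /\ i = b /\ trfun a b i = a)
  \/ (i <> a /\ i <> b /\ trfun a b i = i).
Proof. by rewrite /trfun; case: (i =P a) => ?; case: (i =P b) => ?; lia. Qed.

(* Decides equalities between products of two transpositions. *)
Ltac gen_trfun := match goal with |- context [trfun ?a ?b ?i] =>
    lazymatch i with
    | context [trfun _ _ _] => fail
    | _ => generalize (trfun_cases a b i); generalize (trfun a b i);
           let x := fresh in let h := fresh in intros x h
    end end.
Ltac tr_lia := rewrite !trE;
  match goal with |- app ?u _ = _ => apply: (f_equal (app u)) end;
  repeat gen_trfun;
  repeat match goal with h : is_true (_ != _) |- _ => move/eqP: h => h end;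
  intuition congruence.

Lemma tr_comm (u : Sinf) (a b c d : nat) : a != c -> a != d -> b != c -> b != d ->
  tr (tr u a b) c d = tr (tr u c d) a b.
Proof.
by move=> ac ad bc bd; apply: Sinf_eqP => i; tr_lia.
Qed.

Lemma cov_comm (u : Sinf) (a b c d : nat) : a != c -> a != d -> b != c -> b != d ->
  cov u a b -> cov (tr u a b) c d -> cov u c d /\ cov (tr u c d) a b.
Proof.
move=> ac ad bc bd /covP[ab uab h1] /covP[cd].
have [ca da cb db] : [/\ c != a, d != a, c != b & d != b].
  by rewrite ![c == _]eq_sym ![d == _]eq_sym.
rewrite !(trEn u) // => ucd h2.
have := (Sinf_neq u ac, Sinf_neq u ad, Sinf_neq u bc, Sinf_neq u bd).
have := h1 c; have := h1 d; have := h2 a; have := h2 b.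
rewrite trEl trEr => h2b h2a h1d h1c [[[n1 n2] n3] n4].
split; apply/covP; split; rewrite ?(trEn u) // => i i1 i2.
  have [ia|ia] := eqVneq i a; first by subst i; lia.
  have [ib|ib] := eqVneq i b; first by subst i; lia.
  by have := h2 i i1 i2; rewrite trEn.
have [ic|ic] := eqVneq i c; first by subst i; rewrite trEl; lia.
have [id|id] := eqVneq i d; first by subst i; rewrite trEr; lia.
by rewrite trEn //; apply: h1.
Qed.

(** A 3-cycle of positions is a product of two transpositions in three ways;
    [tr_cycle1] and [tr_cycle2] are about the two 3-cycles of [a], [m], [b]. *)
Lemma tr_cycle1 (u : Sinf) (a m b : nat) : a != m -> m != b -> a != b ->
  tr (tr u m b) a b = tr (tr u a m) m b /\ tr (tr u a b) a m = tr (tr u a m) m b.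
Proof.
move=> am mb ab.
by split; apply: Sinf_eqP => i; tr_lia.
Qed.

Lemma tr_cycle2 (u : Sinf) (a m b : nat) : a != m -> m != b -> a != b ->
  tr (tr u m b) a m = tr (tr u a m) a b /\ tr (tr u a b) m b = tr (tr u a m) a b.
Proof.
move=> am mb ab.
by split; apply: Sinf_eqP => i; tr_lia.
Qed.

Section Triple.
Variables (u : Sinf) (a m b : nat).
Hypotheses (am : (a < m)%N) (mb : (m < b)%N).

Let ab : (a < b)%N. Proof. exact: ltn_trans mb. Qed.
Let nam : a != m. Proof. by rewrite ltn_eqF. Qed.
Let nma : m != a. Proof. by rewrite gtn_eqF. Qed.
Let nmb : m != b. Proof. by rewrite ltn_eqF. Qed.
Let nbm : b != m. Proof. by rewrite gtn_eqF. Qed.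
Let nab : a != b. Proof. by rewrite ltn_eqF. Qed.
Let nba : b != a. Proof. by rewrite gtn_eqF. Qed.

Let ev3 := (trEl, trEr, trEn u nam nab, trEn u nma nmb, trEn u nba nbm).
Let inj3 := (Sinf_neq u nam, Sinf_neq u nmb, Sinf_neq u nab).

(* Values at a further position [c] are the same in all permutations below. *)
Let evc (c : nat) : c != a -> c != m -> c != b ->
  (tr u m b c = u c) * (tr u a b c = u c) * (tr u a m c = u c).
Proof. by move=> ca cm cb; rewrite !trEn. Qed.

Local Ltac at_pos h h' c :=
  have := h c; have := h' c; have := h m; have := h' m;
  case: (eqVneq c a) => [?|?]; [by subst c; lia|];
  case: (eqVneq c m) => [?|?];
    [by subst c; rewrite ?ev3; move: inj3 => [[? ?] ?]; lia|];
  case: (eqVneq c b) => [?|?]; [by subst c; lia|];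
  match goal with
  | ca : is_true (c != a), cm : is_true (c != m), cb : is_true (c != b) |- _ =>
    have := Sinf_neq u ca; have := Sinf_neq u cm; have := Sinf_neq u cb;
    rewrite ?(evc ca cm cb) ?ev3; move: inj3 => [[? ?] ?]; lia
  end.

Local Ltac cov_by h h' := apply/covP; rewrite ?ev3; split; try lia;
  let c := fresh "c" in intros c ? ?; at_pos h h' c.
Local Ltac order_by h h' :=
  have := h m; have := h' m; rewrite ?ev3; move: inj3 => [[? ?] ?]; lia.

(** Of the factorizations of the first 3-cycle, [(a, m)] then [(m, b)] is a
    chain of covers exactly when one of the two others is, and the order of [u
    m] and [u b] decides which; likewise for the second 3-cycle. *)
Lemma cov_cycle1l : cov u m b -> cov (tr u m b) a b ->
  [/\ cov u a m, cov (tr u a m) m b & (u m < u b)%N].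
Proof.
move: inj3 => [[i1 i2] i3] /covP[_ + h] /covP[_ + h']; rewrite ?ev3 in h' * => l1 l2.
by split; [cov_by h h'..|order_by h h'].
Qed.

Lemma cov_cycle1r : cov u a b -> cov (tr u a b) a m ->
  [/\ cov u a m, cov (tr u a m) m b & (u b < u m)%N].
Proof.
move: inj3 => [[i1 i2] i3] /covP[_ + h] /covP[_ + h']; rewrite ?ev3 in h' * => l1 l2.
by split; [cov_by h h'..|order_by h h'].
Qed.

Lemma cov_cycle1 : cov u a m -> cov (tr u a m) m b ->
  if (u m < u b)%N then cov u m b /\ cov (tr u m b) a b
  else cov u a b /\ cov (tr u a b) a m.
Proof.
move: inj3 => [[i1 i2] i3] /covP[_ + h] /covP[_ + h']; rewrite ?ev3 in h' * => l1 l2.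
by case: ifP => umb; split; cov_by h h'.
Qed.

Lemma cov_cycle2l : cov u a m -> cov (tr u a m) a b ->
  [/\ cov u m b, cov (tr u m b) a m & (u a < u m)%N].
Proof.
move: inj3 => [[i1 i2] i3] /covP[_ + h] /covP[_ + h']; rewrite ?ev3 in h' * => l1 l2.
by split; [cov_by h h'..|order_by h h'].
Qed.

Lemma cov_cycle2r : cov u a b -> cov (tr u a b) m b ->
  [/\ cov u m b, cov (tr u m b) a m & (u m < u a)%N].
Proof.
move: inj3 => [[i1 i2] i3] /covP[_ + h] /covP[_ + h']; rewrite ?ev3 in h' * => l1 l2.
by split; [cov_by h h'..|order_by h h'].
Qed.

Lemma cov_cycle2 : cov u m b -> cov (tr u m b) a m ->
  if (u a < u m)%N then cov u a m /\ cov (tr u a m) a b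
  else cov u a b /\ cov (tr u a b) m b.
Proof.
move: inj3 => [[i1 i2] i3] /covP[_ + h] /covP[_ + h']; rewrite ?ev3 in h' * => l1 l2.
by case: ifP => umb; split; cov_by h h'.
Qed.

End Triple.

Section FK.
Variable A : zmodType.
Local Notation T := (@T A).

Lemma T_comm (a b c d : nat) : a != c -> a != d -> b != c -> b != d ->
  T a b * T c d = T c d * T a b.
Proof.
move=> ac ad bc bd; apply: op_ext => F u; rewrite !opME !TE.
have [ca da cb db] : [/\ c != a, d != a, c != b & d != b].
  by rewrite ![c == _]eq_sym ![d == _]eq_sym.
case: (boolP (cov u a b)) => h1; last first.
  case: (boolP (cov u c d)) => // h2; case: ifP => // h3.
  by have [h4 _] := cov_comm ca cb da db h2 h3; rewrite h4 in h1.
case: (boolP (cov (tr u a b) c d)) => h2.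
  by have [-> ->] := cov_comm ac ad bc bd h1 h2; rewrite tr_comm.
case: (boolP (cov u c d)) => // h3; case: ifP => // h4.
by have [_ h5] := cov_comm ca cb da db h3 h4; rewrite h5 in h2.
Qed.

Variables (a m b : nat).
Hypotheses (am : (a < m)%N) (mb : (m < b)%N).

Let nam : a != m. Proof. by rewrite ltn_eqF. Qed.
Let nmb : m != b. Proof. by rewrite ltn_eqF. Qed.
Let nab : a != b. Proof. by rewrite ltn_eqF // (ltn_trans am). Qed.

(** The sum of the contributions of two chains that exclude each other. *)
Let bool3 (c1 c2 c3 c4 c5 c6 q : bool) (x : A) :
  (c1 -> c2 -> [/\ c5, c6 & q]) -> (c3 -> c4 -> [/\ c5, c6 & ~~ q]) ->
  (c5 -> c6 -> if q then c1 /\ c2 else c3 /\ c4) ->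
  (if c1 then if c2 then x else 0 else 0) + (if c3 then if c4 then x else 0 else 0)
  = (if c5 then if c6 then x else 0 else 0).
Proof.
case: c1; case: c2; case: c3; case: c4; case: c5; case: c6; case: q => //= h1 h2 h3;
  rewrite ?addr0 ?add0r //;
  try (by case: (h1 isT isT)); try (by case: (h2 isT isT)); by case: (h3 isT isT).
Qed.

Lemma T_cycle1 : T m b * T a b + T a b * T a m = T a m * T m b.
Proof.
apply: op_ext => F u; rewrite opDE !opME !TE.
have [-> ->] := tr_cycle1 u nam nmb nab.
apply: (@bool3 _ _ _ _ _ _ (u m < u b)%N).
- exact: cov_cycle1l.
- by move=> h1 h2; have [-> -> h3] := cov_cycle1r am mb h1 h2; split=> //; lia.
- exact: cov_cycle1.
Qed.

Lemma T_cycle2 : T a m * T a b + T a b * T m b = T m b * T a m.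
Proof.
apply: op_ext => F u; rewrite opDE !opME !TE.
have [-> ->] := tr_cycle2 u nam nmb nab.
apply: (@bool3 _ _ _ _ _ _ (u a < u m)%N).
- exact: cov_cycle2l.
- by move=> h1 h2; have [-> -> h3] := cov_cycle2r am mb h1 h2; split=> //; lia.
- exact: cov_cycle2.
Qed.

Lemma T_sq (i j : nat) : T i j * T i j = 0.
Proof.
by rewrite -[RHS](T_TT A xpredT i j); congr (_ * _); apply: op_ext.
Qed.

(** The Yang-Baxter equation: after expansion, the terms of degree two agree by
    the three-term relations, and so do those of degree three because squares
    vanish. *)
Lemma T_braid : (1 + T m b) * (1 + T a b) * (1 + T a m)
  = (1 + T a m) * (1 + T a b) * (1 + T m b).
Proof.
set w := T m b; set u := T a b; set t := T a m.
have e1 : u * t = t * w - w * u by rewrite -T_cycle1 addrC addKr.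
have e2 : t * u = w * t - u * w by rewrite -T_cycle2 addrK.
have e3 : w * u * t = t * u * w.
  by rewrite e2 mulrBl -!mulrA e1 mulrBr [w * (w * u)]mulrA !T_sq mulr0 mul0r.
have expand (x y z : op A) : (1 + x) * (1 + y) * (1 + z)
  = 1 + (x + y + z) + (x * y + y * z) + x * z + x * y * z by ncr.
rewrite !expand e3 T_cycle1 T_cycle2.
by move: (t * w) (w * t) (t * u * w) => *; ncr.
Qed.
End FK.

(** * Elimination in a noncommutative ring *)

(** The setting is that of a row [m] added to the rows [0, ..., m - 1], and of
    a column [b > m]. The projections [em], [fm] (and [eb], [fb]) stand for
    the colours 1 and 0 of the value at [m] (at [b]), [w] for [T m b], [Pm]
    and [Pb] for the products of the [1 + T j m] and [1 + T j b] with [j < m].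
    [Cm] and [Cb] are the column operators with the old rows, and [Cp] is that
    of [b] with the new row. *)
Section Gauss.
Variable R : pzRingType.
Implicit Types x y z : R.
Variables em fm eb fb w Pm Pb Cm Cb Cp : R.
Hypotheses (em_fm : em + fm = 1) (emem : em * em = em)
  (eb_fb : eb + fb = 1) (ebeb : eb * eb = eb)
  (ebem : eb * em = em * eb) (Pbem : Pb * em = em * Pb) (Pmeb : Pm * eb = eb * Pm)
  (wem : w * em = eb * w) (web : w * eb = em * w) (ww : w * w = 0)
  (braid : (1 + w) * Pb * Pm = Pm * Pb * (1 + w))
  (XmCm : (fm + Pm * em) * Cm = 1) (CmXm : Cm * (fm + Pm * em) = 1)
  (XbCb : (fb + Pb * eb) * Cb = 1) (CbXb : Cb * (fb + Pb * eb) = 1)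
  (XpCp : (fb + (1 + w) * Pb * eb) * Cp = 1)
  (CpXp : Cp * (fb + (1 + w) * Pb * eb) = 1).

Let tail x y z : x * y = z -> forall t, x * (y * t) = z * t.
Proof. by move=> <- t; rewrite mulrA. Qed.

Let fmE : fm = 1 - em. Proof. by rewrite -em_fm addrC addKr. Qed.
Let fbE : fb = 1 - eb. Proof. by rewrite -eb_fb addrC addKr. Qed.
Let emfm : em * fm = 0. Proof. by rewrite fmE mulrBr mulr1 emem subrr. Qed.
Let fmem : fm * em = 0. Proof. by rewrite fmE mulrBl mul1r emem subrr. Qed.
Let fmfm : fm * fm = fm. Proof. by rewrite {2}fmE mulrBr mulr1 fmem subr0. Qed.
Let ebfb : eb * fb = 0. Proof. by rewrite fbE mulrBr mulr1 ebeb subrr. Qed.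
Let fbeb : fb * eb = 0. Proof. by rewrite fbE mulrBl mul1r ebeb subrr. Qed.
Let fbfb : fb * fb = fb. Proof. by rewrite {2}fbE mulrBr mulr1 fbeb subr0. Qed.
Let ebfm : eb * fm = fm * eb.
Proof. by rewrite fmE mulrBr mulrBl mulr1 mul1r ebem. Qed.
Let fbem : fb * em = em * fb.
Proof. by rewrite fbE mulrBr mulrBl mulr1 mul1r ebem. Qed.
Let fbfm : fb * fm = fm * fb.
Proof. by rewrite fmE mulrBr mulrBl mulr1 mul1r fbem. Qed.
Let Pbfm : Pb * fm = fm * Pb.
Proof. by rewrite fmE mulrBr mulrBl mulr1 mul1r Pbem. Qed.
Let Pmfb : Pm * fb = fb * Pm.
Proof. by rewrite fbE mulrBr mulrBl mulr1 mul1r Pmeb. Qed.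
Let wfm : w * fm = fb * w.
Proof. by rewrite fmE fbE mulrBr mulrBl mulr1 mul1r wem. Qed.
Let wfb : w * fb = fm * w.
Proof. by rewrite fmE fbE mulrBr mulrBl mulr1 mul1r web. Qed.

Let tail2 x y z t : x * y = z * t -> forall u, x * (y * u) = z * (t * u).
Proof. by move=> h u; rewrite mulrA h mulrA. Qed.
Let Pm_em_eb : Pm * (em * eb) = eb * (Pm * em).
Proof. by rewrite -ebem mulrA Pmeb mulrA. Qed.
Let Pm_fm_eb : Pm * (fm * eb) = eb * (Pm * fm).
Proof. by rewrite -ebfm mulrA Pmeb mulrA. Qed.
Let Pm_em_eb' t : Pm * (em * (eb * t)) = eb * (Pm * (em * t)).
Proof. by rewrite [em * (eb * t)]mulrA -ebem -mulrA mulrA Pmeb -mulrA. Qed.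
Let Pm_fm_eb' t : Pm * (fm * (eb * t)) = eb * (Pm * (fm * t)).
Proof. by rewrite [fm * (eb * t)]mulrA -ebfm -mulrA mulrA Pmeb -mulrA. Qed.

(* Pushes the idempotents to the left as far as the commutations allow. *)
Let nf1 := (emem, emfm, fmem, fmfm, ebeb, ebfb, fbeb, fbfb, ebem, ebfm, fbem,
  fbfm, Pbem, Pbfm, Pmeb, Pmfb, wem, wfm, web, wfb, Pm_em_eb, Pm_fm_eb).
Let nf2 := (tail emem, tail emfm, tail fmem, tail fmfm, tail ebeb, tail ebfb,
  tail fbeb, tail fbfb, tail2 ebem, tail2 ebfm, tail2 fbem, tail2 fbfm,
  tail2 Pbem, tail2 Pbfm, tail2 Pmeb, tail2 Pmfb,
  tail2 wem, tail2 wfm, tail2 web, tail2 wfb, Pm_em_eb', Pm_fm_eb').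
Let nf := (nf1, nf2, mul0r, mulr0, mul1r, mulr1, add0r, addr0).
Let dist := (mulrDl, mulrDr, mulrBl, mulrBr, mulNr, mulrN).

Lemma C_f : Cm * fm = fm.
Proof. by rewrite -[RHS]mul1r -CmXm -mulrA mulrDl -mulrA emfm mulr0 addr0 fmfm. Qed.

Lemma C_Pe : Cm * (Pm * em) = em.
Proof. by rewrite -[RHS]mul1r -CmXm -mulrA mulrDl -mulrA emem fmem add0r. Qed.

Lemma eC_e : em * Cm * em = em * Cm.
Proof. by rewrite -[RHS]mulr1 -em_fm mulrDr -(mulrA em Cm fm) C_f emfm addr0. Qed.

Lemma fC : fm * Cm = fm - fm * Pm * em * Cm.
Proof.
rewrite -[X in X - _]mulr1 -XmCm !mulrDl !mulrDr mulrA fmfm !mulrA.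
by rewrite addrK.
Qed.

Lemma ePeC : em * (Pm * (em * Cm)) = em.
Proof.
rewrite -[RHS]mulr1 -XmCm mulrDl mulrDr (mulrA em fm) emfm mul0r add0r.
by rewrite !mulrA.
Qed.

Lemma Cm_eb : Cm * eb = eb * Cm.
Proof.
have h : eb * (fm + Pm * em) = (fm + Pm * em) * eb.
  by rewrite mulrDr mulrDl ebfm -!mulrA -ebem !mulrA Pmeb.
by rewrite -[LHS]mulr1 -XmCm mulrA -(mulrA Cm) h mulrA CmXm mul1r.
Qed.

Let braid' t : Pb * (Pm * t) + w * (Pb * (Pm * t)) = Pm * (Pb * t) + Pm * (Pb * (w * t)).
Proof. by have := congr1 (fun x => x * t) braid; rewrite !dist ?mul1r ?mulr1 ?dist -!mulrA. Qed.

Let Ce t : Cm * (eb * t) = eb * (Cm * t). Proof. by rewrite mulrA Cm_eb mulrA. Qed.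
Let Cf t : Cm * (fm * t) = fm * t. Proof. by rewrite mulrA C_f. Qed.
Let eCe t : em * (Cm * (em * t)) = em * (Cm * t). Proof. by rewrite !mulrA eC_e. Qed.
Let CPe t : Cm * (Pm * (em * t)) = em * t. Proof. by rewrite -[in RHS]C_Pe !mulrA. Qed.
Let Cm_fb : Cm * fb = fb * Cm.
Proof. by rewrite fbE mulrBr mulrBl mulr1 mul1r Cm_eb. Qed.
Let nfC := (Cm_eb, Ce, Cm_fb, C_f, Cf, eCe, eC_e, CPe, C_Pe).

(** Moving the column [m] across the column [b] when the new row [m] starts with
    colour 0. The inverse of [Cm], put on the right, leaves an identity between
    [Pm], [Pb] and [w] that follows from two instances of the braid relation. *)
Lemma gauss_key : fm * eb * Pb * eb * Cm = fm * Cm * eb * (1 + w) * Pb * eb.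
Proof.
suff -> : fm * eb * Pb * eb = fm * Cm * eb * (1 + w) * Pb * eb * (fm + Pm * em).
  by rewrite -mulrA XmCm mulr1.
have key := congr1 (fun x => fm * (eb * x)) (braid' (em * eb)).
have key2 := congr1 (fun x => fm * (Pm * (em * (Cm * (em * (eb * x)))))) (braid' (em * eb)).
rewrite fC ?(dist, nf) -?mulrA ?(nf, nfC).
rewrite ?(dist, nf) -?mulrA ?(nf, nfC) in key key2.
by rewrite ?(subr0, oppr0, addr0, add0r) key -opprD key2 subrr addr0.
Qed.

Let Cbf : Cb * fb = fb.
Proof. by rewrite -[RHS]mul1r -CbXb -mulrA mulrDl -mulrA ebfb mulr0 addr0 fbfb. Qed.
Let eCb_e : eb * Cb * eb = eb * Cb.
Proof. by rewrite -[RHS]mulr1 -eb_fb mulrDr -(mulrA eb Cb fb) Cbf ebfb addr0. Qed.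
Let Cb_em : Cb * em = em * Cb.
Proof.
have h : em * (fb + Pb * eb) = (fb + Pb * eb) * em.
  by rewrite mulrDr mulrDl fbem -!mulrA ebem !mulrA Pbem.
by rewrite -[LHS]mulr1 -XbCb mulrA -(mulrA Cb) h mulrA CbXb mul1r.
Qed.
Let Cbem t : Cb * (em * t) = em * (Cb * t). Proof. by rewrite mulrA Cb_em mulrA. Qed.
Let EB : em * eb * Cb = em * eb * Cb * (em * eb).
Proof.
have eCb' : eb * (Cb * eb) = eb * Cb by rewrite mulrA eCb_e.
by rewrite -!mulrA Cbem (mulrA eb em) ebem -mulrA (mulrA em em) emem eCb'.
Qed.
Let EW : em * eb * (1 - w) = em * eb * (1 - w) * (em * eb).
Proof. by rewrite ?(dist, nf) -?mulrA ?nf. Qed.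

Let w_inv : (1 + w) * (1 - w) = 1.
Proof. by rewrite mulrBr mulr1 mulrDl mul1r ww addr0 addrK. Qed.
Let inv_w : (1 - w) * (1 + w) = 1.
Proof. by rewrite mulrDr mulr1 mulrBl mul1r ww subr0 subrK. Qed.

Let stab E x y : E * x = E * x * E -> E * y = E * y * E ->
  E * (x * y) = E * (x * y) * E.
Proof.
by move=> hx hy; rewrite !(mulrA E) {1}hx -(mulrA (E * x) E y) {1}hy !mulrA -hx.
Qed.

(** Where [m] and [b] both carry colour 1, the columns commute up to the
    factor [1 - w]: this is the braid relation for the inverses of both sides,
    which can be inverted because [gauss_stabl] and [gauss_stabr] keep the
    colours of [m] and [b] equal to 1. *)
Lemma gauss_comm : em * eb * (Cm * Cb * (1 - w)) = em * eb * ((1 - w) * Cb * Cm).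
Proof.
set E := em * eb; pose Xm := fm + Pm * em; pose Xb := fb + Pb * eb.
have XX : E * ((1 + w) * Xb * Xm) = E * (Xm * Xb * (1 + w)).
  have key := congr1 (fun x => em * (eb * x)) (braid' (em * eb)).
  have Pmf t : Pm * (em * (fb * t)) = fb * (Pm * (em * t)).
    by rewrite [em * (fb * t)]mulrA -fbem -mulrA mulrA Pmfb -mulrA.
  rewrite ?(dist, nf) -?mulrA ?(nf, Pmf) in key.
  have Pmf0 : Pm * (em * fb) = fb * (Pm * em).
    by rewrite -fbem mulrA Pmfb mulrA.
  by rewrite /E /Xm /Xb ?(dist, nf) -?mulrA ?(nf, Pmf, Pmf0) key.
have E' : E = eb * em by rewrite ebem.
have EC : E * Cm = E * Cm * E.
  rewrite {2}E' /E !mulrA -(mulrA (eb * em) Cm) -2!(mulrA eb) (mulrA em) eC_e.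
  by rewrite -!mulrA Cm_eb [em * (eb * Cm)]mulrA -ebem !mulrA ebeb.
have EE : E * (Cm * Cb * (1 - w)) = E * (Cm * Cb * (1 - w)) * E.
  by apply: (stab (stab EC EB) EW).
have inv1 : Cm * Cb * (1 - w) * ((1 + w) * Xb * Xm) = 1.
  by rewrite -!mulrA (mulrA (1 - w)) inv_w mul1r (mulrA Cb) CbXb mul1r.
have inv2 : Xm * Xb * (1 + w) * ((1 - w) * Cb * Cm) = 1.
  by rewrite -!mulrA (mulrA (1 + w)) w_inv mul1r (mulrA Xb) XbCb mul1r.
move: (E) XX EE => {EC E'} E XX EE.
move: (Cm * Cb * (1 - w)) (_ * _ * (1 + w)) ((1 - w) * Cb * Cm) ((1 + w) * Xb * Xm)
  inv1 inv2 XX EE => A P Q P' inv1 inv2 XX EE.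
rewrite EE -[LHS]mulr1 -inv2 -(mulrA _ E) (mulrA E P) -XX.
by rewrite (mulrA _ _ Q) (mulrA _ E P') -EE -(mulrA E) inv1 mulr1.
Qed.

Lemma gauss_stabl : em * eb * (Cb * (1 - w)) = em * eb * (Cb * (1 - w)) * (em * eb).
Proof. exact: (stab EB EW). Qed.

Lemma gauss_stabr : em * eb * ((1 - w) * Cb) = em * eb * ((1 - w) * Cb) * (em * eb).
Proof. exact: (stab EW EB). Qed.

Let g := em + fm * Cm.

(** Adding the row [m] to the column [b]: after conjugation by [g], a new row
    that starts with colour 0 is transparent, while one that starts with
    colour 1 contributes the factor [1 - w]. *)
Lemma gauss_conj : eb * g * Cp = eb * (fm * Cb + em * Cb * (1 - w)) * g.
Proof.
have h : eb * g * (fb + (1 + w) * Pb * eb)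
    = eb * (fm * (fb + Pb * eb) + em * (1 + w) * (fb + Pb * eb)) * g.
  rewrite /g.
  have key := gauss_key; rewrite ?(dist, nf) -?mulrA ?(nf, nfC) in key.
  rewrite ?(dist, nf) -?mulrA ?(nf, nfC).
  by rewrite key.
pose D := fm * (fb + Pb * eb) + em * (1 + w) * (fb + Pb * eb).
pose D' := fm * Cb + em * Cb * (1 - w).
have Cbfm : Cb * fm = fm * Cb by rewrite fmE mulrBr mulrBl mulr1 mul1r Cb_em.
have D'e : eb * D' = eb * D' * eb.
  rewrite /D' mulrDr mulrDl; congr (_ + _).
    by rewrite mulrA ebfm -!mulrA (mulrA eb Cb eb) eCb_e.
  rewrite !mulrA ebem; have := stab EB EW; rewrite !mulrA => ->.
  by rewrite -!mulrA ebeb.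
have D'D : eb * D' * D = eb.
  rewrite /D /D'.
  move: (fb + Pb * eb) CbXb => Xb CX.
  have p1 : eb * (fm * Cb) * (fm * Xb + em * (1 + w) * Xb) = eb * fm.
    rewrite mulrDr -!mulrA (mulrA Cb fm) Cbfm Cbem -!mulrA CX mulr1.
    by rewrite fmfm (mulrA fm em) fmem mul0r mulr0 addr0.
  have p2 : em * eb * (fm * Xb + em * (1 + w) * Xb) = em * eb * ((1 + w) * Xb).
    by rewrite mulrDr !mulrA -(mulrA em eb fm) ebfm mulrA emfm !mul0r add0r
      -(mulrA em eb em) ebem mulrA emem.
  have p3 : em * eb * (Cb * (1 - w)) * (fm * Xb + em * (1 + w) * Xb) = em * eb.
    rewrite (stab EB EW) -mulrA p2 mulrA -(stab EB EW) -!mulrA.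
    by rewrite (mulrA (1 - w)) inv_w mul1r CX mulr1.
  rewrite (mulrDr eb) mulrDl p1 -(mulrA em) mulrA ebem p3.

  by rewrite -ebem -mulrDr addrC em_fm mulr1.
have -> : eb * g * Cp = eb * D' * D * g * Cp by rewrite D'D.
rewrite D'e -!mulrA (mulrA eb D) (mulrA (eb * D)) -h -mulrA XpCp mulr1.
by rewrite !mulrA -D'e.
Qed.
End Gauss.

(** * Column operators *)

Section Lowering.
Variable A : zmodType.
Variable D : Sinf -> nat.

(** Such operators strictly lower the measure [D] along chains, and hence are
    locally nilpotent. *)
Definition low (Q : op A) : Prop :=
  forall F u, (forall u', (D u' < D u)%N -> F u' = 0) -> Q F u = 0.

Lemma lowD Q1 Q2 : low Q1 -> low Q2 -> low (Q1 + Q2).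
Proof. by move=> h1 h2 F u h; rewrite opDE h1 // h2 // addr0. Qed.

Lemma lowM Q1 Q2 : low Q1 -> low Q2 -> low (Q1 * Q2).
Proof.
move=> h1 h2 F u h; rewrite opME h1 // => u' hu'; apply: h2 => u'' hu''.
by apply: h; apply: ltn_trans hu'.
Qed.

Lemma low_dg Q p : low Q -> low (Q * dg p).
Proof.
move=> h1 F u h; rewrite opME h1 // => u' hu'; rewrite dgE.
by case: ifP => // _; apply: h.
Qed.

Lemma low_T a b : (forall u, cov u a b -> (D (tr u a b) < D u)%N) -> low (T a b).
Proof. by move=> h F u hF; rewrite TE; case: ifP => // /h /hF. Qed.

Lemma low_exp Q n F u : low Q -> (D u < n)%N -> (Q ^+ n) F u = 0.
Proof.
move=> hQ; elim: n u => // n IHn u; rewrite ltnS => hu.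
by rewrite exprS opME hQ // => u' hu'; apply: IHn; apply: leq_trans hu.
Qed.

Lemma low_local Q F G u : low Q -> (forall u', (D u' < D u)%N -> F u' = G u') ->
  Q F u = Q G u.
Proof.
move=> hQ h; apply/eqP; rewrite -subr_eq0 -op_subF hQ // => u' hu'.
by rewrite h // subrr.
Qed.

Lemma low_nil Q n : low Q -> (forall u, (D u < n)%N) -> Q ^+ n = 0.
Proof. by move=> hQ h; apply: op_ext => F u; apply: low_exp. Qed.
End Lowering.

(** A finite geometric series; it inverts [x] when [x - 1] is nilpotent. *)
Definition unip_inv (R : pzRingType) (n : nat) (x : R) : R :=
  \sum_(i < n) (1 - x) ^+ i.

Lemma unip_invP (R : pzRingType) n (x : R) : (x - 1) ^+ n = 0 ->
  x * unip_inv n x = 1 /\ unip_inv n x * x = 1.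
Proof.
move=> h; have h' : (1 - x) ^+ n = 0.
  by rewrite -opprB exprNn h mulr0.
have e : x * unip_inv n x = 1.
  have := subrX1 (1 - x) n; rewrite h' -/(unip_inv n x).
  rewrite [1 - x]addrC addrK mulNr sub0r => /eqP; rewrite eqr_opp => /eqP <- //.
split=> //; rewrite -[RHS]e; symmetry; apply: commr_sum => i _; apply: commrX.
by apply: commrB; [apply: commr1 | apply: commr_refl].
Qed.

Lemma comm_inv (R : pzRingType) (x y z : R) : y * z = 1 -> z * y = 1 ->
  GRing.comm x y -> GRing.comm x z.
Proof.
move=> yz zy xy; rewrite /GRing.comm -[x * z]mul1r -zy -[LHS]mulrA (mulrA y) -xy.
by rewrite -(mulrA x) yz mulr1.
Qed.

Section Columns.
Variable A : zmodType.
Local Notation T := (@T A).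

(** The sum over the chains in the column [b] whose rows decrease. *)
Fixpoint Pi (k b : nat) : op A :=
  if k is j.+1 then (1 + T j b) * Pi j b else 1.

Lemma comm_Pi (x : op A) k b : (forall j, (j < k)%N -> GRing.comm x (T j b)) ->
  GRing.comm x (Pi k b).
Proof.
elim: k => [|k IHk] h /=; first exact: commr1.
apply: commrM; last by apply: IHk => j /ltnW; apply: h.
by apply: commrD; [apply: commr1 | apply: h].
Qed.

Lemma T_Pi_comm i j k b : (k <= i)%N -> (i != b) -> (j != b) -> (k <= j)%N ->
  GRing.comm (T i j) (Pi k b).
Proof.
move=> ki ib jb kj; apply: comm_Pi => a ak; apply: T_comm => //.
  by rewrite gtn_eqF // (leq_trans ak).
by rewrite gtn_eqF // (leq_trans ak).
Qed.

(** The Yang-Baxter equation for the columns [m] and [b], row by row. *)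
Lemma Pi_braid j m b : (j <= m)%N -> (m < b)%N ->
  (1 + T m b) * Pi j b * Pi j m = Pi j m * Pi j b * (1 + T m b).
Proof.
move=> jm mb; elim: j jm => [|j IHj] jm /=; first by rewrite !mulr1 !mul1r.
have jb : (j < b)%N by apply: ltn_trans mb.
have c1 : GRing.comm (1 + T j m) (Pi j b).
  apply: commr_sym; apply: commrD; [exact: commr1 | apply: commr_sym].
  by apply: T_Pi_comm; rewrite ?ltn_eqF //; lia.
have c2 : GRing.comm (1 + T j b) (Pi j m).
  apply: commr_sym; apply: commrD; [exact: commr1 | apply: commr_sym].
  by apply: T_Pi_comm; lia.
move: (IHj (ltnW jm)) (T_braid A jm mb) c1 c2; rewrite /GRing.comm.
move: (1 + T m b) (1 + T j b) (1 + T j m) (Pi j b) (Pi j m) => x y z p q IH br c1 c2.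
have -> : x * (y * p) * (z * q) = x * y * (p * z) * q by rewrite !mulrA.
by rewrite -c1 (mulrA (x * y)) br -!mulrA (mulrA x p) IH !mulrA -(mulrA z y q) c2 !mulrA.
Qed.

Section Coloured.
Variable S : nat -> bool.

(** [S] is the set of the values of colour 0; [e b] and [fo b] project onto
    the permutations whose value at [b] has colour 1 and 0. *)
Definition e (b : nat) : op A := dg (fun v => ~~ S (v b)).
Definition fo (b : nat) : op A := dg (fun v => S (v b)).

Lemma dgM (p q : Sinf -> bool) : dg p * dg q = dg (fun v => p v && q v) :> op A.
Proof. by apply: op_ext => F v; rewrite opME !dgE; case: (p v); case: (q v). Qed.

Lemma dgC (p q : Sinf -> bool) : GRing.comm (dg p : op A) (dg q).
Proof. by apply: op_ext => F v; rewrite !opME !dgE; case: (p v); case: (q v). Qed.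

Lemma e_fo b : e b + fo b = 1.
Proof. by apply: op_ext => F v; rewrite opDE !dgE; case: (S _); rewrite ?add0r ?addr0. Qed.

Lemma fo_e b : fo b = 1 - e b.
Proof. by rewrite -(e_fo b) addrC addKr. Qed.

Lemma e_idem b : e b * e b = e b.
Proof. by rewrite /e dgM; congr dg; apply: functional_extensionality => v; rewrite andbb. Qed.

Lemma e_T (i j b : nat) : b != i -> b != j -> GRing.comm (e b) (T i j).
Proof. by move=> bi bj; rewrite /GRing.comm (@dg_T A _ (fun v => ~~ S (v b))) // => v _; rewrite trEn. Qed.

Lemma T_er i j : T i j * e j = e i * T i j.
Proof. by apply: dg_T => v _; rewrite trEr. Qed.

Lemma T_el i j : T i j * e i = e j * T i j.
Proof. by apply: dg_T => v _; rewrite trEl. Qed.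

Lemma e_Pi b k c : (k <= b)%N -> b != c -> GRing.comm (e b) (Pi k c).
Proof. by move=> kb bc; apply: comm_Pi => j jk; apply: e_T => //; lia. Qed.

(** The column operator is defined by its inverse [Xc], which has an explicit
    form. *)
Definition Xc (k b : nat) : op A := fo b + Pi k b * e b.

(** The signed sum of the chains in the column [b] that obey the colour rule,
    see [VjS]. *)
Definition Cc (k b : nat) : op A := unip_inv k.+1 (Xc k b).

Lemma XcE k b : Xc k b - 1 = (Pi k b - 1) * e b.
Proof. rewrite /Xc fo_e.
by move: (Pi k b) (e b) => x y; ncr.
Qed.

Lemma low_Pi D k b :
  (forall a u, (a < k)%N -> cov u a b -> (D (tr u a b) < D u)%N) -> low D (Pi k b - 1).
Proof.
elim: k => [|k IHk] h /=; first by rewrite subrr => F u.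
have h1 : low D (Pi k b - 1) by apply: IHk => a u /ltnW; apply: h.
have h2 : low D (T k b) by apply: low_T => u; apply: h.
have -> : (1 + T k b) * Pi k b - 1 = T k b + T k b * (Pi k b - 1) + (Pi k b - 1).
  by move: (T k b) (Pi k b) => x y; ncr.
by apply: lowD => //; apply: lowD => //; apply: lowM.
Qed.

Lemma low_X D k b :
  (forall a u, (a < k)%N -> cov u a b -> (D (tr u a b) < D u)%N) -> low D (Xc k b - 1).
Proof. by move=> h; rewrite XcE; apply: low_dg; apply: low_Pi. Qed.

(** A cover in the column [b] decreases the number of rows with a value below
    that of the column. *)
Lemma X_nil k b : (Xc k b - 1) ^+ k.+1 = 0.
Proof.
pose D (u : Sinf) := (\sum_(a < k) (u a < u b))%N.
apply: (@low_nil _ D).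
  apply: low_X => a u ak /covP[ab uab _]; rewrite /D.
  rewrite [X in (X < _)%N](bigD1 (Ordinal ak)) //= [X in (_ < X)%N](bigD1 (Ordinal ak)) //=.
  rewrite trEl trEr uab; have -> : (u b < u a)%N = false by lia.
  rewrite add0n add1n ltnS.
  apply: leq_sum => i ia; have ia' : (i : nat) != a by [].
  have [ib|ib] := eqVneq (i : nat) b; first by rewrite ib trEr ltnn.
  by rewrite trEn //; case: (ltnP (u i) (u a)) => // h; rewrite (ltn_trans h).
move=> u; rewrite ltnS; suff : (D u <= \sum_(a < k) 1)%N by rewrite sum1_card card_ord.
by apply: leq_sum => i _; apply: leq_b1.
Qed.

Lemma XC k b : Xc k b * Cc k b = 1.
Proof. by have [] := unip_invP (X_nil k b). Qed.
Lemma CX k b : Cc k b * Xc k b = 1.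
Proof. by have [] := unip_invP (X_nil k b). Qed.

Lemma comm_C (x : op A) k b : GRing.comm x (fo b) -> GRing.comm x (Pi k b) ->
  GRing.comm x (e b) -> GRing.comm x (Cc k b).
Proof.
move=> h1 h2 h3; apply: comm_inv (XC k b) (CX k b) _.
by apply: commrD => //; apply: commrM.
Qed.

Lemma fo_T i j b : b != i -> b != j -> GRing.comm (fo b) (T i j).
Proof.
move=> bi bj; rewrite fo_e; apply: commr_sym; apply: commrB; first exact: commr1.
by apply: commr_sym; apply: e_T.
Qed.

Lemma T_C i j k b : (k <= i)%N -> i != b -> j != b -> (k <= j)%N ->
  GRing.comm (T i j) (Cc k b).
Proof.
move=> ki ib jb kj; apply: comm_C.
- by apply: commr_sym; apply: fo_T; rewrite eq_sym.
- exact: T_Pi_comm.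
- by apply: commr_sym; apply: e_T; rewrite eq_sym.
Qed.

Lemma e_C b k c : (k <= b)%N -> b != c -> GRing.comm (e b) (Cc k c).
Proof. by move=> kb bc; apply: comm_C; [exact: dgC | exact: e_Pi | exact: dgC]. Qed.

Lemma fo_C b k c : (k <= b)%N -> b != c -> GRing.comm (fo b) (Cc k c).
Proof.
move=> kb bc; rewrite fo_e; apply: commr_sym; apply: commrB; first exact: commr1.
by apply: commr_sym; apply: e_C.
Qed.

(** Conjugation by this element compares the columns with and without the row
    [k], see [cols_conj]. *)
Definition gk (k : nat) : op A := e k + fo k * Cc k k.

Section Instances.
Variables k b : nat.
Hypothesis kb : (k < b)%N.
Let nkb : k != b. Proof. by rewrite ltn_eqF. Qed.
Let ebek : e b * e k = e k * e b. Proof. exact: dgC. Qed.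
Let Pbek : Pi k b * e k = e k * Pi k b. Proof. by symmetry; apply: e_Pi nkb. Qed.
Let Pkeb : Pi k k * e b = e b * Pi k k. Proof. by symmetry; apply: e_Pi; [exact: ltnW|rewrite gtn_eqF]. Qed.
Let XpE : fo b + (1 + T k b) * Pi k b * e b = Xc k.+1 b. Proof. by []. Qed.
Let XpCp : (fo b + (1 + T k b) * Pi k b * e b) * Cc k.+1 b = 1. Proof. by rewrite XpE XC. Qed.

Lemma col_conj : e b * gk k * Cc k.+1 b
  = e b * (fo k * Cc k b + e k * Cc k b * (1 - T k b)) * gk k.
Proof.
rewrite /gk; exact: (gauss_conj (e_fo k) (e_idem k) (e_fo b) (e_idem b) ebek Pbek Pkeb
  (T_el k b) (T_er k b) (T_sq A k b) (Pi_braid (leqnn k) kb) (XC k k) (CX k k)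
  (XC k b) (CX k b) XpCp).
Qed.

Lemma col_comm : e k * e b * (Cc k k * Cc k b * (1 - T k b))
  = e k * e b * ((1 - T k b) * Cc k b * Cc k k).
Proof.
exact: (gauss_comm (e_fo k) (e_idem k) (e_fo b) (e_idem b) ebek Pbek Pkeb
  (T_el k b) (T_er k b) (T_sq A k b) (Pi_braid (leqnn k) kb) (XC k k) (CX k k)
  (XC k b) (CX k b)).
Qed.

Lemma col_stabl : e k * e b * (Cc k b * (1 - T k b))
  = e k * e b * (Cc k b * (1 - T k b)) * (e k * e b).
Proof.
exact: (gauss_stabl (e_idem k) (e_fo b) (e_idem b) ebek Pbek
  (T_el k b) (T_er k b) (XC k b) (CX k b)).
Qed.

Lemma col_stabr : e k * e b * ((1 - T k b) * Cc k b)
  = e k * e b * ((1 - T k b) * Cc k b) * (e k * e b).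
Proof.
exact: (gauss_stabr (e_idem k) (e_fo b) (e_idem b) ebek Pbek
  (T_el k b) (T_er k b) (XC k b) (CX k b)).
Qed.

End Instances.

(** Products over a sequence of columns, in the order in which the columns
    are met along a chain. *)
Definition As k (s : seq nat) : op A := \prod_(b <- s) Cc k b.
Definition Bs m (s : seq nat) : op A := \prod_(b <- s) (1 - T m b).
Definition Es (s : seq nat) : op A := \prod_(b <- s) e b.

Lemma comm_prodl (x : op A) (s : seq nat) (f : nat -> op A) :
  (forall b, b \in s -> GRing.comm x (f b)) -> GRing.comm x (\prod_(b <- s) f b).
Proof.
move=> h; rewrite big_seq; apply: (big_ind (GRing.comm x)) => //.
- exact: commr1.
- by move=> y z; apply: commrM.
Qed.

Lemma comm_Es (x : op A) (s : seq nat) :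
  (forall b, b \in s -> GRing.comm x (e b)) -> GRing.comm x (Es s).
Proof. exact: comm_prodl. Qed.

Lemma comm1B (x y : op A) : GRing.comm x y -> GRing.comm x (1 - y).
Proof. by move=> h; apply: commrB => //; apply: commr1. Qed.

Lemma comm_Bs (x : op A) m (s : seq nat) :
  (forall b, b \in s -> GRing.comm x (T m b)) -> GRing.comm x (Bs m s).
Proof. by move=> h; apply: comm_prodl => b /h; apply: comm1B. Qed.

Lemma eT1_comm k b c : b != k -> b != c -> GRing.comm (e b) (1 - T k c).
Proof. by move=> bk bc; apply: comm1B; apply: e_T. Qed.

Lemma gk_e k b : (k < b)%N -> GRing.comm (e b) (gk k).
Proof.
move=> kb; rewrite /gk; apply: commrD; first exact: dgC.
by apply: commrM; [exact: dgC | apply: e_C; lia].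
Qed.

(** [gauss_conj] column by column. The projections [Es] commute with the other
    columns, and the factors [1 - T k b] of the new row collect in [Bs]. *)
Lemma cols_conj k s : uniq s -> all (fun b => (k < b)%N) s ->
  Es s * gk k * As k.+1 s
  = Es s * (fo k * As k s + e k * As k s * Bs k s) * gk k.
Proof.
elim: s => [_ _|b s IHs] /=.
  by rewrite /Es /As /Bs !big_nil !mulr1 mul1r [fo k + _]addrC e_fo !mul1r.
move=> /andP[bs us] /andP[kb ks]; have {IHs} IH := IHs us ks.
rewrite /Es /As /Bs !big_cons -/(Es s) -/(As k s) -/(As k.+1 s) -/(Bs k s).
have nb c : c \in s -> c != b /\ (k < c)%N.
  move=> cs; split; last exact: (allP ks).
  by apply: contraNneq bs => <-.
have cE1 : GRing.comm (gk k * Cc k.+1 b) (Es s).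
  apply: comm_Es => c /nb[cb kc]; apply: commr_sym; apply: commrM; first exact: gk_e.
  by apply: e_C.
pose U := fo k * Cc k b + e k * Cc k b * (1 - T k b).
have cE2 : GRing.comm U (Es s).
  apply: comm_Es => c /nb[cb kc]; apply: commr_sym; apply: commrD.
    by apply: commrM; [exact: dgC | apply: e_C; lia].
  apply: commrM; first by apply: commrM; [exact: dgC | apply: e_C; lia].
  by apply: eT1_comm; lia.
have cR : GRing.comm (As k s) (1 - T k b).
  apply: commr_sym; apply: comm_prodl => c /nb[cb kc]; apply: commr_sym.
  by apply: comm1B; apply: commr_sym; apply: T_C; lia.
have cC : GRing.comm (fo k) (Cc k b) by apply: fo_C; lia.
have -> : e b * Es s * gk k * (Cc k.+1 b * As k.+1 s)
    = e b * (Es s * (gk k * Cc k.+1 b)) * As k.+1 s by rewrite !mulrA.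
rewrite -cE1 !mulrA (col_conj kb) -/U -(mulrA _ (gk k)) -(mulrA _ _ (As _ _)).
have -> : gk k * Es s = Es s * gk k.
  by apply: comm_Es => c /nb[cb kc]; apply: commr_sym; apply: gk_e.
rewrite IH !(mulrA _ _ (gk k)); congr (_ * _).
have bE : e b * Es s = Es s * e b by apply: comm_Es => c _; apply: dgC.
rewrite mulrA -(mulrA (e b)) cE2 mulrA bE -!(mulrA (Es s)); congr (_ * _).
have eC : e k * Cc k b = Cc k b * e k by apply: e_C; lia.
have ebk : e b * e k = e k * e b by exact: dgC.
have fe : fo k * e k = 0 by rewrite fo_e mulrBl mul1r e_idem subrr.
have ef : e k * fo k = 0 by rewrite fo_e mulrBr mulr1 e_idem subrr.
have ff : fo k * fo k = fo k by rewrite {2}fo_e mulrBr mulr1 fe subr0.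
rewrite /U (mulrDr (e b)) (mulrDl (e b * _)) [in RHS]mulrDr; congr (_ + _).
  by rewrite mulrDr cC -!mulrA !(mulrA (fo k)) ff fe !mul0r !mulr0 addr0 (mulrA (Cc k b)) -cC !mulrA.
have st : e b * (e k * Cc k b * (1 - T k b)) * (e k * e b)
    = e b * (e k * Cc k b * (1 - T k b)).
  by have := col_stabl kb; rewrite !mulrA -ebk => <-.
rewrite -st -(mulrA _ (e k * e b)).
have -> : e k * e b * (fo k * As k s + e k * As k s * Bs k s)
    = e k * e b * (As k s * Bs k s).
  rewrite -ebk -!mulrA mulrDr !(mulrA (e k)) ef e_idem mul0r add0r.
  by rewrite -!mulrA.
rewrite mulrA st -!mulrA (mulrA (1 - T k b)) -cR.
by rewrite -!mulrA.
Qed.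

(** [gauss_comm] column by column. *)
Lemma cols_comm k s : uniq s -> all (fun b => (k < b)%N) s ->
  e k * Es s * (Cc k k * As k s * Bs k s) = e k * Es s * (Bs k s * As k s * Cc k k).
Proof.
elim: s => [_ _|b s IHs] /=.
  by rewrite /Es /As /Bs !big_nil !mulr1 !mul1r.
move=> /andP[bs us] /andP[kb ks]; have {IHs} IH := IHs us ks.
rewrite /Es /As /Bs !big_cons -/(Es s) -/(As k s) -/(Bs k s).
have nb c : c \in s -> c != b /\ (k < c)%N.
  move=> cs; split; last exact: (allP ks).
  by apply: contraNneq bs => <-.
have cE1 : GRing.comm (Cc k k * Cc k b * (1 - T k b)) (Es s).
  apply: comm_Es => c /nb[cb kc]; apply: commr_sym; apply: commrM.
    by apply: commrM; apply: e_C; lia.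
  by apply: eT1_comm; lia.
have cE2 : GRing.comm ((1 - T k b) * Cc k b) (Es s).
  apply: comm_Es => c /nb[cb kc]; apply: commr_sym; apply: commrM.
    by apply: eT1_comm; lia.
  by apply: e_C; lia.
have cR : GRing.comm (As k s) (1 - T k b).
  apply: commr_sym; apply: comm_prodl => c /nb[cb kc]; apply: commr_sym.
  by apply: comm1B; apply: commr_sym; apply: T_C; lia.
have cB : GRing.comm (Cc k b) (Bs k s).
  by apply: comm_Bs => c /nb[cb kc]; apply: commr_sym; apply: T_C; lia.
have bE : e b * Es s = Es s * e b by apply: comm_Es => c _; apply: dgC.
have kE : e k * Es s = Es s * e k by apply: comm_Es => c _; apply: dgC.
have ebk : e b * e k = e k * e b by exact: dgC.
have cM : GRing.comm (Cc k k) (Es s).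
  by apply: comm_Es => c /nb[cb kc]; apply: commr_sym; apply: e_C; lia.
have := col_comm kb; have := col_stabr kb; rewrite /GRing.comm in cE1 cE2 cR cB cM.
move: (Cc k k) (Cc k b) (1 - T k b) (As k s) (Bs k s) (Es s) (e k) (e b)
  IH cE1 cE2 cR cB cM bE ebk.
move=> cm cb r a bb E ek eb IH cE1 cE2 cR cB cM bE ebk st co.
have -> : ek * (eb * E) * (cm * (cb * a) * (r * bb))
    = ek * eb * (E * (cm * cb * r)) * (a * bb).
  by rewrite !mulrA -(mulrA _ a r) cR !mulrA.
rewrite -cE1 (mulrA (ek * eb)) co.
have -> : ek * eb * (r * cb * cm) * E * (a * bb)
    = ek * eb * (r * cb) * (cm * E * (a * bb)) by rewrite !mulrA.
have -> : ek * (eb * E) * (r * bb * (cb * a) * cm)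
    = ek * eb * (E * (r * cb)) * (bb * a * cm).
  by rewrite !mulrA -(mulrA _ bb cb) -cB !mulrA.
rewrite -cE2 (mulrA (ek * eb) _ E) -(mulrA (ek * eb * (r * cb)) E) st -!(mulrA _ (ek * eb)); congr (_ * _).
rewrite -ebk -!(mulrA eb); congr (_ * _).
by move: IH; rewrite -!mulrA (mulrA cm E) cM -!mulrA.
Qed.

End Coloured.
End Columns.

(** * A new row, and sums over colourings *)

Section ColumnAlgebra.
Variables (A : zmodType) (S : nat -> bool).
Local Notation e := (@e A S).
Local Notation fo := (@fo A S).
Local Notation Cc := (@Cc A S).
Local Notation As := (@As A S).
Local Notation Es := (@Es A S).
Local Notation T := (@T A).
Local Notation Pi := (@Pi A).
Local Notation Bs := (@Bs A).

Let fe k : fo k * e k = 0.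
Proof. by rewrite fo_e mulrBl mul1r e_idem subrr. Qed.
Let ef k : e k * fo k = 0.
Proof. by rewrite fo_e mulrBr mulr1 e_idem subrr. Qed.
Let ff k : fo k * fo k = fo k.
Proof. by rewrite {2}fo_e mulrBr mulr1 fe subr0. Qed.

(** Where the row [k] and the columns have colour 1, the new row keeps this
    colour. *)
Lemma cols_stab k s : uniq s -> all (fun b => (k < b)%N) s ->
  e k * Es s * (As k s * Bs k s) = e k * Es s * (As k s * Bs k s) * e k.
Proof.
elim: s => [_ _|b s IHs] /=.
  by rewrite /Es /As /Bs !big_nil !mulr1 e_idem.
move=> /andP[bs us] /andP[kb ks]; have {IHs} IH := IHs us ks.
rewrite /Es /As /Bs !big_cons -/(Es s) -/(As k s) -/(Bs k s).
have nb c : c \in s -> c != b /\ (k < c)%N.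
  move=> cs; split; last exact: (allP ks).
  by apply: contraNneq bs => <-.
have cE : GRing.comm (Cc k b * (1 - T k b)) (Es s).
  apply: comm_Es => c /nb[cb kc]; apply: commr_sym; apply: commrM.
    by apply: e_C; lia.
  by apply: eT1_comm; lia.
have cR : GRing.comm (As k s) (1 - T k b).
  apply: commr_sym; apply: comm_prodl => c /nb[cb kc]; apply: commr_sym.
  by apply: comm1B; apply: commr_sym; apply: T_C; lia.
have ebk : e b * e k = e k * e b by exact: dgC.
have := col_stabl A S kb; rewrite /GRing.comm in cE cR.
move: (Cc k b) (1 - T k b) (As k s) (Bs k s) (Es s) (e k) (e b) IH cE cR ebk.
move=> cb r a bb E ek eb IH cE cR ebk st.
have -> : ek * (eb * E) * (cb * a * (r * bb))
    = ek * eb * (E * (cb * r)) * (a * bb).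
  by rewrite !mulrA -(mulrA _ a r) cR !mulrA.
rewrite -cE (mulrA (ek * eb) _ E) -(mulrA (ek * eb * (cb * r)) E) st.
move: (ek * eb * (cb * r)) => X.
have -> : X * (ek * eb) * (E * (a * bb)) = X * eb * (ek * E * (a * bb)).
  by rewrite -ebk !mulrA.
by rewrite {1}IH !mulrA.
Qed.

(** The operator in which a new row [k] enters the product of the columns. *)
Definition Uop k s : op A :=
  Pi k k * (e k * (Cc k k * (e k * (As k s * Bs k s)))).

Section NewRow.
Variables (k : nat) (s : seq nat).
Hypotheses (us : uniq s) (ks : all (fun b => (k < b)%N) s).

Let kE : e k * Es s = Es s * e k.
Proof. by apply: comm_Es => c _; apply: dgC. Qed.
Let fE : fo k * Es s = Es s * fo k.
Proof. by rewrite fo_e mulrBr mulrBl mul1r mulr1 kE. Qed.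
Let ks' b : b \in s -> (k < b)%N. Proof. exact: (allP ks). Qed.

Let CE : Cc k k * Es s = Es s * Cc k k.
Proof. by apply: comm_Es => c /ks' kc; apply: commr_sym; apply: e_C; lia. Qed.

Let Cf : Cc k k * fo k = fo k.
Proof. by apply: (C_f (e_fo A S k) (e_idem A S k) (CX A S k k)). Qed.

(** The columns with the new row [k] when the value there has colour 1, and in
    [newrow0] when it has colour 0, both obtained by projecting [cols_conj].
    *)
Lemma newrow1 : Es s * e k * As k.+1 s = Es s * e k * (As k s * Bs k s).
Proof.
have eg : e k * gk A S k = e k.
  by rewrite /gk mulrDr e_idem mulrA ef mul0r addr0.
have := congr1 (fun x => e k * x) (cols_conj A S us ks).
rewrite !mulrA kE -(mulrA _ (e k) (gk _ _ _)) eg => ->.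
have -> : Es s * e k * (fo k * As k s + e k * As k s * Bs k s)
    = e k * Es s * (As k s * Bs k s).
  rewrite kE -[LHS]mulrA -[RHS]mulrA; congr (_ * _).
  by rewrite mulrDr !mulrA ef e_idem mul0r add0r.
by rewrite (cols_stab us ks) -(mulrA _ (e k) (gk _ _ _)) eg -(cols_stab us ks) kE !mulrA.
Qed.

Lemma newrow0 : Es s * fo k * As k.+1 s
  = Es s * fo k * (As k s * Cc k k + (1 - Cc k k) * e k * (As k s * Bs k s)).
Proof.
have fg : fo k * gk A S k = fo k * Cc k k.
  by rewrite /gk mulrDr mulrA fe ff add0r.
have cA : fo k * As k s = As k s * fo k.
  by apply: comm_prodl => c /ks' kc; apply: fo_C; lia.
have h : Es s * fo k * (Cc k k * As k.+1 s) = Es s * fo k * (As k s * Cc k k).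
  have := congr1 (fun x => fo k * x) (cols_conj A S us ks).
  rewrite !mulrA fE -(mulrA _ (fo k) (gk _ _ _)) fg !mulrA => ->.
  have -> : Es s * fo k * (fo k * As k s + e k * As k s * Bs k s)
      = Es s * (As k s * fo k).
    by rewrite -mulrA mulrDr !mulrA ff fe !mul0r addr0 cA mulrA.
  by rewrite -!mulrA fg (mulrA (As k s)) -cA -!mulrA.
have h1 : (1 - Cc k k) = (1 - Cc k k) * e k.
  have := mulrDr (1 - Cc k k) (e k) (fo k).
  by rewrite e_fo mulr1 [_ * fo k]mulrBl mul1r Cf subrr addr0.
have -> : As k.+1 s = Cc k k * As k.+1 s + (1 - Cc k k) * As k.+1 s.
  by rewrite mulrBl mul1r addrC subrK.
rewrite mulrDr h [in RHS]mulrDr; congr (_ + _).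
have mv x : Es s * (fo k * ((1 - Cc k k) * x)) = fo k * ((1 - Cc k k) * (Es s * x)).
  rewrite mulrA -fE -!mulrA; congr (_ * _); rewrite !mulrA; congr (_ * _).
  by rewrite mulrBr mulrBl mulr1 mul1r CE.
rewrite {1}h1 -!mulrA !mv; do 2 congr (_ * _).
by have := newrow1; rewrite -!mulrA.
Qed.

(** [Uop] is the contribution of the new row for colour 1, and by [Uop0] also
    the correction for colour 0; it has the form of an operator of the row [k]
    applied to a quantity that requires colour 1. *)
Lemma Uop1 : Es s * e k * Uop k s = Es s * e k * (As k s * Bs k s).
Proof.
have h := ePeC (e_fo A S k) (e_idem A S k) (XC A S k k).
rewrite -!(mulrA (Es s)); congr (_ * _); rewrite /Uop.
have -> : e k * (Pi k k * (e k * (Cc k k * (e k * (As k s * Bs k s)))))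
   = e k * (Pi k k * (e k * Cc k k)) * (e k * (As k s * Bs k s)) by rewrite !mulrA.
by rewrite h mulrA e_idem.
Qed.

Lemma Uop0 : Es s * fo k * Uop k s
  = Es s * fo k * ((1 - Cc k k) * e k * (As k s * Bs k s)).
Proof.
have h : fo k * (1 - Cc k k) = fo k * (Pi k k * (e k * Cc k k)).
  rewrite mulrBr mulr1 (fC (e_fo A S k) (e_idem A S k) (XC A S k k)) opprB addrC subrK.
  by rewrite !mulrA.
rewrite -!(mulrA (Es s)); congr (_ * _); rewrite /Uop.
by rewrite -!mulrA [RHS]mulrA h -!mulrA.
Qed.

Lemma Uop_comm : Es s * e k * (Cc k k * (e k * (As k s * Bs k s)))
  = Es s * e k * (Bs k s * (As k s * Cc k k)).
Proof.
have h : e k * Cc k k * e k = e k * Cc k k := eC_e (e_fo A S k) (e_idem A S k) (CX A S k k).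
have := cols_comm A S us ks; rewrite kE -!mulrA => <-.
by rewrite (mulrA (Cc k k)) (mulrA (e k)) (mulrA (e k) (Cc k k) (e k)) h -!mulrA.
Qed.

End NewRow.

End ColumnAlgebra.

Section ColourDependence.
Variable A : zmodType.
Implicit Types S : nat -> bool.

(** The column operator at [u] only looks at the colours of the values below
    the value [u b] of the column, because that value decreases along it. *)
Lemma Cc_local S S' k b F (u : Sinf) : (k <= b)%N ->
  (forall y, (y < u b)%N -> S y = S' y) -> Cc A S k b F u = Cc A S' k b F u.
Proof.
move=> kb; have [n] := ubnP (u b); elim: n u => // n IHn u; rewrite ltnS => un SS.
have CE S0 : Cc A S0 k b = 1 - (Pi A k b - 1) * e A S0 b * Cc A S0 k b.
  by rewrite -XcE mulrBl XC mul1r opprB addrC subrK.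
rewrite (CE S) (CE S') !opBE !op1E; congr (_ - _); rewrite -!mulrA !opME.
apply: (@low_local _ (fun u => u b)).
  by apply: low_Pi => a w ak /covP[_ h _]; rewrite trEr.
move=> w wu; rewrite !opME /e !dgE SS //; case: ifP => // _.
by apply: IHn => [|y yw]; [apply: leq_trans un | apply: SS; apply: ltn_trans wu].
Qed.

Variables (k y : nat) (S : nat -> bool).
Let S' z := (z == y) || S z.
Let h : op A := dg (fun u : Sinf => u k == y).

Let h_e b : b != k -> h * e A S' b = h * e A S b.
Proof.
move=> bk; rewrite /h /e !dgM; congr dg; apply: functional_extensionality => u.
rewrite /S'; case: (eqVneq (u k) y) => //= <-.
by rewrite (negbTE (Sinf_neq u bk)).
Qed.

Let h_T i j : k != i -> k != j -> GRing.comm h (T i j).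
Proof. by move=> ki kj; rewrite /GRing.comm (@dg_T A _ (fun v => v k == y)) // => v _; rewrite trEn. Qed.

(** Columns beyond [k] leave the value at [k] in place and never look at its
    colour. *)
Lemma As_recolour s F G (v : Sinf) : all (fun b => (k < b)%N) s -> v k = y ->
  (forall u : Sinf, u k = y -> F u = G u) ->
  As A S' k s F v = As A S k s G v.
Proof.
move=> ks vy FG.
have hP b : (k < b)%N -> GRing.comm h (Pi A k b).
  by move=> kb; apply: comm_Pi => j jk; apply: h_T; lia.
have hX b : (k < b)%N -> h * Xc A S' k b = h * Xc A S k b.
  move=> kb; have bk : b != k by rewrite gtn_eqF.
  rewrite /Xc !fo_e !mulrDr !mulrN !(mulrA h) (hP b kb) -!(mulrA _ h).
  by rewrite h_e.
have hC S0 b : (k < b)%N -> GRing.comm h (Cc A S0 k b).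
  by move=> kb; apply: comm_C; [exact: dgC | exact: hP | exact: dgC].
have hCC b : (k < b)%N -> h * Cc A S' k b = h * Cc A S k b.
  move=> kb; have hXc : h * Xc A S k b = Xc A S k b * h.
    by apply: commrD; [exact: dgC | apply: commrM; [exact: hP | exact: dgC]].
  rewrite -[LHS]mul1r -(CX A S k b) -mulrA (mulrA _ h) -hXc -hX // -!mulrA XC mulr1.
  by rewrite hC.
have hA : h * As A S' k s = h * As A S k s.
  elim: s ks {v vy} => [|b s IHs] /=; first by rewrite /As !big_nil.
  move=> /andP[kb ks]; rewrite /As !big_cons !mulrA hCC // hC // -!mulrA.
  by congr (_ * _); apply: IHs.
have hAc : h * As A S k s = As A S k s * h.
  by apply: comm_prodl => b /(allP ks); apply: hC.
have at_v (Q : op A) H : Q H v = (h * Q) H v by rewrite opME dgE vy eqxx.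
rewrite at_v hA hAc [RHS]at_v hAc !opME; apply: op_eq => u; rewrite !dgE.
by case: eqP => // /FG.
Qed.

End ColourDependence.

Section ColourSum.
Variables (R : comPzRingType) (t : R).
Implicit Types (F : (nat -> bool) -> R) (S : nat -> bool).

Definition addc (y : nat) S : nat -> bool := fun z => (z == y) || S z.

(** The expectation of [F] at a random set of entries of [s], each of which is
    chosen independently with weight [t]. *)
Fixpoint csum (s : seq nat) F : R :=
  if s is y :: s' then (1 - t) * csum s' F + t * csum s' (fun S => F (addc y S))
  else F xpred0.

Lemma csum_ext s F G : (forall S, (forall z, S z -> z \in s) -> F S = G S) ->
  csum s F = csum s G.
Proof.
elim: s F G => [|y s IHs] F G h /=; first by apply: h.
congr (_ * _ + _ * _); apply: IHs => S hS; apply: h => z.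
  by move/hS; rewrite inE orbC => ->.
by rewrite /addc inE => /orP[-> //|/hS ->]; rewrite orbT.
Qed.

Lemma csum_cons_cat s1 s2 y F : csum (s1 ++ y :: s2) F = csum (y :: s1 ++ s2) F.
Proof.
elim: s1 F => [//|x s1 IHs] F /=; rewrite !IHs /=.
have -> : (fun S => F (addc x (addc y S))) = (fun S => F (addc y (addc x S))).
  apply: functional_extensionality => S; congr F.
  by apply: functional_extensionality => z; rewrite /addc orbCA.
ring.
Qed.

Lemma csum_perm s s' F : perm_eq s s' -> csum s F = csum s' F.
Proof.
elim: s s' F => [|y s IHs] s' F; first by rewrite perm_sym => /perm_nilP ->.
move=> ss; have : y \in s' by rewrite -(perm_mem ss) mem_head.
move=> /splitPr e; move: ss; case: e => s1 s2.
rewrite perm_sym perm_catC cat_cons perm_cons perm_catC perm_sym => ss.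
by rewrite csum_cons_cat /= !(IHs _ _ ss).
Qed.

Lemma csum_lin s F G c d :
  csum s (fun S => c * F S + d * G S) = c * csum s F + d * csum s G.
Proof. by elim: s F G => [//|y s IHs] F G /=; rewrite !IHs; ring. Qed.

Lemma csumD s F G : csum s (fun S => F S + G S) = csum s F + csum s G.
Proof.
by rewrite -[RHS]addr0 -[csum s F]mul1r -[csum s G]mul1r -csum_lin addr0;
   apply: csum_ext => S _; rewrite !mul1r.
Qed.

Lemma csum0 s : csum s (fun _ => 0) = 0.
Proof. by elim: s => //= y s ->; rewrite !mulr0 addr0. Qed.

Fixpoint vals (k : nat) (v : Sinf) : seq nat :=
  if k is j.+1 then v j :: vals j v else [::].

Lemma mem_vals k v y : y \in vals k v -> exists2 j, (j < k)%N & y = v j.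
Proof.
elim: k => // k IHk /=; rewrite inE => /orP[/eqP ->|/IHk [j jk ->]]; first by exists k.
by exists j => //; apply: ltnW.
Qed.

Lemma vals_notin k (v : Sinf) S b : (forall z, S z -> z \in vals k v) -> (k <= b)%N ->
  S (v b) = false.
Proof.
move=> hS kb; apply/negP => /hS /mem_vals [j jk /(@Sinf_inj v) e].
by move: kb; rewrite e leqNgt jk.
Qed.

Lemma vals_map k v : vals k v = map v (rev (iota 0 k)).
Proof.
elim: k => // k IHk; rewrite -[in iota _ _]addn1 iotaD rev_cat /= IHk add0n.
by [].
Qed.

Lemma vals_tr_perm k v a b : (a < k)%N -> (b < k)%N ->
  perm_eq (vals k (tr v a b)) (vals k v).
Proof.
move=> ak bk; rewrite !vals_map.
rewrite (eq_map (g := v \o trfun a b)) => [|i]; last by rewrite trE.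
rewrite map_comp; apply: perm_map; apply: uniq_perm.
- by rewrite map_inj_uniq ?rev_uniq ?iota_uniq //; apply: inv_inj; apply: trfunK.
- by rewrite rev_uniq iota_uniq.
move=> i; apply/mapP/idP => [[j]|]; rewrite !mem_rev !mem_iota /= add0n.
  by move=> jk ->; have := trfun_cases a b j; lia.
move=> ik; exists (trfun a b i); last by rewrite trfunK.
by rewrite mem_rev mem_iota /= add0n; have := trfun_cases a b i; lia.
Qed.

Lemma vals_tr_id k v a b : (k <= a)%N -> (k <= b)%N -> vals k (tr v a b) = vals k v.
Proof.
move=> ka kb; rewrite !vals_map; apply/eq_in_map => i.
rewrite mem_rev mem_iota /= add0n => ik.
by rewrite trEn //; lia.
Qed.

(** Operators that permute the values at the first [k] positions commute with
    the sum over the colourings of these values. *)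
Definition csum_comm k (Q : op R) : Prop :=
  forall (G : (nat -> bool) -> Sinf -> R) v,
  csum (vals k v) (fun S => Q (G S) v) = Q (fun u => csum (vals k u) (fun S => G S u)) v.

Lemma csum_comm1 k : csum_comm k 1. Proof. by []. Qed.

Lemma csum_commD k Q1 Q2 : csum_comm k Q1 -> csum_comm k Q2 -> csum_comm k (Q1 + Q2).
Proof.
move=> h1 h2 G v; rewrite opDE -h1 -h2.
have := csum_lin (vals k v) (fun S => Q1 (G S) v) (fun S => Q2 (G S) v) 1 1.
rewrite !mul1r => <-; apply: csum_ext => S _; by rewrite !mul1r.
Qed.

Lemma csum_commN k Q : csum_comm k Q -> csum_comm k (- Q).
Proof.
move=> h1 G v; rewrite opNE -h1.
have := csum_lin (vals k v) (fun S => Q (G S) v) (fun S => Q (G S) v) (-1) 0.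
rewrite mul0r addr0 mulN1r => <-; apply: csum_ext => S _.
by rewrite mul0r addr0 mulN1r.
Qed.

Lemma csum_commM k Q1 Q2 : csum_comm k Q1 -> csum_comm k Q2 -> csum_comm k (Q1 * Q2).
Proof.
move=> h1 h2 G v; rewrite opME.
rewrite (op_eq Q1 v (G := fun u => csum (vals k u) (fun S => Q2 (G S) u))); last first.
  by move=> u; rewrite h2.
by rewrite -h1.
Qed.

Lemma csum_commT k a b :
  (forall v, perm_eq (vals k (tr v a b)) (vals k v)) -> csum_comm k (T a b).
Proof.
move=> h G v; rewrite TE; case: ifP => c; last first.
  rewrite (csum_ext (G := fun _ => 0)); last by move=> S _; rewrite TE c.
  by elim: (vals k v) => //= y s ->; rewrite !mulr0 addr0.
rewrite -(csum_perm _ (h v)); apply: csum_ext => S _; by rewrite TE c.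
Qed.

End ColourSum.

(** * The recursion on the number of rows *)

Section ZRecursion.
Variables (R : comPzRingType) (t : R).
Local Notation As := (@As R).
Local Notation csum := (csum t).

Definition cols (k N : nat) : seq nat := rev (iota k (N - k)).

Lemma mem_cols k N b : (b \in cols k N) = (k <= b < N)%N.
Proof. by rewrite mem_rev mem_iota; lia. Qed.

Lemma cols_uniq k N : uniq (cols k N).
Proof. by rewrite rev_uniq iota_uniq. Qed.

Lemma cols_gt k N : all (fun b => (k < b)%N) (cols k.+1 N).
Proof. by apply/allP => b; rewrite mem_cols => /andP[]. Qed.

Lemma cols_rcons k N : (k < N)%N -> cols k N = rcons (cols k.+1 N) k.
Proof.
move=> kN; rewrite /cols; have -> : (N - k = (N - k.+1).+1)%N by lia.
by rewrite /= rev_cons.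
Qed.

(** By [monk] below, this acts on Grothendieck polynomials as the
    multiplication by [1 - x k]. *)
Definition Yop (k N : nat) : op R := Pi R k k * Bs R k (cols k.+1 N).

(** The average over the colourings of the values at the rows of the signed sum
    over the chains that obey the colour rule. *)
Definition Z (k N : nat) (F : Sinf -> R) (v : Sinf) : R :=
  csum (vals k v) (fun S => As S k (cols k N) F v).

Lemma Z0 N F v : Z 0 N F v = F v.
Proof.
rewrite /Z /=; elim: (cols 0 N) => [|b s IHs]; first by rewrite /As big_nil.
rewrite /As big_cons opME -/(As _ _ _); suff -> : Cc R xpred0 0 b = 1 by [].
have : Xc R xpred0 0 b = 1 by rewrite /Xc /= mul1r addrC e_fo.
by have := XC R xpred0 0 b => + h; rewrite h mul1r.
Qed.

Lemma Es_at S (s : seq nat) (Q : op R) F (v : Sinf) : (forall b, b \in s -> S (v b) = false) ->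
  (Es R S s * Q) F v = Q F v.
Proof.
elim: s Q => [|b s IHs] Q h; first by rewrite /Es big_nil mul1r.
rewrite /Es big_cons -/(Es R S s) -mulrA opME dgE h ?mem_head //= -opME IHs // => c cs.
by apply: h; rewrite inE cs orbT.
Qed.

Lemma csum_comm_Pi j k m : (j <= k)%N -> (m < k)%N -> csum_comm t k (Pi R j m).
Proof.
move=> jk mk; elim: j jk => [|j IHj] jk /=; first exact: csum_comm1.
apply: csum_commM; last by apply: IHj; apply: ltnW.
apply: csum_commD; first exact: csum_comm1.
by apply: csum_commT => v; apply: vals_tr_perm.
Qed.

Lemma csum_comm_Bs k s : all (fun b => (k < b)%N) s -> csum_comm t k (Bs R k s).
Proof.
elim: s => [_|b s IHs /= /andP[kb ks]]; first by rewrite /Bs big_nil; exact: csum_comm1.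
rewrite /Bs big_cons; apply: csum_commM; last exact: IHs.
apply: csum_commD; first exact: csum_comm1.
apply: csum_commN; apply: csum_commT => v.
by rewrite vals_tr_id //; apply: ltnW.
Qed.

(** For colour 0 of the value at the new row [k], there are the columns from
    [k] on without that row, plus [Uop]; for colour 1 there is [Uop] alone.
    The colour sum commutes with the operators [T j k] in [Uop]; behind them,
    colour 0 contributes nothing and colour 1 gives [Bs] applied to [Z] for
    [k] rows. *)
Lemma Z_rec k N F v : (k < N)%N ->
  Z k.+1 N F v = t * Z k N F v + (1 - t) * Yop k N (Z k N F) v.
Proof.
move=> kN; set s := cols k.+1 N.
have us : uniq s by apply: cols_uniq.
have ks : all (fun b => (k < b)%N) s by apply: cols_gt.
have AsE S : As S k (cols k N) = As S k s * Cc R S k k.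
  by rewrite cols_rcons // /As -cats1 big_cat big_seq1.
have off (S : nat -> bool) (u : Sinf) : (forall z, S z -> z \in vals k u) ->
    (forall b, b \in s -> S (u b) = false) /\ S (u k) = false.
  move=> hS; split=> [b|]; last exact: (vals_notin hS (leqnn k)).
  by move/(allP ks) => kb; apply: (vals_notin hS); apply: ltnW.
pose U S := Uop R S k s.
have c1 (S : nat -> bool) : (forall z, S z -> z \in vals k v) -> As S k.+1 s F v = U S F v.
  move=> /off [hs hk].
  have := newrow1 R S us ks; rewrite -(Uop1 R S k s) => h.
  have := congr1 (fun Q : op R => Q F v) h; rewrite -!mulrA !Es_at // !opME !dgE.
  by rewrite hk.
have c0 (S : nat -> bool) : (forall z, S z -> z \in vals k v) ->
    As (addc (v k) S) k.+1 s F v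
    = As S k (cols k N) F v + U (addc (v k) S) F v.
  move=> hS; have [hs hk] := off _ _ hS.
  set S' := addc (v k) S.
  have hs' b : b \in s -> S' (v b) = false.
    move=> bs; rewrite /S' /addc hs // orbF; apply/negbTE/Sinf_neq.
    by move/(allP ks): bs => kb; rewrite gtn_eqF.
  have hk' : S' (v k) by rewrite /S' /addc eqxx.
  have h := newrow0 R S' us ks; rewrite mulrDr -(Uop0 R S' k s) -mulrDr in h.
  have := congr1 (fun Q : op R => Q F v) h; rewrite -!mulrA !Es_at // !(opME (fo _ _ _)) !dgE.
  rewrite hk' => ->; rewrite opDE; congr (_ + _).
  rewrite AsE !opME; apply: As_recolour => // u uk; apply: Cc_local => // y yu.
  by rewrite /S' /addc -uk (ltn_eqF yu).
rewrite /Z /= -/s (csum_ext _ c1) (csum_ext _ c0).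
rewrite csumD mulrDr addrCA; congr (_ + _).
pose G S := (e R S k * (Cc R S k k * (e R S k * (As S k s * Bs R k s)))) F.
transitivity (csum (vals k.+1 v) (fun S => Pi R k k (G S) v)); first by [].
rewrite csum_comm_Pi //.
rewrite (op_eq _ v (G := fun u => (1 - t) * Bs R k s (Z k N F) u)).
  by rewrite (@op_natP _ _ ( *%R (1 - t))) // => x y; rewrite mulrDr.
move=> u /=; rewrite [X in _ + t * X](csum_ext _ (G := fun _ => 0)); last first.
  by move=> S _; rewrite /G opME dgE /addc eqxx.
rewrite csum0 mulr0 addr0; congr (_ * _).
rewrite -csum_comm_Bs //; apply: csum_ext => S /off [hs hk].
have := congr1 (fun Q : op R => Q F u) (Uop_comm R S us ks).
rewrite -!(mulrA (Es _ _ _)) !Es_at // !(opME (e _ _ _)) !dgE hk /= AsE.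
by rewrite /G opME dgE hk.
Qed.
End ZRecursion.

(** * Expansion into chains *)

(** The way in which consecutive labels of a chain satisfy (P1) but not
    [prec]. *)
Definition desc (l l' : nat * nat) : bool := (l'.2 == l.2) && (l'.1 < l.1)%N.

Definition letters (k N : nat) : seq (nat * nat) :=
  [seq (a, b) | b <- index_iota k N, a <- index_iota 0 k].

(* Makes variables of the carrier of the eqType nat visible to lia. *)
Ltac natify := repeat match goal with
  | x : Equality.sort _ |- _ => change nat in (type of x) end.

Lemma mem_letters (k N : nat) (l : nat * nat) : (l \in letters k N) = (l.1 < k <= l.2)%N && (l.2 < N)%N.
Proof.
apply/allpairsP/idP => [[[b a] /= [hb ha ->]] /=|h].
  by move: hb ha; rewrite !mem_index_iota; natify; lia.
by exists (l.2, l.1); rewrite !mem_index_iota /=; split; [lia|lia|case: (l)].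
Qed.

Lemma letters_uniq k N : uniq (letters k N).
Proof.
apply: allpairs_uniq; rewrite ?iota_uniq // => -[b a] [b' a'] _ _ /= [-> ->] //.
Qed.

Section LetterSums.
Variable M : zmodType.
Variables (k N : nat) (f : nat * nat -> M).

Lemma sum_letters : \sum_(l <- letters k N) f l
  = \sum_(k <= b < N) \sum_(0 <= a < k) f (a, b).
Proof. by rewrite /letters big_allpairs_dep /=; apply: eq_bigr. Qed.

Lemma sum_letters_prec (j b : nat) : (j < k)%N -> (k <= b < N)%N ->
  \sum_(l <- letters k N | prec (j, b) l) f l
  = \sum_(k <= b' < b) \sum_(0 <= a < k) f (a, b') + \sum_(j.+1 <= a < k) f (a, b).
Proof.
move=> jk /andP[kb bN]; rewrite big_mkcond /letters big_allpairs_dep /=.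
rewrite (big_cat_nat (n := b)) //=; last exact: ltnW.
rewrite (big_cat_nat (n := b.+1) (m := b)) //= big_nat1.
congr (_ + _).
  apply: eq_big_nat => b' /andP[_ b'b]; apply: eq_bigr => a _.
  by rewrite /prec /= b'b.
rewrite [X in _ + X]big1_seq ?addr0; last first.
  move=> b' /=; rewrite mem_index_iota => /andP[bb' _].
  by apply: big1 => a _; rewrite /prec /= ltnNge (ltnW bb') /= ltn_eqF.
rewrite (big_cat_nat (n := j.+1)) //= big1_seq ?add0r; last first.
  move=> a /=; rewrite mem_index_iota /= ltnS => aj.
  by rewrite /prec /= ltnn eqxx /= ltnNge aj.
by apply: eq_big_nat => a /andP[ja _]; rewrite /prec /= eqxx ja orbT.
Qed.

Lemma sum_letters_desc (j b : nat) : (j < k)%N -> (k <= b < N)%N ->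
  \sum_(l <- letters k N | desc (j, b) l) f l = \sum_(0 <= a < j) f (a, b).
Proof.
move=> jk kbN; rewrite big_mkcond /letters big_allpairs_dep /=.
rewrite (bigD1_seq b) ?iota_uniq ?mem_index_iota //= [X in _ + X]big1 ?addr0; last first.
  by move=> b' b'b; apply: big1 => a _; rewrite /desc /= (negbTE b'b).
rewrite (big_cat_nat (n := j)) //=; last exact: ltnW.
rewrite [X in _ + X]big1_seq ?addr0; last first.
  by move=> a /=; rewrite mem_index_iota /desc /= => /andP[ja _]; rewrite ltnNge ja andbF.
by apply: eq_big_nat => a /andP[_ aj]; rewrite /desc /= eqxx aj.
Qed.
End LetterSums.

Section ChainExpansion.
Variables (R : comPzRingType) (k N : nat) (S : nat -> bool).
Local Notation T := (@T R).
Local Notation e := (@e R S).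
Local Notation fo := (@fo R S).
Local Notation Ls := (letters k N).

(** The chains of length at most [n] that start with the label [l] and obey
    the colour rule: the value moved to the right by a label has colour 1 when
    the next label is larger or absent, and colour 0 when it is a descent. *)
Fixpoint Nl (n : nat) (l : nat * nat) : op R :=
  if n is n'.+1 then
    T l.1 l.2 * (- (e l.2 * (1 + \sum_(l' <- Ls | prec l l') Nl n' l'))
                 + fo l.2 * \sum_(l' <- Ls | desc l l') Nl n' l')
  else 0.

Lemma NlS n l : Nl n.+1 l =
    T l.1 l.2 * (- (e l.2 * (1 + \sum_(l' <- Ls | prec l l') Nl n l'))
                 + fo l.2 * \sum_(l' <- Ls | desc l l') Nl n l').
Proof. by []. Qed.

(** Bounds the length of chains, as each cover destroys a noninversion between
    a row and a column. *)
Definition noninv (u : Sinf) : nat := (\sum_(l <- Ls) (u l.1 < u l.2))%N.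

Lemma noninv_tr u (l : nat * nat) : l \in Ls -> cov u l.1 l.2 -> (noninv (tr u l.1 l.2) < noninv u)%N.
Proof.
move=> lL /covP[ab uab _]; rewrite /noninv.
rewrite [X in (X < _)%N](bigD1_seq l) ?letters_uniq //=.
rewrite [X in (_ < X)%N](bigD1_seq l) ?letters_uniq //=.
rewrite trEl trEr uab; have -> : (u l.2 < u l.1)%N = false by lia.
rewrite add0n add1n ltnS [X in (X <= _)%N]big_seq_cond [X in (_ <= X)%N]big_seq_cond.
apply: leq_sum => -[a b] /andP[]; move: lL; rewrite !mem_letters => lL /= lL' _.
natify.
have E1 : (u a <= tr u l.1 l.2 a)%N.
  have [->|n1] := eqVneq a l.1; first by rewrite trEl ltnW.
  by rewrite trEn //; lia.
have E2 : (tr u l.1 l.2 b <= u b)%N.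
  have [->|n1] := eqVneq b l.2; first by rewrite trEr ltnW.
  by rewrite trEn //; lia.
by case: ltnP => // h; lia.
Qed.

Lemma Nl_stable n (l : nat * nat) F u : l \in Ls -> (noninv u <= n)%N ->
  Nl n.+1 l F u = Nl n l F u.
Proof.
elim: n l u => [|n IHn] l u lL hu.
  by rewrite NlS opME TE; case: ifP => // /(noninv_tr lL); lia.
rewrite [Nl n.+2 _]NlS [Nl n.+1 _]NlS !opME !TE; case: ifP => // c.
have hu' := noninv_tr lL c; set w := tr u l.1 l.2 in hu' *.
have {}IHn l' : l' \in Ls -> Nl n.+1 l' F w = Nl n l' F w.
  by move=> l'L; apply: IHn => //; lia.
rewrite !opDE !opNE !opME !dgE !opDE !op_sumE.
have E (P : pred (nat * nat)) : \sum_(l' <- Ls | P l') Nl n.+1 l' F w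
    = \sum_(l' <- Ls | P l') Nl n l' F w.
  rewrite big_seq_cond [RHS]big_seq_cond.
  by apply: eq_bigr => l' /andP[l'L _]; apply: IHn.
by rewrite !E.
Qed.

Definition fuel := (size Ls).

Lemma noninv_fuel u : (noninv u <= fuel)%N.
Proof.
rewrite /noninv /fuel -sum1_size; apply: leq_sum => l _; exact: leq_b1.
Qed.

Lemma NlE l : l \in Ls -> Nl fuel l =
  T l.1 l.2 * (- (e l.2 * (1 + \sum_(l' <- Ls | prec l l') Nl fuel l'))
               + fo l.2 * \sum_(l' <- Ls | desc l l') Nl fuel l').
Proof.
move=> lL; apply: op_ext => F u; rewrite -(Nl_stable F lL (noninv_fuel u)).
by [].
Qed.

(** The chains in the columns before [j]. *)
Definition Vj (j : nat) : op R :=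
  1 + \sum_(k <= b < j) \sum_(0 <= a < k) Nl fuel (a, b).

(** [Xc] cancels the chains that start in the column [b]. A label [(j, b)] is
    followed by a larger label or by one with a smaller row in the column [b],
    and over [j] these alternatives telescope. *)
Lemma VjS b : (k <= b < N)%N -> Xc R S k b * Vj b.+1 = Vj b.
Proof.
move=> kbN; set V := Vj b.+1; pose Sj j := \sum_(0 <= a < j) Nl fuel (a, b).
have VE : V = Vj b + Sj k.
  by rewrite /V /Vj big_nat_recr //= ?addrA //; case/andP: kbN.
have NE j : (j < k)%N -> Nl fuel (j, b) = - (T j b * (e b * V)) + T j b * Sj j.
  move=> jk; rewrite NlE ?mem_letters /=; last by lia.
  rewrite sum_letters_prec // sum_letters_desc // -/(Sj j).
  have -> : 1 + (\sum_(k <= b' < b) \sum_(0 <= a < k) Nl fuel (a, b')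
       + \sum_(j.+1 <= a < k) Nl fuel (a, b)) = V - Sj j - Nl fuel (j, b).
    have SE : Sj k = Sj j + Nl fuel (j, b) + \sum_(j.+1 <= a < k) Nl fuel (a, b).
      by rewrite /Sj (big_cat_nat (n := j.+1)) //= big_nat_recr.
    rewrite VE SE /Vj; move: (Sj j) (Nl _ _) (\sum_(j.+1 <= _ < _) _) => x y z.
    by move: (\sum_(k <= _ < b) _) => W; ncr.
  have h0 : T j b * (e b * Nl fuel (j, b)) = 0.
    by rewrite NlE ?mem_letters /=; [rewrite !mulrA T_TT mul0r | lia].
  rewrite mulrDr mulrN !mulrBr h0 subr0 opprB [X in _ + X]mulrA.
  rewrite fo_e mulrBr mulr1 mulrBl !mulrA.
  by move: (T j b * e b * V) (T j b * e b * Sj j) (T j b * Sj j) => x y z; ncr.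
have PE j : (j <= k)%N -> Pi R j b * (e b * V) = e b * V - Sj j.
  elim: j => [|j IHj] jk /=; first by rewrite mul1r /Sj big_geq // subr0.
  rewrite -mulrA IHj; last exact: ltnW.
  rewrite [Sj j.+1]/Sj big_nat_recr //= -/(Sj j) NE //.
  by move: (T j b) (e b * V) (Sj j) => x y z; ncr.
rewrite /Xc mulrDl -mulrA PE // addrA -mulrDl [fo b + _]addrC e_fo mul1r VE.
by rewrite addrK.
Qed.

Lemma As_Vj j : (k <= j <= N)%N -> As R S k (cols k j) = Vj j.
Proof.
elim: j => [|j IHj] kj.
  by rewrite /As /cols sub0n big_nil /Vj big_geq // addr0.
have [jk|kj'] := ltnP j k.
  by rewrite /As /cols /Vj big_geq ?addr0; [have -> : (j.+1 - k = 0)%N by lia | lia];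
    rewrite big_nil.
have -> : cols k j.+1 = j :: cols k j.
  rewrite /cols subSn // -addn1 iotaD rev_cat /=; congr (_ :: _); lia.
rewrite /As big_cons -/(As R S k _) IHj; last by lia.
by rewrite -(VjS (b := j)) ?mulrA ?CX ?mul1r //; lia.
Qed.

Fixpoint words (n : nat) : seq (seq (nat * nat)) :=
  if n is n'.+1 then [::] :: [seq l :: g | l <- Ls, g <- words n'] else [:: [::]].

Lemma mem_words n g : (g \in words n) = (size g <= n)%N && all (mem Ls) g.
Proof.
elim: n g => [|n IHn] [|l g] //=; rewrite inE /=.
apply/allpairsP/idP => [[[l' g'] /= [h1 h2 [-> ->]]]|].
  by move: h2; rewrite IHn ltnS h1.
move=> /and3P[h1 h2 h3]; exists (l, g) => /=; split=> //.
by rewrite IHn -ltnS h1 h3.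
Qed.

Lemma words_uniq n : uniq (words n).
Proof.
elim: n => //= n IHn; apply/andP; split.
  by apply/negP => /allpairsP[[l g] [_ _]].
by apply: allpairs_uniq; rewrite ?letters_uniq // => -[l g] [l' g'] _ _ /= [-> ->].
Qed.

Definition endS (v : Sinf) (g : seq (nat * nat)) : Sinf :=
  foldl (fun u l => tr u l.1 l.2) v g.

(** The factor of the label [l], given the colour [c] of the value that it
    moves to the right and the labels [g] after it. *)
Definition link (c : bool) (l : nat * nat) (g : seq (nat * nat)) : R :=
  if c then (if g is l' :: _ then (desc l l')%:R else 0)
  else - (if g is l' :: _ then (prec l l')%:R else 1).

Fixpoint wt (v : Sinf) (g : seq (nat * nat)) : R :=
  if g is l :: g' then
    (cov v l.1 l.2)%:R * link (S (v l.1)) l g' * wt (tr v l.1 l.2) g'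
  else 1.

Lemma NlwE n l F v :
  Nl n.+1 l F v = \sum_(g <- words n) wt v (l :: g) * F (endS v (l :: g)).
Proof.
elim: n l v => [|n IHn] l v.
  rewrite NlS opME TE [in RHS]/= big_seq1 /=; case: ifP => c; last by rewrite !mul0r.
  rewrite !big1 // /e /fo trEr; case: (S (v l.1)) => /=.
    by rewrite mulr0 !mul0r oppr0 addr0.
  by rewrite !addr0 mul1r ?mulr1 mulN1r.
rewrite NlS opME TE; set w := tr v l.1 l.2.
rewrite [words n.+1]/= big_cons big_allpairs_dep /=.
case: ifP => c; last first.
  rewrite !mul0r add0r big1 // => l' _; rewrite big1 // => g _; rewrite !mul0r //.
rewrite !op_sumE [w l.2]trEr.
have E l' : \sum_(g <- words n) true%:R * link (S (v l.1)) l (l' :: g) *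
     ((cov w l'.1 l'.2)%:R * link (S (w l'.1)) l' g * wt (tr w l'.1 l'.2) g) *
      F (endS (tr w l'.1 l'.2) g)
   = (if S (v l.1) then (desc l l')%:R else - (prec l l')%:R) * Nl n.+1 l' F w.
  rewrite IHn big_distrr /=; apply: eq_bigr => g _.
  by rewrite mul1r /link !mulrA; case: (S (v l.1)).
rewrite (eq_bigr _ (fun l' _ => E l')); case: (S (v l.1)) => /=.
  rewrite mulr0 !mul0r oppr0 !add0r [LHS]big_mkcond; apply: eq_bigr => l' _.
  by case: (desc l l'); rewrite ?mul1r ?mul0r.
rewrite addr0 opprD; congr (_ + _); first by rewrite mul1r ?mulr1 mulN1r.
rewrite -sumrN [LHS]big_mkcond; apply: eq_bigr => l' _.
by case: (prec l l'); rewrite ?mulN1r ?oppr0 ?mul0r.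
Qed.

Lemma As_wt F v : (k <= N)%N ->
  As R S k (cols k N) F v = \sum_(g <- words fuel) wt v g * F (endS v g).
Proof.
move=> kN.
rewrite As_Vj ?leqnn ?andbT // /Vj -(@sum_letters _ k N (Nl fuel)) opDE op_sumE op1E.
case E : fuel => [|n].
  rewrite [in RHS]/= big_seq1 mul1r; move: E; rewrite /fuel => /size0nil ->.
  by rewrite big_nil addr0.
rewrite [words _]/= big_cons mul1r [in RHS]big_allpairs_dep; congr (_ + _).
by apply: eq_bigr => l _; rewrite NlwE.
Qed.

End ChainExpansion.

(** * Chains satisfying (P0) and (P1) *)

Section ChainCombinatorics.
Variable k : nat.
Implicit Types (u v w : Sinf) (g : seq (nat * nat)) (U : seq nat) (l : nat * nat).

Fixpoint okc u g : bool :=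
  if g is l :: g' then [&& (l.1 < k <= l.2)%N, cov u l.1 l.2 & okc (tr u l.1 l.2) g']
  else true.

Definition linkok U l g : bool :=
  if g is l' :: _ then prec l l' || desc l l' && (l.1 \notin U) else true.

(** Conditions (P0) and (P1) for a chain continuing one whose labels have the
    rows [U]. *)
Fixpoint good U g : bool :=
  if g is l :: g' then linkok U l g' && good (l.1 :: U) g' else true.

Lemma linkok_col U l l' g : linkok U l (l' :: g) -> (l'.2 <= l.2)%N.
Proof. by rewrite /linkok /prec /desc; lia. Qed.

(** No label [(f, b1)] of [g] with [b1 < b] and [f < c] moves to the left a
    value strictly between [mu] and the current value at [c]. *)
Fixpoint safe (c b mu : nat) w g : Prop :=
  if g is l :: g' then
    ((l.2 < b)%N -> (l.1 < c)%N -> ~~ (mu < w l.2 < w c)%N)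
    /\ safe c b mu (tr w l.1 l.2) g'
  else True.

(** The hypotheses are an invariant: no column still to come, and no unused
    row to the right of [c], carries a value between [mu] and the value at
    [c]. A cover that would violate it has an intermediate value at [c]. *)
Lemma safe_from (c b mu : nat) U l w g :
  (c < k)%N ->
  okc w g -> linkok U l g -> good (l.1 :: U) g ->
  (forall b1, (k <= b1 < l.2)%N -> ~~ (mu < w b1 < w c)%N) ->
  ((l.2 < b)%N -> c \in U
     /\ ((l.1 < c)%N || (c < l.1)%N && (l.1 \notin U) -> ~~ (mu < w l.2 < w c)%N)) ->
  (forall r, (c < r < k)%N -> r \notin l.1 :: U -> (mu < w r)%N -> (w c < w r)%N) ->
  c \in l.1 :: U -> safe c b mu w g.
Proof.
move=> ck; elim: g U l w => [//|[f b'] g IHg] U [d b0] w.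
rewrite [okc _ _]/= [good _ _]/= => /and3P[/andP[fk kb'] cf ok] lk /andP[lk' gd].
rewrite /= => H1 H2 H3 H4.
have b'b0 : (b' <= b0)%N := linkok_col lk.
have /covP[fb' wfb' hcov] := cf.
have safe_here : (b' < b)%N -> (f < c)%N -> ~~ (mu < w b' < w c)%N.
  move=> b'b fc; move: b'b0; rewrite leq_eqVlt => /orP[/eqP e|lt]; last first.
    by apply: H1; rewrite kb' lt.
  rewrite e in b'b *; have [cU h] := H2 b'b; apply: h.
  move: lk; rewrite /linkok /prec /desc /= e ltnn eqxx /=.
  case: (ltngtP d c) => //= [cd|dc]; last by rewrite dc cU; lia.
  by lia.
split=> //; apply: (IHg (d :: U) (f, b')) => //=.
- move=> b1 /andP[kb1 b1b'].
  rewrite (trEn w (i := b1)); [|lia|lia].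
  have [e|ne] := eqVneq f c.
    subst f; rewrite trEl; have := hcov b1; have := H1 b1.
    by have := Sinf_neq w (i := b1) (j := c); lia.
  by rewrite trEn; [apply: H1; lia | lia | lia].
- move=> b'b; split=> // hf; rewrite trEr.
  have fc : f != c by move: hf; case: (eqVneq f c) => // ->; rewrite ltnn.
  rewrite trEn; [|lia|lia].
  case/orP: hf => [lt|/andP[lt fr]].
    have := safe_here b'b lt; have := hcov c lt.
    by have := Sinf_neq w (i := c) (j := b'); lia.
  by have := H3 f; rewrite lt fk fr => /(_ isT isT); lia.
- move=> r /andP[cr rk]; rewrite !inE !negb_or => /and3P[rf rd rU].
  rewrite (trEn w (i := r)); [|lia|lia].
  have := H3 r; rewrite cr rk !inE negb_or rd rU => /(_ isT isT) h.
  have [e|ne] := eqVneq f c.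
    subst f; rewrite trEl => /h h'; have := hcov r cr.
    by have := Sinf_neq w (i := r) (j := b'); lia.
  by rewrite trEn //; lia.
- by rewrite inE H4 orbT.
Qed.

Lemma safe_chain U c b u g : okc u ((c, b) :: g) -> good U ((c, b) :: g) ->
  safe c b (u c) (tr u c b) g.
Proof.
move=> /= /and3P[/andP[ck kb] cv ok] /andP[lk gd].
have /covP[cb ucb hcov] := cv.
apply: (@safe_from _ _ _ U (c, b)) => //=; rewrite ?ltnn //.
- move=> b1 h; rewrite trEl trEn; [|lia|lia].
  by have := hcov b1; lia.
- move=> r /andP[cr rk] _; rewrite trEl trEn; [|lia|lia].
  have := hcov r cr; have := Sinf_neq u (i := r) (j := b); lia.
- by rewrite mem_head.
Qed.

(** A cover in the row [f] would have the value at [c] in between, unless it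
    moved to the left a value that is excluded by [safe]. *)
Lemma never_used c b mu f w g : (c < k)%N -> (f < c)%N -> okc w g ->
  (forall l g', g = l :: g' -> (l.2 <= b)%N) ->
  sorted geq (unzip2 g) ->
  safe c b mu w g -> (k <= b)%N -> (mu <= w f < w c)%N -> (w b <= mu)%N -> f \notin unzip1 g.
Proof.
move=> ck fc; elim: g w => [//|[a b'] g IHg] w /= /and3P[/andP[ak kb'] cv ok] hb srt.
have b'b : (b' <= b)%N by apply: (hb (a, b') g).
move=> [sf sf'] kb /andP[K1 K1'] K2.
have /covP[ab' wab' hcov] := cv.
rewrite inE negb_or; apply/andP; split.
  apply/eqP => e; subst a; have := hcov c fc; have := Sinf_neq w (i := c) (j := b').
  by move: b'b; rewrite leq_eqVlt => /orP[/eqP e|lt]; [subst b'; lia | have := sf lt fc; lia].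
have fa : f != a.
  apply/eqP => e; subst a; have := hcov c fc; have := Sinf_neq w (i := c) (j := b').
  by move: b'b; rewrite leq_eqVlt => /orP[/eqP e|lt]; [subst b'; lia | have := sf lt fc; lia].
apply: (IHg (tr w a b')) => //.
- move=> [a2 b2] g2 e; move: srt; rewrite e /= => /andP[h _].
  by apply: leq_trans b'b.
- exact: path_sorted srt.
- rewrite (trEn w (i := f)) //; last by lia.
  have [e|ne] := eqVneq c a; first by subst a; rewrite trEl; lia.
  by rewrite trEn //; lia.
have [e|ne] := eqVneq b b'; first by subst b'; rewrite trEr; have := sf; lia.
by rewrite trEn //; lia.
Qed.

Lemma good_sorted U g : good U g -> sorted geq (unzip2 g).
Proof.
elim: g U => [//|l g IHg] U /= /andP[lk /IHg]; case: g lk {IHg} => [//|l' g] lk /= ->.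
by rewrite andbT; apply: linkok_col lk.
Qed.

(** The row [f] receives the value that [c] has just given up, so that
    [never_used] applies to it. *)
Lemma spoiled U c f b u g : (f < c)%N -> okc u [:: (c, b), (f, b) & g] ->
  good U [:: (c, b), (f, b) & g] -> f \notin unzip1 g.
Proof.
move=> fc ok gd; have [_ sf] := safe_chain ok gd.
have srt : sorted geq (unzip2 g).
  by move: gd => /andP[_ /andP[_ /good_sorted]].
have hb l g' : g = l :: g' -> (l.2 <= b)%N.
  by move: gd => /andP[_ /andP[+ _]] e; rewrite e => /linkok_col.
move: ok => /= /and5P[/andP[ck kb] c1 _ c2 ok].
have /covP[cb ucb _] := c1; have /covP[fb] := c2.
rewrite trEr (trEn u (i := f)); [|lia|lia] => ufc _.
apply: (never_used ck fc ok hb srt sf kb).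
  rewrite trEl trEr; rewrite trEn; [|lia|lia].
  by rewrite trEl ucb leqnn.
by rewrite trEr trEn; lia.
Qed.

Lemma okc_cat u g1 g2 : okc u (g1 ++ g2) = okc u g1 && okc (endS u g1) g2.
Proof. by elim: g1 u => //= l g IHg u; rewrite IHg !andbA. Qed.

Lemma okc_len u g : okc u g -> len (endS u g) = (len u + size g)%N.
Proof.
elim: g u => [|l g IHg] u /=; first by rewrite addn0.
move=> /and3P[_ cv /IHg ->]; have /andP[_ /eqP ->] := cv; lia.
Qed.

Lemma row_mono u g a : okc u g -> (a < k)%N -> (u a <= endS u g a)%N.
Proof.
elim: g u => [//|l g IHg] u /= /and3P[/andP[lk kl] cv ok] ak.
apply: leq_trans (IHg _ ok ak); have /covP[_ h _] := cv.
have [e|ne] := eqVneq a l.1; first by rewrite e trEl ltnW.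
by rewrite trEn //; lia.
Qed.

Lemma col_mono u g b : okc u g -> (k <= b)%N -> (endS u g b <= u b)%N.
Proof.
elim: g u => [//|l g IHg] u /= /and3P[/andP[lk kl] cv ok] kb.
apply: leq_trans (IHg _ ok kb) _; have /covP[_ h _] := cv.
have [e|ne] := eqVneq b l.2; first by rewrite e trEr ltnW.
by rewrite trEn //; lia.
Qed.

Lemma col_fix u g b : okc u g -> (k <= b)%N -> b \notin unzip2 g -> endS u g b = u b.
Proof.
elim: g u => [//|l g IHg] u /= /and3P[/andP[lk kl] cv ok] kb.
by rewrite inE negb_or => /andP[bl bg]; rewrite IHg // trEn //; lia.
Qed.

Lemma row_fix u g a : okc u g -> (a < k)%N -> a \notin unzip1 g -> endS u g a = u a.
Proof.
elim: g u => [//|l g IHg] u /= /and3P[/andP[lk kl] cv ok] kb.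
by rewrite inE negb_or => /andP[bl bg]; rewrite IHg // trEn //; lia.
Qed.

Lemma sorted_le b (s : seq nat) : path geq b s -> forall x, x \in s -> (x <= b)%N.
Proof.
elim: s b => [//|y s IHs] b /= /andP[yb /IHs h] x; rewrite inE => /orP[/eqP -> //|/h xy].
exact: leq_trans xy yb.
Qed.

(** If [c] gave up the smaller value, then [never_used] would freeze the row
    [a], which the other chain increases. *)
Lemma first_label_le U v a c b g g' :
  okc v ((a, b) :: g) -> okc v ((c, b) :: g') -> good U ((c, b) :: g') ->
  endS v ((a, b) :: g) = endS v ((c, b) :: g') -> (v a <= v c)%N.
Proof.
move=> ok ok' gd' e; rewrite leqNgt; apply/negP => vca.
have sf := safe_chain ok' gd'.
have srt := good_sorted gd'.
have aE := congr1 (fun w : Sinf => w a) e.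
move: ok ok' => /= /and3P[/andP[ak kb] c1 ok] /and3P[/andP[ck _] c2 ok'].
have /covP[ab vab _] := c1; have /covP[cb vcb hcov] := c2.
have ac : (a < c)%N.
  rewrite ltnNge; apply/negP => h; have ca : a != c by apply: contraTneq vca => ->; rewrite ltnn.
  by have := hcov a; lia.
have nu : a \notin unzip1 g'.
  apply: (never_used ck ac ok' _ _ sf kb).
  - move=> l g2 e2; move: srt; rewrite e2 /= => /andP[h _]; exact: h.
  - exact: path_sorted srt.
  - by rewrite trEl trEn; lia.
  - by rewrite trEr.
have := row_mono ok ak; rewrite trEl; move: aE => /= ->.
rewrite (row_fix ok' ak nu) trEn; lia.
Qed.

(** The first column is the largest position whose value changes from [v] to
    the end. The first row then agrees by [first_label_le]. *)
Lemma chain_unique U v g g' : okc v g -> okc v g' -> good U g -> good U g' ->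
  endS v g = endS v g' -> g = g'.
Proof.
elim: g g' U v => [|[a b] g IHg] [|[a' b'] g'] U v // ok ok' gd gd' e.
- by have := okc_len ok'; rewrite -e /=; lia.
- by have := okc_len ok; rewrite e /=; lia.
have bb (c d c' d' : nat) h h' : okc v ((c, d) :: h) -> okc v ((c', d') :: h') ->
    good U ((c, d) :: h) -> endS v ((c, d) :: h) = endS v ((c', d') :: h') -> (d' <= d)%N.
  move=> o o' gd0 e0; rewrite leqNgt; apply/negP => dd.
  have srt := good_sorted gd0.
  have nd : d' \notin unzip2 ((c, d) :: h).
    apply/negP => /=; rewrite inE => /orP[/eqP h1|/(sorted_le srt)]; last by rewrite leqNgt dd.
    by rewrite h1 ltnn in dd.
  have kd' : (k <= d')%N by move: o' => /= /andP[/andP[]].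
  have := col_fix o kd' nd; rewrite e0 /=.
  move: o' => /= /and3P[_ /covP[_ lt _] o']; have := col_mono o' kd'; rewrite trEr; lia.
have eb : b = b'.
  by apply/eqP; rewrite eqn_leq (bb _ _ _ _ _ _ ok' ok gd' (esym e)) (bb _ _ _ _ _ _ ok ok' gd e).
subst b'.
have ea : a = a'.
  apply: (@Sinf_inj v); apply/eqP; rewrite eqn_leq.
  by rewrite (first_label_le ok ok' gd' e) (first_label_le ok' ok gd (esym e)).
subst a'; congr (_ :: _).
move: ok ok' gd gd' => /= /and3P[_ _ ok] /and3P[_ _ ok'] /andP[_ gd] /andP[_ gd'].
exact: IHg ok ok' gd gd' e.
Qed.

End ChainCombinatorics.

(** * Weights and statistics of chains *)

Section ChainWeights.
Variables (R : comPzRingType) (t : R) (k : nat).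
Implicit Types (U : seq nat) (g : seq (nat * nat)) (l : nat * nat).

(** The average of [link] over the colour of the moved value. The values at
    the used rows [U] have colour 1 when they are moved. *)
Definition mean_link U l g : R :=
  let asc := if l.1 \in U then -1 else - (1 - t) in
  if g is l' :: _ then
    if prec l l' then asc
    else if desc l l' then (if l.1 \in U then 0 else t) else 0
  else asc.

Fixpoint mean_wt U g : R :=
  if g is l :: g' then mean_link U l g' * mean_wt (l.1 :: U) g' else 1.

Lemma mean_wtS U (a b : nat) g : mean_wt U ((a, b) :: g) =
  (if g is l' :: _ then
    if prec (a, b) l' then (if a \in U then -1 else - (1 - t))
    else if desc (a, b) l' then (if a \in U then 0 else t) else 0
  else (if a \in U then -1 else - (1 - t))) * mean_wt (a :: U) g.
Proof. by case: g. Qed.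

Lemma prec_desc l l' : prec l l' -> desc l l' = false.
Proof. by rewrite /prec /desc; natify; lia. Qed.

Lemma wt_not_chain (S : nat -> bool) u g : all (fun l : nat * nat => (l.1 < k <= l.2)%N) g -> ~~ okc k u g ->
  wt R S u g = 0.
Proof.
elim: g u => [//|l g IHg] u /= /andP[-> al] /=.
by case: (cov _ _ _) => /= h; rewrite ?mul0r // IHg // mulr0.
Qed.

(** [E] are the unused rows, whose values have free colours, and [S0] are the
    values known to have colour 0. The hypotheses say that a value in [S0] at
    a used row is not moved again by labels that follow the rules, and that
    one in a column is picked up by the next label and then not moved again.
    By [spoiled] this is preserved along the chain. *)
Lemma csum_wt_gen g : forall U E (u : Sinf) (S0 : nat -> bool),
  okc k u g -> uniq E -> all (fun r => (r < k)%N) E ->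
  (forall r, (r < k)%N -> (r \in U) = (r \notin E)) ->
  (forall r i, (r < k)%N -> r \notin E -> S0 (u r) -> good U (take i g) -> r \notin unzip1 (take i g)) ->
  (forall c l g', (k <= c)%N -> S0 (u c) -> g = l :: g' ->
     l.2 = c /\ forall i, good U (l :: take i g') -> l.1 \notin unzip1 (take i g')) ->
  (forall r, r \in E -> S0 (u r) = false) ->
  csum t (map u E) (fun S => wt R (fun z => S z || S0 z) u g) = mean_wt U g.
Proof.
have csum1 s : csum t s (fun _ => 1) = 1.
  by elim: s => //= y s ->; ring.
elim: g => [|l g IHg] U E u S0; first by move=> *; apply: csum1.
case: l => a b; rewrite [okc _ _ _]/= => /and3P[/andP[ak kb] cv ok] uE kE UE H1 H2 H3.
set u' := tr u a b.
have u'E r : (r < k)%N -> r != a -> u' r = u r by move=> rk ra; rewrite /u' trEn //; lia.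
have mapE (E' : seq nat) : all (fun r => (r < k)%N) E' -> a \notin E' -> map u' E' = map u E'.
  move=> kE' aE'; apply/eq_in_map => r rE'; apply: u'E; first exact: (allP kE').
  by apply: contraNneq aE' => <-.
have wtE S : wt R S u ((a, b) :: g) = link R (S (u a)) (a, b) g * wt R S u' g.
  by rewrite /= cv mul1r.
(* Colours of the values at used rows and at columns after the first cover. *)
have H1' (E' : seq nat) : linkok U (a, b) g -> {subset E <= a :: E'} ->
    forall r i, (r < k)%N -> r \notin E' -> S0 (u' r) -> good (a :: U) (take i g) ->
    r \notin unzip1 (take i g).
  move=> lk EE' r i rk rE' Sr gd.
  have gd' : good U ((a, b) :: take i g).
    rewrite /= gd andbT; case: i {gd} => [|i]; first by rewrite take0.
    by case: (g) lk.
  have [e|ra] := eqVneq r a.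
    subst r; move: Sr; rewrite /u' trEl => Sb.
    by have [_ h] := H2 b (a, b) g kb Sb erefl; apply: h.
  have rE : r \notin E by apply/negP => /EE'; rewrite inE (negbTE ra) (negbTE rE').
  move: Sr; rewrite u'E // => Sr.
  by have := H1 r i.+1 rk rE Sr gd'; rewrite /= inE negb_or => /andP[].
have H2' c : (k <= c)%N -> c != b -> S0 (u' c) = false.
  move=> kc cb; rewrite /u' trEn //; last by lia.
  apply/negP => Sc; have [e _] := H2 c (a, b) g kc Sc erefl.
  by rewrite -e eqxx in cb.
have [aE|aE] := boolP (a \in E); last first.
  have aU : a \in U by rewrite UE.
  have Sa : S0 (u a) = false.
    apply/negP => Sa; have := H1 a 1 ak aE Sa.
    by rewrite /= take0 /= inE eqxx => /(_ isT).
  transitivity (link R false (a, b) g * csum t (map u E) (fun S => wt R (fun z => S z || S0 z) u' g)).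
    rewrite -[RHS]addr0 -[X in _ + X](mul0r (csum t (map u E) (fun _ => 0))) -csum_lin.
    apply: csum_ext => S hS; rewrite wtE mul0r addr0 Sa orbF.
    have -> // : S (u a) = false.
    by apply/negP => /hS /mapP[r rE /Sinf_inj e]; rewrite e rE in aE.
  have IH : linkok U (a, b) g ->
      csum t (map u E) (fun S => wt R (fun z => S z || S0 z) u' g) = mean_wt (a :: U) g.
    move=> lk; rewrite -mapE //; apply: IHg => //.
    - move=> r rk; rewrite inE UE //; case: eqVneq => // ->.
      by rewrite aE.
    - by apply: H1' => // r rE; rewrite inE rE orbT.
    - move=> c l g' kc Sc _; exfalso; have [e|cb] := eqVneq c b.
        by move: Sc; rewrite e /u' trEr Sa.
      by rewrite H2' in Sc.
    - move=> r rE; rewrite u'E ?H3 //; first exact: (allP kE).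
      by apply: contraNneq aE => <-.
  move: IH; rewrite mean_wtS /link /linkok aU; case: (g) => [|l' g'] IH.
    by rewrite IH.
  case: ifP => pr; first by rewrite IH ?pr.
  by rewrite /= oppr0 mul0r; case: desc; rewrite mul0r.
have aU : a \notin U by rewrite UE // negbK.
set E' := rem a E.
have EE' : perm_eq E (a :: E') := perm_to_rem aE.
have aE' : a \notin E' by rewrite mem_rem_uniq // inE eqxx.
have E'E : {subset E' <= E} by move=> r; apply: mem_rem.
have kE' : all (fun r => (r < k)%N) E' by apply/allP => r /E'E; apply: (allP kE).
have UE' r : (r < k)%N -> (r \in a :: U) = (r \notin E').
  move=> rk; rewrite inE UE // mem_rem_uniq // inE negb_and negbK.
  by case: eqVneq.
have Sa : S0 (u a) = false by apply: H3.
rewrite (csum_perm _ _ (perm_map u EE')) [csum _ _ _]/=.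
have -> : csum t [seq u i | i <- E'] (fun S => wt R (fun z => S z || S0 z) u ((a, b) :: g))
    = link R false (a, b) g * csum t (map u E') (fun S => wt R (fun z => S z || S0 z) u' g).
  rewrite -[RHS]addr0 -[X in _ + X](mul0r (csum t (map u E') (fun _ => 0))) -csum_lin.
  apply: csum_ext => S hS; rewrite wtE mul0r addr0 Sa orbF.
  have -> // : S (u a) = false.
  by apply/negP => /hS /mapP[r rE /Sinf_inj e]; rewrite e rE in aE'.
have -> : csum t [seq u i | i <- E'] (fun S => wt R (fun z => addc (u a) S z || S0 z) u ((a, b) :: g))
    = link R true (a, b) g *
      csum t (map u E') (fun S => wt R (fun z => S z || addc (u a) S0 z) u' g).
  rewrite -[RHS]addr0 -[X in _ + X](mul0r (csum t (map u E') (fun _ => 0))) -csum_lin.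
  apply: csum_ext => S hS; rewrite wtE mul0r addr0 /addc eqxx /=; congr (_ * wt _ _ _ _).
  by apply: functional_extensionality => z; case: (z == _); rewrite ?orbT.
have sub : {subset E <= a :: E'} by move=> r; rewrite (perm_mem EE').
have H3' r : r \in E' -> u' r = u r.
  move=> rE; apply: u'E; first exact: (allP kE').
  by apply: contraNneq aE' => <-.
rewrite -!mapE //.
have IH1 : linkok U (a, b) g ->
    csum t (map u' E') (fun S => wt R (fun z => S z || S0 z) u' g) = mean_wt (a :: U) g.
  move=> lk; apply: IHg => //; first exact: rem_uniq.
  - exact: H1'.
  - move=> c l g' kc Sc _; exfalso; have [e|cb] := eqVneq c b.
      by move: Sc; rewrite e /u' trEr Sa.
    by rewrite H2' in Sc.
  - by move=> r rE; rewrite H3' // H3 // E'E.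
have IH2 l2 g2 : g = l2 :: g2 -> desc (a, b) l2 ->
    csum t (map u' E') (fun S => wt R (fun z => S z || addc (u a) S0 z) u' g) = mean_wt (a :: U) g.
  move=> eg ds; have lk : linkok U (a, b) g by rewrite eg /= ds aU orbT.
  have [] := andP ds; move=> /eqP /= e2 lt2.
  apply: IHg => //; first exact: rem_uniq.
  - move=> r i rk rE'; rewrite /addc => /orP[/eqP e _|]; last exact: (H1' E' lk sub r i rk rE').
    have h : u' r = u' b by rewrite /u' trEr.
    by move/Sinf_inj: h rk => ->; rewrite ltnNge kb.
  - move=> c l g' kc; rewrite eg /addc => Sc [<- <-].
    have [e|cb] := eqVneq c b; last first.
      move: Sc; rewrite H2' // orbF => /eqP e.
      by rewrite -(trEr u a b) in e; move/Sinf_inj: e cb => ->; rewrite eqxx.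
    subst c; split=> // i gd; apply: (@spoiled k U a l2.1 b u (take i g2) lt2).
      move: ok; rewrite eg -[in X in X -> _](cat_take_drop i g2) -cat_cons okc_cat => /andP[ok' _].
      have -> : (l2.1, b) = l2 by case: (l2) e2 => x y /= ->.
      by apply/and3P; split; [rewrite /= ak kb | | ].
    have -> : (l2.1, b) = l2 by case: (l2) e2 => x y /= ->.
    by rewrite [good _ _]/= ds aU orbT /=.
  - move=> r rE; rewrite H3' // /addc (H3 r (E'E r rE)) orbF; apply/negbTE.
    by rewrite (inj_eq (@Sinf_inj u)); apply: contraNneq aE' => <-.
move: IH1 IH2; rewrite mean_wtS /link /linkok (negbTE aU).
case: (g) => [|l' g'] IH1 IH2.
  by rewrite IH1 // mul0r mulr0 addr0; ring.
case: ifP => pr.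
  rewrite IH1 ?pr // prec_desc // mul0r mulr0 addr0 mulr1n; ring.
rewrite /= oppr0 mul0r mulr0 add0r; case: ifP => ds; last by rewrite !mul0r mulr0.
by rewrite (IH2 l' g') // mul1r.
Qed.

Lemma csum_wt (v : Sinf) g : okc k v g -> csum t (vals k v) (fun S => wt R S v g) = mean_wt [::] g.
Proof.
move=> ok; rewrite -(@csum_wt_gen g [::] (rev (iota 0 k)) v xpred0 ok) //.
- rewrite vals_map; apply: csum_ext => S _; congr (wt _ _ _ _).
  by apply: functional_extensionality => z; rewrite orbF.
- by rewrite rev_uniq iota_uniq.
- by apply/allP => r; rewrite mem_rev mem_iota; lia.
- by move=> r rk; rewrite mem_rev mem_iota rk.
Qed.

Lemma mean_wt0 U g : ~~ good U g -> mean_wt U g = 0.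
Proof.
elim: g U => [//|l g IHg] U /=; rewrite negb_and => /orP[|/IHg ->]; last by rewrite mulr0.
case: g {IHg} => [//|l' g] /=; rewrite negb_or negb_and negbK => /andP[/negbTE -> h].
case: ifP => ds; last by rewrite mul0r.
by move: h; rewrite ds /= => ->; rewrite mul0r.
Qed.
End ChainWeights.

Section ChainStatistics.
Implicit Types (U : seq nat) (g : seq (nat * nat)) (l : nat * nat).

Fixpoint ndesc g : nat :=
  if g is l :: g' then ((if g' is l' :: _ then ~~ prec l l' : nat else 0) + ndesc g')%N else 0%N.

Fixpoint nrep U g : nat :=
  if g is l :: g' then ((l.1 \in U) + nrep (l.1 :: U) g')%N else 0%N.

Lemma nrepE U g : nrep U g
  = count (fun i => ((lab g i).1 \in U) || a_repeats g i) (iota 0 (size g)).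
Proof.
elim: g U => [//|l g IHg] U /=; rewrite IHg /a_repeats /= orbF; congr (_ + _)%N.
rewrite -[1%N]addn0 iotaDl count_map; apply: eq_count => i; rewrite [preim _ _ _]/= add0n !inE.
by rewrite -orbA orbCA.
Qed.

Lemma decreasing_start0 l g : decreasing_start (l :: g) 0.
Proof. by rewrite /decreasing_start /= take0. Qed.

Lemma decreasing_startS l l' g i :
  decreasing_start (l :: l' :: g) i.+1 = desc l l' && decreasing_start (l' :: g) i.
Proof.
rewrite /decreasing_start /desc /=.
by case: (eqVneq l'.2 l.2) => [->|//]; rewrite andbCA.
Qed.

Lemma count_iotaS (P : pred nat) n :
  count P (iota 0 n.+1) = (P 0 + count (fun i => P i.+1) (iota 0 n))%N.
Proof. by rewrite /= -[1%N]addn0 iotaDl count_map. Qed.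

Lemma forced0 l g : forced (l :: g) 0.
Proof. by rewrite /forced decreasing_start0 orbT. Qed.

(** Besides the descents, exactly one cover is forced: the last one of the
    initial decreasing run. *)
Lemma forced_count U l g : good U (l :: g) ->
  count (forced (l :: g)) (iota 0 (size g).+1) = (ndesc (l :: g)).+1.
Proof.
have D h : count (fun i => (i.+1 < size h)%N && ~~ prec (lab h i) (lab h i.+1)) (iota 0 (size h)) = ndesc h.
  elim: h => [//|x h IHh]; rewrite count_iotaS [ndesc _]/= -IHh; congr (_ + _)%N.
  by case: (h).
elim: g U l => [|l' g IHg] U l; rewrite count_iotaS forced0 //.
move=> /andP[lk gd]; rewrite add1n; congr _.+1; rewrite [ndesc _]/=.
case: (boolP (desc l l')) => ds.
  have -> : prec l l' = false by apply: contraTF ds => /prec_desc ->.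
  rewrite add1n -(IHg _ _ gd); apply: eq_count => i /=.
  by rewrite /forced decreasing_startS ds.
move: lk; rewrite /linkok (negbTE ds) orbF => ->; rewrite add0n -[RHS](D (l' :: g)).
by apply: eq_count => i; rewrite /forced decreasing_startS (negbTE ds) orbF.
Qed.

(** [n] counts the covers that are neither descents nor prohibited. *)
Lemma mean_wtE (R : comPzRingType) (t : R) U g : good U g ->
  exists n, (n + ndesc g + nrep U g = size g)%N /\
    mean_wt t U g = (-1) ^+ (n + nrep U g) * t ^+ ndesc g * (1 - t) ^+ n.
Proof.
elim: g U => [|l g IHg] U; first by exists 0%N; rewrite /= !expr0 !mulr1.
rewrite [good _ _]/= => /andP[lk /IHg [n [e pE]]] /=.
rewrite pE; move: lk e {pE IHg}; case: g => [|l' g] /=.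
  move=> _; rewrite !addn0 => /eqP; rewrite ?addn_eq0 => /eqP ->.
  case: (l.1 \in U); [exists 0%N|exists 1%N]; split=> //.
    by rewrite !expr0 !mulr1.
  by rewrite !expr1 !expr0 !mulr1; ring.
move=> lk e; case: (boolP (prec l l')) lk => pr /= lk.
  case: (boolP (l.1 \in U)) => lU /=.
    exists n; split; first by move: e; lia.
    by rewrite !add0n add1n addnS exprS !mulrA.
  exists n.+1; split; first by move: e; lia.
  by rewrite !add0n addSn !exprS; ring.
move/andP: lk => [-> lU]; rewrite (negbTE lU); exists n; split; first by move: e; lia.
by rewrite !add1n add0n exprS; ring.
Qed.

Lemma nrep_le U g : good U g -> (ndesc g + nrep U g <= size g)%N.
Proof. by move=> /(@mean_wtE int 0) [n [<- _]]; lia. Qed.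

(** The first decreasing run of rows ends with a fresh, non-descending label. *)
Lemma forced_prohibited_le U l g : good U (l :: g) -> all (fun r => (l.1 < r)%N) U ->
  ((ndesc (l :: g)).+1 + nrep U (l :: g) <= (size g).+1)%N.
Proof.
elim: g U l => [|l' g IHg] U l gd lU.
  by move: lU => /=; case: (boolP (l.1 \in U)) => // h /allP /(_ _ h); rewrite ltnn.
have fr : l.1 \notin U by apply/negP => /(allP lU); rewrite ltnn.
have [lk {}gd] : linkok U l (l' :: g) /\ good (l.1 :: U) (l' :: g) by apply/andP.
have := nrep_le gd; rewrite [ndesc (l :: _)]/= [nrep U (l :: _)]/= (negbTE fr) add0n.
move: lk; rewrite /linkok; case: (boolP (prec l l')) => [pr _ /=|pr /= /andP[/andP[_ ds] _] _]; first by lia.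
have h : all (fun r => (l'.1 < r)%N) (l.1 :: U).
  by rewrite /= ds; apply/allP => r /(allP lU); apply: ltn_trans.
by have := IHg _ _ gd h; rewrite /=; lia.
Qed.

Lemma goodP U g : reflect (forall i, (i.+1 < size g)%N ->
    prec (lab g i) (lab g i.+1) || desc (lab g i) (lab g i.+1)
      && ~~ (((lab g i).1 \in U) || a_repeats g i)) (good U g).
Proof.
elim: g U => [|l g IHg] U /=; first by apply: (iffP idP).
apply: (iffP andP) => [[lk /IHg h] [|i] hi|h].
- case: (g) lk hi => [//|l' g'] /= lk _.
  by rewrite /a_repeats /= orbF.
- have := h i hi; rewrite /a_repeats /lab /= !inE => h'.
  by rewrite [X in ~~ X]orbA [X in ~~ (X || _)]orbC.
split; first by case: (g) h => [//|l' g'] /(_ 0%N isT); rewrite /a_repeats /= orbF.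
apply/IHg => i hi; have := h i.+1 hi; rewrite /a_repeats /lab /= !inE.
by rewrite [X in ~~ X]orbA [X in ~~ (X || _)]orbC.
Qed.

(** Consecutive labels of a chain differ, so that under (P1) they satisfy
    [prec] or [desc]. *)
Lemma goodE (k : nat) (v : Sinf) g : okc k v g -> (condP0 g /\ condP1 g) <-> good [::] g.
Proof.
move=> ok; split=> [[P0 P1]|gd]; last first.
  split; last exact: good_sorted gd.
  move=> i i0 hi rp; move/goodP: gd => /(_ i hi); rewrite rp orbT andbF orbF //.
apply/goodP => i hi; have ds : prec (lab g i) (lab g i.+1) || desc (lab g i) (lab g i.+1).
  move: {P0} v ok i hi P1; rewrite /condP1.
  elim: g => [//|l g IHg] v ok [|i] hi; last first.
    move=> srt; apply: (IHg (tr v l.1 l.2)) => //; first by move: ok => /= /and3P[].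
    exact: path_sorted srt.
  case: g {IHg} ok hi => [//|l' g] /= /and5P[_ c1 _ c2 _] _ /andP[h _].
  have /covP[_ lt1 _] := c1; have /covP[_ lt2 _] := c2.
  rewrite /lab /= /prec /desc; case: ltngtP h => //= e _.
  case: ltngtP => // e1; exfalso; move: lt2; rewrite -e -e1 trEl trEr.
  by rewrite e ltnNge (ltnW lt1).
case: (posnP i) => [e|ip]; first by subst i; rewrite /a_repeats take0 /= andbT.
case: (boolP (a_repeats g i)) => rp; last by rewrite /= andbT.
by rewrite (P0 i ip hi rp).
Qed.
End ChainStatistics.

(** * Exchanging variables in polynomials *)

Section TwistedQuotients.
Variables (R : comPzRingType) (d f g f' g' sf sg : R).
Hypotheses (ef : d * f' = f - sf) (eg : d * g' = g - sg).

Lemma twisted_quotientB : d * (f' - g') = (f - g) - (sf - sg).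
Proof. by rewrite mulrBr ef eg; ring. Qed.

(** The divided difference is a derivation twisted by [s]. *)
Lemma twisted_quotientM : d * (f' * g + sf * g') = f * g - sf * sg.
Proof. by rewrite mulrDr mulrA ef mulrCA eg; ring. Qed.
End TwistedQuotients.

Section Polynomials.
Implicit Types (f g h : ZX) (s : nat -> nat) (m : {cmonom nat}).
Local Notation U := (@ucm nat).

Lemma mulcm_inj m : injective (mulcm m).
Proof.
move=> m1 m2 /(congr1 (fun x : {cmonom nat} => fun i => x i)) e.
apply/eqP/cmP => i; have := congr1 (fun x => x i) e.
by rewrite !mulcmE => /eqP; rewrite eqn_add2l => /eqP.
Qed.

Lemma coef_varX (i : nat) f m :
  ('x_i * f)@_m = \sum_(k <- msupp f) f@_k *+ (mulcm (U i) k == m).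
Proof.
rewrite malgM_def fgmulUg raddf_sum; apply: eq_bigr => k _.
by rewrite /= mcoeffU mul1r.
Qed.

Lemma coef_varXM (i : nat) f m : ('x_i * f)@_(mulcm (U i) m) = f@_m.
Proof.
rewrite coef_varX [in RHS](monalgE f) raddf_sum; apply: eq_bigr => k _.
by rewrite /= mcoeffU (inj_eq (@mulcm_inj _)).
Qed.

Lemma coef_varX0 (i : nat) f m : m i = 0%N -> ('x_i * f)@_m = 0.
Proof.
move=> mi; rewrite coef_varX big1 // => k _.
by case: eqP => // e; move: mi; rewrite -e mulcmE ucmE eqxx.
Qed.

Lemma divcmK (j : nat) m : m j != 0%N -> mulcm (U j) (divcm m (U j)) = m.
Proof.
move=> mj; apply/eqP/cmP => i; rewrite mulcmE divcmE ucmE.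
case: eqVneq => [<-|_] /=; last by rewrite subn0.
by rewrite add1n subn1 prednK // lt0n.
Qed.

(** The coefficient of [m] in [f] is that of [m 'x_i / 'x_j], and it is 0 if
    ['x_j] does not occur in [m]; so the coefficients vanish by induction on
    the exponent of ['x_j]. *)
Lemma varB_neq0 (i j : nat) f : i != j -> ('x_i - 'x_j) * f = 0 -> f = 0.
Proof.
move=> ij e0; have e1 : 'x_i * f = 'x_j * f by apply/eqP; rewrite -subr_eq0 -mulrBl e0.
have H n : forall m, (m j <= n)%N -> f@_m = 0.
  elim: n => [|n IHn] m mj; rewrite -(coef_varXM i) e1.
    by apply: coef_varX0; rewrite mulcmE ucmE (negbTE ij); move: mj; case: (m j).
  have [mj0|mj0] := eqVneq (m j) 0%N.
    by apply: coef_varX0; rewrite mulcmE ucmE (negbTE ij) mj0.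
  rewrite -{1}(divcmK mj0) mulcmA [mulcm (U i) _]mulcmC -mulcmA coef_varXM.
  by apply: IHn; rewrite mulcmE divcmE !ucmE (negbTE ij) eqxx add0n leq_subLR add1n.
by apply/malgP => m; rewrite mcoeff0; apply: (H (m j)).
Qed.

Lemma varB_inj (i j : nat) f g : i != j -> ('x_i - 'x_j) * f = ('x_i - 'x_j) * g -> f = g.
Proof.
move=> ij e; apply/eqP; rewrite -subr_eq0; apply/eqP/(varB_neq0 ij).
by rewrite mulrBr e subrr.
Qed.

Lemma ZX_ind (P : ZX -> Prop) : P 1 -> (forall f g, P f -> P g -> P (f - g)) ->
  (forall f g, P f -> P g -> P (f * g)) -> (forall i : nat, P 'x_i) -> forall f, P f.
Proof.
move=> P1 PB PM PX.
have P0 : P 0 by rewrite -(subrr 1); apply: PB.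
have PN f : P f -> P (- f) by rewrite -[- f]sub0r; apply: PB.
have PD f g : P f -> P g -> P (f + g).
  by move=> Pf Pg; rewrite -[g]opprK; apply/PB/PN.
have Pn (n : nat) : P n%:R by elim: n => // n IHn; rewrite mulrS; apply: PD.
have Pz (c : int) : P c%:MP.
  rewrite -[c]intz rmorph_int; case: c => n; first exact: Pn.
  by rewrite NegzE mulrNz; apply: PN; apply: Pn.
have Pm n : forall m, (mdeg m <= n)%N -> P << m >>.
  elim: n => [|n IHn] m.
    by rewrite leqn0 mdeg_eq0 => /eqP ->; apply: P1.
  case: (fset_0Vmem (finsupp m)) => [e _|[j jm] dm].
    have -> : m = onecm nat by apply/eqP/cmP => i; rewrite onecmE; apply/eqP; rewrite cmE_eq0 e.
    exact: P1.
  have mj : m j != 0%N by rewrite cmE_neq0.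
  have := divcmK mj; move: (divcm m _) => m' em.
  have -> : << m >> = 'x_j * << m' >> :> ZX.
    by rewrite malgM_def fgmulUU mulr1 -[X in _ = << _ *g X >>]/(mulcm (U j) m') em.
  apply: (PM _ _ (PX j)); apply: (IHn m'); move: dm; rewrite -em.
  by rewrite (mdegM (U j) m') mdegU.
move=> f; rewrite (monalgE f); elim: (enum_fset _) => [|m r IHr].
  by rewrite big_nil.
rewrite big_cons; apply: (PD _ _ _ IHr).
have -> : << f@_m *g m >> = (f@_m)%:MP * << m >> :> ZX.
  by rewrite malgM_def fgmulUU mulr1 /= mul1m.
exact: (PM _ _ (Pz _) (Pm (mdeg m) m (leqnn _))).
Qed.

Definition monact s (m : {cmonom nat}) : ZX := \prod_(j <- finsupp m) 'x_(s j) ^+ m j.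

Lemma monactE s m (D : {fset nat}) : (finsupp m `<=` D)%fset ->
  monact s m = \prod_(j <- D) 'x_(s j) ^+ m j.
Proof.
move=> mD; apply: big_fset_incl => // j _; rewrite -cmE_eq0 => /eqP ->.
by rewrite expr0.
Qed.

Lemma monact_mmorph s : mmorphism (monact s).
Proof.
split=> [m1 m2|]; last by rewrite /monact mdom1 big_seq_fset0.
pose D := (finsupp m1 `|` finsupp m2)%fset.
rewrite !(@monactE s _ D) ?fsubsetUl ?fsubsetUr //; last by rewrite mdomD.
by rewrite -big_split /=; apply: eq_bigr => j _; rewrite cmM exprD.
Qed.

HB.instance Definition _ s := monalg.isMultiplicative.Build {cmonom nat} ZX (monact s)
  (monact_mmorph s).

Lemma actX_rmorph s : exists F : {rmorphism ZX -> ZX}, actX s =1 F.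
Proof. by exists (mmap intr (monact s)). Qed.

Lemma actXB s : {morph actX s : f g / f - g}.
Proof. by have [F FE] := actX_rmorph s => f g; rewrite !FE rmorphB. Qed.
Lemma actXM s : {morph actX s : f g / f * g}.
Proof. by have [F FE] := actX_rmorph s => f g; rewrite !FE rmorphM. Qed.
Lemma actX1 s : actX s 1 = 1.
Proof. by have [F ->] := actX_rmorph s; rewrite rmorph1. Qed.

Lemma actX_var s i : actX s 'x_i = 'x_(s i).
Proof.
rewrite /actX mmapU mul1r mdomU big_seq_fset1 cmU eqxx expr1 //.
Qed.

Lemma eq_rmorph_ZX (F G : ZX -> ZX) : {morph F : f g / f - g} -> {morph F : f g / f * g} ->
  {morph G : f g / f - g} -> {morph G : f g / f * g} -> F 1 = 1 -> G 1 = 1 ->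
  (forall i, F 'x_i = G 'x_i) -> F =1 G.
Proof.
move=> FB FM GB GM F1 G1 FG; elim/ZX_ind => [|f g h1 h2|f g h1 h2|i].
- by rewrite F1 G1.
- by rewrite (FB f g) (GB f g) h1 h2.
- by rewrite (FM f g) (GM f g) h1 h2.
exact: FG.
Qed.

Lemma actX_comp s1 s2 f : actX s1 (actX s2 f) = actX (fun i => s1 (s2 i)) f.
Proof.
apply: (@eq_rmorph_ZX (fun f => actX s1 (actX s2 f))) => [g h|g h|||||i].
- by rewrite (actXB s2 g h) actXB.
- by rewrite (actXM s2 g h) actXM.
- exact: actXB.
- exact: actXM.
- by rewrite (actX1 s2) actX1.
- exact: actX1.
by rewrite (actX_var s2) (actX_var s1) (actX_var _ i).
Qed.

Lemma eq_actX s1 s2 f : s1 =1 s2 -> actX s1 f = actX s2 f.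
Proof.
move=> e; apply: (@eq_rmorph_ZX (actX s1) (actX s2)) => [||||||i].
- exact: actXB.
- exact: actXM.
- exact: actXB.
- exact: actXM.
- exact: actX1.
- exact: actX1.
by rewrite (actX_var s1) (actX_var s2) e.
Qed.

Lemma actX_id f : actX id f = f.
Proof.
apply: (@eq_rmorph_ZX (actX id) id) => // [|||i].
- exact: actXB.
- exact: actXM.
- exact: actX1.
exact: actX_var.
Qed.

Lemma divdiffP i f : ('x_i - 'x_i.+1) * divdiff i f = f - actX (trfun i i.+1) f.
Proof.
apply: (epsilon_spec (inhabits 0) (fun g : ZX => _ * g = f - actX (trfun i i.+1) f)).
set s := trfun i i.+1; move: f.
have [d ed] : exists d, d = 'x_i - 'x_i.+1 by eexists.
rewrite -ed; apply: ZX_ind => [|f g [f' ef] [g' eg]|f g [f' ef] [g' eg]|j].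
- by exists 0; rewrite (actX1 s) (subrr 1) (mulr0 d).
- by exists (f' - g'); rewrite (actXB s f g); apply: twisted_quotientB ef eg.
- exists (f' * g + actX s f * g').
  by rewrite (actXM s f g); apply: twisted_quotientM ef eg.
rewrite (actX_var s) /s /trfun; case: (eqVneq j i) => [->|_].
  by exists 1; rewrite (mulr1 d) ed.
case: (eqVneq j i.+1) => [->|_].
  exists (-1); exact: etrans (mulrN1 d) (etrans (congr1 -%R ed) (opprB _ _)).
exists 0; exact: etrans (mulr0 d) (esym (subrr _)).
Qed.

End Polynomials.

(** The data needed to define Grothendieck polynomials in an arbitrary
    commutative ring. *)
Record isosys (R : comPzRingType) (x : nat -> R) (s iso : nat -> R -> R) : Prop := IsoSys {
  iso_sB : forall i, {morph s i : f g / f - g};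
  iso_sM : forall i, {morph s i : f g / f * g};
  iso_s1 : forall i, s i 1 = 1;
  iso_sx : forall i j, s i (x j) = x (trfun i i.+1 j);
  iso_sK : forall i f, s i (s i f) = f;
  iso_scomm : forall i j f, (i.+1 < j)%N -> s i (s j f) = s j (s i f);
  iso_sbraid : forall i f, s i (s i.+1 (s i f)) = s i.+1 (s i (s i.+1 f));
  iso_P : forall i f, (x i - x i.+1) * iso i f = (1 - x i.+1) * f - (1 - x i) * s i f;
  iso_cancel : forall i j f g, i != j -> (x i - x j) * f = (x i - x j) * g -> f = g
}.

Lemma ZX_isosys : isosys varX (fun i => actX (trfun i i.+1)) isobaric.
Proof.
split.
- by move=> i; apply: actXB.
- by move=> i; apply: actXM.
- by move=> i; apply: actX1.
- by move=> i j; apply: actX_var.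
- move=> i f; exact: etrans (actX_comp _ _ f) (etrans (eq_actX f (@trfunK i i.+1)) (actX_id f)).
- move=> i j f ij; apply: etrans (actX_comp _ _ f) (etrans _ (esym (actX_comp _ _ f))).
  by apply: eq_actX => r; rewrite /trfun; repeat case: eqP => //; lia.
- move=> i f.
  have E a b : actX (trfun a a.+1) (actX (trfun b b.+1) (actX (trfun a a.+1) f))
      = actX (fun r => trfun a a.+1 (trfun b b.+1 (trfun a a.+1 r))) f.
    exact: etrans (congr1 _ (actX_comp _ _ f)) (actX_comp _ _ f).
  transitivity (actX (fun r => trfun i i.+1 (trfun i.+1 i.+2 (trfun i i.+1 r))) f).
    exact: E.
  transitivity (actX (fun r => trfun i.+1 i.+2 (trfun i i.+1 (trfun i.+1 i.+2 r))) f); last first.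
    exact: esym (E i.+1 i).
  by apply: eq_actX => r; rewrite /trfun; repeat case: eqP => //; lia.
- move=> i f; apply: etrans (divdiffP i ((1 - 'x_i.+1) * f)) _; congr (_ - _).
  apply: etrans (actXM _ _ f) _; congr (_ * _).
  apply: etrans (actXB _ 1 'x_i.+1) _.
  have e : trfun i i.+1 i.+1 = i by rewrite /trfun eqxx gtn_eqF.
  exact: (f_equal2 (fun a b : ZX => a - b) (actX1 _) (etrans (actX_var _ i.+1) (congr1 varX e))).
exact: varB_inj.
Qed.

(** * Isobaric operators *)

Section IsobaricCalculus.
Variables (R : comPzRingType) (x : nat -> R) (s iso : nat -> R -> R).
Hypothesis X : isosys x s iso.
Local Notation y i := (1 - x i).

Lemma sXB i : {morph s i : f g / f - g}. Proof. exact: iso_sB X i. Qed.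
Lemma sXM i : {morph s i : f g / f * g}. Proof. exact: iso_sM X i. Qed.
Lemma sX0 i : s i 0 = 0.
Proof. by have := sXB i 0 0; rewrite !subrr. Qed.
Lemma sXD i : {morph s i : f g / f + g}.
Proof. by move=> f g; rewrite -{1}[g]opprK -{1}[- g]sub0r !sXB sX0 sub0r opprK. Qed.
Lemma sXK i f : s i (s i f) = f. Proof. exact: iso_sK X i f. Qed.

Lemma sXXn i f n : s i (f ^+ n) = s i f ^+ n.
Proof. by elim: n => [|n IHn]; rewrite ?(iso_s1 X) // !exprS sXM IHn. Qed.

Lemma sXy i : s i (y i) = y i.+1.
Proof. by rewrite sXB (iso_s1 X) (iso_sx X) /trfun eqxx. Qed.
Lemma sXy' i : s i (y i.+1) = y i.
Proof. by rewrite sXB (iso_s1 X) (iso_sx X) /trfun eqxx gtn_eqF. Qed.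
Lemma sXyn i j : j != i -> j != i.+1 -> s i (y j) = y j.
Proof. by move=> a b; rewrite sXB (iso_s1 X) (iso_sx X) /trfun (negbTE a) (negbTE b). Qed.

Lemma isoP i f : (y i.+1 - y i) * iso i f = y i.+1 * f - y i * s i f.
Proof.
have -> : y i.+1 - y i = x i - x i.+1 by ring.
exact: (iso_P X).
Qed.

Lemma y_inj (i j : nat) f g : i != j -> (y i - y j) * f = (y i - y j) * g -> f = g.
Proof.
move=> ij; have -> : y i - y j = x j - x i by ring.
by apply: (iso_cancel X); rewrite eq_sym.
Qed.

Lemma isoE i f g : (y i.+1 - y i) * g = y i.+1 * f - y i * s i f -> iso i f = g.
Proof. by move=> e; apply: (@y_inj i.+1 i); rewrite ?isoP ?e // gtn_eqF. Qed.

Lemma isoB i : {morph iso i : f g / f - g}.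
Proof.
by move=> f g; apply: isoE; rewrite mulrBr !isoP sXB; ring.
Qed.
Lemma isoD i : {morph iso i : f g / f + g}.
Proof.
by move=> f g; apply: isoE; rewrite mulrDr !isoP sXD; ring.
Qed.

Lemma isoZ i f g : s i f = f -> iso i (f * g) = f * iso i g.
Proof.
by move=> e; apply: isoE; rewrite mulrCA isoP sXM e; ring.
Qed.

Lemma sX_iso i f : s i (iso i f) = iso i f.
Proof.
apply: (@y_inj i.+1 i); first by rewrite gtn_eqF.
have := congr1 (s i) (isoP i f).
rewrite sXM [s i (_ * f - _)]sXB !(sXM i (y _)) [s i (y i.+1 - y i)]sXB sXy sXy' sXK => e.
by rewrite isoP -opprB mulNr e; ring.
Qed.

Lemma iso_idem i f : iso i (iso i f) = iso i f.
Proof. by apply: isoE; rewrite sX_iso mulrBl. Qed.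

(** The correction term in [iso_y'] and [iso_y] is the one that appears in
    [Psi_Yi] and [Psi_Yi1]. *)
Lemma iso_y' i f : iso i (y i.+1 * f) = y i * iso i f + y i.+1 * f.
Proof. by apply: isoE; rewrite mulrDr mulrCA isoP sXM sXy'; ring. Qed.

Lemma iso_y i f : iso i (y i * f) = y i.+1 * iso i f - y i.+1 * f.
Proof. by apply: isoE; rewrite mulrBr mulrCA isoP sXM sXy; ring. Qed.

Lemma iso_comm i j f : (i.+1 < j)%N -> iso i (iso j f) = iso j (iso i f).
Proof.
move=> ij; have sc := iso_scomm X f ij.
have sj : s i (y j) = y j by apply: sXyn; lia.
have sj' : s i (y j.+1) = y j.+1 by apply: sXyn; lia.
have si : s j (y i) = y i by apply: sXyn; lia.
have si' : s j (y i.+1) = y i.+1 by apply: sXyn; lia.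
symmetry; apply: isoE.
transitivity (iso i ((y j.+1 - y j) * iso j f)); first by rewrite isoZ // [LHS]sXB sj sj'.
rewrite isoP isoB !isoZ //; congr (_ - _ * _).
apply: isoE; rewrite sc -{1}si -{1}si' -[LHS]/((s j (y i.+1) - s j (y i)) * _).
by rewrite -(sXB j (y i.+1)) -sXM isoP [LHS]sXB !(sXM j (y _)) si si'.
Qed.

(** Multiplied by the product of the three differences of variables, both
    sides become the same alternating sum over the permutations of three
    variables. *)
Lemma iso_braid i f :
  iso i (iso i.+1 (iso i f)) = iso i.+1 (iso i (iso i.+1 f)).
Proof.
set a := i; set b := i.+1; set c := i.+2.
have sbb : s a (s b (s a f)) = s b (s a (s b f)) := iso_sbraid X i f.
have sc : s a (y c) = y c by apply: sXyn; rewrite /a /c; lia.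
have sa : s b (y a) = y a by apply: sXyn; rewrite /a /b; lia.
have s1 : s a (y a) = y b := sXy a. have s2 : s a (y b) = y a := sXy' a.
have s3 : s b (y b) = y c := sXy b. have s4 : s b (y c) = y b := sXy' b.
have E := (sXM, sXB, s1, s2, s3, s4, sc, sa, sXK).
apply: (@y_inj b a); first by rewrite gtn_eqF.
apply: (@y_inj c b); first by rewrite gtn_eqF.
apply: (@y_inj c a); first by rewrite gtn_eqF // /c /a; lia.
set g1 := iso a f; set g2 := iso b g1; set g3 := iso a g2.
set h1 := iso b f; set h2 := iso a h1; set h3 := iso b h2.
have G1 : (y b - y a) * g1 = y b * f - y a * s a f := isoP a f.
have G2 : (y c - y b) * g2 = y c * g1 - y b * s b g1 := isoP b g1.
have G3 : (y b - y a) * g3 = y b * g2 - y a * s a g2 := isoP a g2.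
have H1 : (y c - y b) * h1 = y c * f - y b * s b f := isoP b f.
have H2 : (y b - y a) * h2 = y b * h1 - y a * s a h1 := isoP a h1.
have H3 : (y c - y b) * h3 = y c * h2 - y b * s b h2 := isoP b h2.
have g1s : s a g1 = g1 := sX_iso a f. have h1s : s b h1 = h1 := sX_iso b f.
have K1 := congr1 (s a) G2; rewrite !E g1s in K1.
have K2 := congr1 (s b) G1; rewrite !E in K2.
have K3 := congr1 (s a) K2; rewrite !E in K3.
have L1 := congr1 (s b) H2; rewrite !E h1s in L1.
have L2 := congr1 (s a) H1; rewrite !E in L2.
have L3 := congr1 (s b) L2; rewrite !E in L3.
pose S := y c ^+ 2 * (y b * f - y a * s a f) - y b ^+ 2 * (y c * s b f - y a * s b (s a f))
  + y a ^+ 2 * (y c * s a (s b f) - y b * s a (s b (s a f))).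
transitivity S.
  have -> : (y c - y a) * ((y c - y b) * ((y b - y a) * g3))
     = (y c - y a) * y b * ((y c - y b) * g2) - (y c - y b) * y a * ((y c - y a) * s a g2).
    by rewrite G3; ring.
  rewrite G2 K1.
  have -> : (y c - y a) * y b * (y c * g1 - y b * s b g1)
     - (y c - y b) * y a * (y c * g1 - y a * s a (s b g1))
     = y c ^+ 2 * ((y b - y a) * g1) - y b ^+ 2 * ((y c - y a) * s b g1)
       + y a ^+ 2 * ((y c - y b) * s a (s b g1)) by ring.
  by rewrite G1 K2 K3.
symmetry.
have -> : (y c - y a) * ((y c - y b) * ((y b - y a) * h3))
   = (y c - y a) * y c * ((y b - y a) * h2) - (y b - y a) * y b * ((y c - y a) * s b h2).
  transitivity ((y c - y a) * (y b - y a) * ((y c - y b) * h3)); first by ring.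
  by rewrite H3; ring.
rewrite H2 L1.
have -> : (y c - y a) * y c * (y b * h1 - y a * s a h1)
   - (y b - y a) * y b * (y c * h1 - y a * s b (s a h1))
   = y b * y c * ((y c - y b) * h1) - y a * y c * ((y c - y a) * s a h1)
     + y a * y b * ((y b - y a) * s b (s a h1)) by ring.
by rewrite H1 L2 L3 /S sbb; ring.
Qed.

(** The isobaric operators lead from one dominant monomial to another. *)
Lemma iso_monomial i (n : nat) h : s i h = h ->
  iso i (x i ^+ n.+1 * x i.+1 ^+ n * h) = x i ^+ n * x i.+1 ^+ n * h.
Proof.
move=> hs; apply: isoE.
have e1 : s i (x i) = x i.+1 by rewrite (iso_sx X) /trfun eqxx.
have e2 : s i (x i.+1) = x i by rewrite (iso_sx X) /trfun eqxx gtn_eqF.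
by rewrite !sXM hs !sXXn e1 e2 !exprS; ring.
Qed.
End IsobaricCalculus.

(** * Descents and the Bruhat operators *)

Section Descents.
Variables (A : zmodType) (i : nat).

(** [tau] is the part of [Psi] at descents; unlike [Psi], it merely exchanges
    positions in the operators [T a b], see [T_tau_gen] and the lemmas after
    it. *)
Definition tau_fun (F : Sinf -> A) (v : Sinf) : A :=
  if (v i.+1 < v i)%N then F (tr v i i.+1) else 0.
Program Definition tau : op A := @Op _ tau_fun _ _.
Next Obligation. by rewrite /tau_fun; case: ifP => //; rewrite addr0. Qed.
Next Obligation. by rewrite /tau_fun; case: ifP => // _; rewrite (morphD0 H). Qed.

(** On Grothendieck polynomials [Psi] is the isobaric operator, see [Psi_G].
    *)
Definition Psi_fun (F : Sinf -> A) (v : Sinf) : A :=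
  if (v i.+1 < v i)%N then F (tr v i i.+1) else F v.
Program Definition Psi : op A := @Op _ Psi_fun _ _.
Next Obligation. by rewrite /Psi_fun; case: ifP. Qed.
Next Obligation. by rewrite /Psi_fun; case: ifP. Qed.

Lemma tauE F v : tau F v = if (v i.+1 < v i)%N then F (tr v i i.+1) else 0.
Proof. by []. Qed.
Lemma PsiE F v : Psi F v = if (v i.+1 < v i)%N then F (tr v i i.+1) else F v.
Proof. by []. Qed.

Local Notation Ti := (@T A i i.+1).

Lemma cov_adj (v : Sinf) : cov v i i.+1 = (v i < v i.+1)%N.
Proof.
by apply/idP/idP => [/covP[]|h]; [|apply/covP; split=> // c; lia].
Qed.

Lemma adj_neq (v : Sinf) : (v i.+1 < v i)%N = ~~ (v i < v i.+1)%N.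
Proof. by have := Sinf_neq v (i := i) (j := i.+1); lia. Qed.

Lemma Psi_tau : Psi = (1 + Ti) * tau.
Proof.
apply: op_ext => F v; rewrite opME opDE op1E PsiE TE !tauE cov_adj adj_neq.
by rewrite trEl trEr trK; case: (v i < v i.+1)%N; rewrite /= ?add0r ?addr0.
Qed.

(** The first product is the identity at ascents, the second one at descents.
    *)
Lemma T_tau_adj : Ti * tau + tau * Ti = 1.
Proof.
apply: op_ext => F v; rewrite opDE !opME op1E tauE !TE tauE !cov_adj adj_neq.
by rewrite trEl trEr trK; case: ltngtP (Sinf_neq v (i := i) (j := i.+1)) => /=;
  rewrite ?add0r ?addr0 //; lia.
Qed.

Lemma T_tau_gen (a b a' b' : nat) :
  (forall v, tr (tr v a b) i i.+1 = tr (tr v i i.+1) a' b') ->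
  (forall v : Sinf, cov v a b && (tr v a b i.+1 < tr v a b i)%N
             = (v i.+1 < v i)%N && cov (tr v i i.+1) a' b') ->
  @T A a b * tau = tau * @T A a' b'.
Proof.
move=> h1 h2; apply: op_ext => F v; rewrite !opME tauE !TE tauE.
rewrite -h1; have := h2 v; case: (cov v a b); case: (v i.+1 < v i)%N => //=.
- by move=> <-.
- by move=> ->.
- by move=> <-.
Qed.

Ltac cov_pos h c := have := h c; have := h i; have := h i.+1;
  have [?|?] := eqVneq c i; [subst c|have [?|?] := eqVneq c i.+1; [subst c|]].

Lemma T_tau0 (a b : nat) : (a < b)%N -> a != i -> a != i.+1 -> b != i -> b != i.+1 ->
  @T A a b * tau = tau * @T A a b.
Proof.
move=> ab ai ai1 bi bi1; apply: T_tau_gen => v; first by apply: tr_comm.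
have [ia ib i1a i1b] : [/\ i != a, i != b, i.+1 != a & i.+1 != b].
  by rewrite ![i == _]eq_sym ![i.+1 == _]eq_sym.
rewrite !(trEn v (a := a)) // andbC; case: ltnP => //= d.
apply/idP/idP => /covP[_ + h]; rewrite ?(trEn v (a := i)) // in h * => lt; apply/covP.
  rewrite !(trEn v (a := i)) //; split=> // c c1 c2.
  cov_pos h c; rewrite ?trEl ?trEr ?(trEn v (a := i)) //; lia.
split=> // c c1 c2; cov_pos h c; rewrite ?trEl ?trEr ?(trEn v (a := i)) //; lia.
Qed.

(** In this and the three following lemmas, the value at the remaining one of
    the positions [i], [i + 1] is not between those exchanged by the cover, so
    that the presence of a descent at [i] after it implies one before it. *)
Lemma T_tau_ir (b : nat) : (i.+1 < b)%N -> @T A (i) (b) * tau = tau * @T A (i.+1) (b).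
Proof.
move=> lt; have [n1 n2 n3 n4] : [/\ b != i, b != i.+1, i != b & i.+1 != b] by split; apply/eqP; lia.
apply: T_tau_gen => v; first by apply: Sinf_eqP => j; tr_lia.
have [n5 n6] : i != i.+1 /\ i.+1 != i by split; apply/eqP; lia.
have [N1 [N2 N3]] := conj (Sinf_neq v n1) (conj (Sinf_neq v n2) (Sinf_neq v n5)).
have ev := (trEl, trEr, trEn v n1 n2, trEn v n5 n3, trEn v n6 n4, trEn v n3 n5, trEn v n4 n6).
apply/idP/idP => /andP[].
  move=> /covP[_ + h]; rewrite ?ev => l1 l2; apply/andP.
  suff d : (v i.+1 < v i)%N.
    split=> //; apply/covP; rewrite ?ev; split; [lia|lia|move=> c c1 c2].
    by cov_pos h c; rewrite ?ev ?(trEn v (a := i)) //; lia.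
  by have := h i; have := h i.+1; lia.
move=> d /covP[_ + h]; rewrite ?ev => l2; apply/andP.
suff d2 : cov v (i) (b).
  split=> //; rewrite ?ev; have := h i; have := h i.+1; rewrite ?ev; have /covP[_ _ h3] := d2.
  by have := h3 i; have := h3 i.+1; lia.
apply/covP; split; [lia|lia|move=> c c1 c2].
by cov_pos h c; rewrite ?ev ?(trEn v (a := i)) //; lia.
Qed.

Lemma T_tau_i1r (b : nat) : (i.+1 < b)%N -> @T A (i.+1) (b) * tau = tau * @T A (i) (b).
Proof.
move=> lt; have [n1 n2 n3 n4] : [/\ b != i, b != i.+1, i != b & i.+1 != b] by split; apply/eqP; lia.
apply: T_tau_gen => v; first by apply: Sinf_eqP => j; tr_lia.
have [n5 n6] : i != i.+1 /\ i.+1 != i by split; apply/eqP; lia.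
have [N1 [N2 N3]] := conj (Sinf_neq v n1) (conj (Sinf_neq v n2) (Sinf_neq v n5)).
have ev := (trEl, trEr, trEn v n1 n2, trEn v n5 n3, trEn v n6 n4, trEn v n3 n5, trEn v n4 n6).
apply/idP/idP => /andP[].
  move=> /covP[_ + h]; rewrite ?ev => l1 l2; apply/andP.
  suff d : (v i.+1 < v i)%N.
    split=> //; apply/covP; rewrite ?ev; split; [lia|lia|move=> c c1 c2].
    by cov_pos h c; rewrite ?ev ?(trEn v (a := i)) //; lia.
  by have := h i; have := h i.+1; lia.
move=> d /covP[_ + h]; rewrite ?ev => l2; apply/andP.
suff d2 : cov v (i.+1) (b).
  split=> //; rewrite ?ev; have := h i; have := h i.+1; rewrite ?ev; have /covP[_ _ h3] := d2.
  by have := h3 i; have := h3 i.+1; lia.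
apply/covP; split; [lia|lia|move=> c c1 c2].
by cov_pos h c; rewrite ?ev ?(trEn v (a := i)) //; lia.
Qed.

Lemma T_tau_li (a : nat) : (a < i)%N -> @T A (a) (i) * tau = tau * @T A (a) (i.+1).
Proof.
move=> lt; have [n1 n2 n3 n4] : [/\ a != i, a != i.+1, i != a & i.+1 != a] by split; apply/eqP; lia.
apply: T_tau_gen => v; first by apply: Sinf_eqP => j; tr_lia.
have [n5 n6] : i != i.+1 /\ i.+1 != i by split; apply/eqP; lia.
have [N1 [N2 N3]] := conj (Sinf_neq v n1) (conj (Sinf_neq v n2) (Sinf_neq v n5)).
have ev := (trEl, trEr, trEn v n1 n2, trEn v n5 n3, trEn v n6 n4, trEn v n3 n5, trEn v n4 n6).
apply/idP/idP => /andP[].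
  move=> /covP[_ + h]; rewrite ?ev => l1 l2; apply/andP.
  suff d : (v i.+1 < v i)%N.
    split=> //; apply/covP; rewrite ?ev; split; [lia|lia|move=> c c1 c2].
    by cov_pos h c; rewrite ?ev ?(trEn v (a := i)) //; lia.
  by have := h i; have := h i.+1; lia.
move=> d /covP[_ + h]; rewrite ?ev => l2; apply/andP.
suff d2 : cov v (a) (i).
  split=> //; rewrite ?ev; have := h i; have := h i.+1; rewrite ?ev; have /covP[_ _ h3] := d2.
  by have := h3 i; have := h3 i.+1; lia.
apply/covP; split; [lia|lia|move=> c c1 c2].
by cov_pos h c; rewrite ?ev ?(trEn v (a := i)) //; lia.
Qed.

Lemma T_tau_li1 (a : nat) : (a < i)%N -> @T A (a) (i.+1) * tau = tau * @T A (a) (i).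
Proof.
move=> lt; have [n1 n2 n3 n4] : [/\ a != i, a != i.+1, i != a & i.+1 != a] by split; apply/eqP; lia.
apply: T_tau_gen => v; first by apply: Sinf_eqP => j; tr_lia.
have [n5 n6] : i != i.+1 /\ i.+1 != i by split; apply/eqP; lia.
have [N1 [N2 N3]] := conj (Sinf_neq v n1) (conj (Sinf_neq v n2) (Sinf_neq v n5)).
have ev := (trEl, trEr, trEn v n1 n2, trEn v n5 n3, trEn v n6 n4, trEn v n3 n5, trEn v n4 n6).
apply/idP/idP => /andP[].
  move=> /covP[_ + h]; rewrite ?ev => l1 l2; apply/andP.
  suff d : (v i.+1 < v i)%N.
    split=> //; apply/covP; rewrite ?ev; split; [lia|lia|move=> c c1 c2].
    by cov_pos h c; rewrite ?ev ?(trEn v (a := i)) //; lia.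
  by have := h i; have := h i.+1; lia.
move=> d /covP[_ + h]; rewrite ?ev => l2; apply/andP.
suff d2 : cov v (a) (i.+1).
  split=> //; rewrite ?ev; have := h i; have := h i.+1; rewrite ?ev; have /covP[_ _ h3] := d2.
  by have := h3 i; have := h3 i.+1; lia.
apply/covP; split; [lia|lia|move=> c c1 c2].
by cov_pos h c; rewrite ?ev ?(trEn v (a := i)) //; lia.
Qed.
End Descents.

(** * Descents and the Monk operators *)

Lemma cols_cat j m N : (j <= m <= N)%N -> cols j N = cols m N ++ cols j m.
Proof.
move=> /andP[jm mN]; rewrite /cols -rev_cat; congr rev.
have -> : (N - j = (m - j) + (N - m))%N by lia.
by rewrite iotaD; congr (_ ++ iota _ _); lia.
Qed.

Section PsiY.
Variables (R : comPzRingType) (i N : nat).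
Hypothesis iN : (i.+1 < N)%N.
Local Notation T := (@T R).
Local Notation tau := (tau R i).
Local Notation Psi := (Psi R i).
Local Notation Ti := (T i i.+1).
Local Notation Pi := (Pi R).
Local Notation Bs := (Bs R).
Local Notation Y j := (Yop R j N).

Definition twist (x y : op R) : Prop := x * tau = tau * y.

Lemma twist1 : twist 1 1. Proof. by rewrite /twist mul1r mulr1. Qed.
Lemma twistM x y x' y' : twist x y -> twist x' y' -> twist (x * x') (y * y').
Proof. by rewrite /twist => h h'; rewrite -mulrA h' !mulrA h. Qed.
Lemma twistD x y x' y' : twist x y -> twist x' y' -> twist (x + x') (y + y').
Proof. by rewrite /twist => h h'; rewrite mulrDl mulrDr h h'. Qed.
Lemma twistN x y : twist x y -> twist (- x) (- y).
Proof. by rewrite /twist => h; rewrite mulNr mulrN h. Qed.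

Lemma twist_Pi k b b' : (forall a, (a < k)%N -> twist (T a b) (T a b')) ->
  twist (Pi k b) (Pi k b').
Proof.
elim: k => [_|k IHk h] /=; first exact: twist1.
apply: twistM; last by apply: IHk => a ak; apply: h; apply: ltnW.
by apply: twistD; [exact: twist1|apply: h].
Qed.

Lemma twist_Bs m m' s : (forall b, b \in s -> twist (T m b) (T m' b)) ->
  twist (Bs m s) (Bs m' s).
Proof.
rewrite /Bs; elim: s => [_|b s IHs h]; first by rewrite !big_nil; apply: twist1.
rewrite !big_cons; apply: twistM.
  by apply: twistD; [exact: twist1|apply/twistN/h; rewrite mem_head].
by apply: IHs => c cs; apply: h; rewrite inE cs orbT.
Qed.

Let Z1 := Pi i i * Bs i (cols i.+2 N).
Let Z2 := Pi i i.+1 * Bs i.+1 (cols i.+2 N).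

Let twist12 : twist Z1 Z2.
Proof.
apply: twistM; first by apply: twist_Pi => a ai; apply: T_tau_li.
by apply: twist_Bs => b; rewrite mem_cols => /andP[ib _]; apply: T_tau_ir.
Qed.

Let twist21 : twist Z2 Z1.
Proof.
apply: twistM; first by apply: twist_Pi => a ai; apply: T_tau_li1.
by apply: twist_Bs => b; rewrite mem_cols => /andP[ib _]; apply: T_tau_i1r.
Qed.

Let Yi : Y i = Z1 * (1 - Ti).
Proof. by rewrite /Yop cols_rcons // /Bs -cats1 big_cat big_seq1 mulrA. Qed.

Let Yi1 : Y i.+1 = (1 + Ti) * Z2.
Proof. by rewrite /Yop /= -mulrA. Qed.

(** The relations of [Psi] with [Yop] in this section have the form of those
    of an isobaric operator with [1 - x j]. All come from [T_tau_adj] and, for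
    [j] away from [i], from the Yang-Baxter equation. *)
Lemma Psi_Yi : Psi * Y i = Y i.+1 * Psi - Y i.+1.
Proof.
transitivity (Y i.+1 * (tau * (1 - Ti))).
  rewrite Yi Yi1 Psi_tau -[RHS]mulrA (mulrA Z2) twist21 -!mulrA; congr (_ * _).
transitivity (Y i.+1 * (Psi - 1)); last by rewrite mulrBr mulr1.
congr (_ * _); rewrite Psi_tau -[X in _ = _ - X](T_tau_adj R i).
by move: tau Ti => x y; ncr.
Qed.

Lemma Psi_Yi1 : Psi * Y i.+1 = Y i * Psi + Y i.+1.
Proof.
have sq : Ti * Ti = 0 := T_sq R i i.+1.
rewrite Psi_tau Yi Yi1.
have -> : Z1 * (1 - Ti) * ((1 + Ti) * tau) = tau * Z2.
  have e : (1 - Ti) * (1 + Ti) = 1 by rewrite -[RHS]subr0 -sq; move: Ti => y; ncr.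
  by rewrite -twist12 -(mulrA Z1) (mulrA (1 - Ti)) e mul1r.
rewrite mulrA -mulrDl; congr (_ * _).
have -> : (1 + Ti) * tau * (1 + Ti) = tau + Ti * tau + tau * Ti + Ti * (tau * Ti).
  by move: tau Ti => x y; ncr.
have -> : tau * Ti = 1 - Ti * tau by rewrite -(T_tau_adj R i) addrC addKr.
rewrite mulrBr mulr1 mulrA sq mul0r subr0.
by move: (Ti * tau) Ti tau => z x y; ncr.
Qed.

Lemma Psi_T (a b : nat) : (a < b)%N -> a != i -> a != i.+1 -> b != i -> b != i.+1 ->
  GRing.comm Psi (T a b).
Proof.
move=> ab ai ai1 bi bi1; rewrite /GRing.comm Psi_tau -mulrA -T_tau0 // !mulrA; congr (_ * _).
by rewrite mulrDl mulrDr mul1r mulr1 (@T_comm R i i.+1 a b) // eq_sym.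
Qed.

Lemma comm_1T (x : op R) a b : GRing.comm x (T a b) -> GRing.comm x (1 + T a b).
Proof. by move=> h; apply: commrD => //; apply: commr1. Qed.

Let commPi k b : (k <= i)%N -> (i.+1 < b)%N -> GRing.comm Psi (Pi k b).
Proof.
elim: k => [|k IHk] ki ib /=; first exact: commr1.
apply: commrM; last by apply: IHk => //; apply: ltnW.
by apply/comm_1T/Psi_T; try (apply/eqP); lia.
Qed.

Let commPi2 k b : (i.+2 <= k)%N -> (k <= b)%N -> GRing.comm Psi (Pi k b).
Proof.
elim: k => [//|k IHk]; rewrite ltnS leq_eqVlt => /predU1P[<- ib /=|ik kb /=].
  rewrite mulrA; apply: commrM; last exact: commPi.
  rewrite /GRing.comm Psi_tau.
  have -> : (1 + Ti) * tau * ((1 + T i.+1 b) * (1 + T i b))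
     = (1 + Ti) * (1 + T i b) * (1 + T i.+1 b) * tau.
    rewrite -!mulrA; congr (_ * _); rewrite !mulrA; symmetry; rewrite -[RHS]mulrA.
    apply: twistM; apply: twistD; try exact: twist1; first exact: T_tau_ir.
    exact: T_tau_i1r.
  by rewrite -(@T_braid R i i.+1 b) ?mulrA.
apply: commrM; last by apply: IHk => //; apply: ltnW.
by apply/comm_1T/Psi_T; try (apply/eqP); lia.
Qed.

Lemma Psi_Yj j : (j < N)%N -> j != i -> j != i.+1 -> Psi * Y j = Y j * Psi.
Proof.
move=> jN ji ji1; apply: commrM.
  have [h|h] := leqP j i.
    by apply: comm_Pi => a aj; apply: Psi_T; try (apply/eqP); lia.
  by apply: commPi2 => //; lia.
have cB s : (forall b, b \in s -> (j < b)%N /\ (b != i) && (b != i.+1)) ->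
    GRing.comm Psi (Bs j s).
  move=> h; apply: comm_Bs => b /h [jb /andP[bi bi1]].
  by apply: Psi_T; rewrite // eq_sym.
have [h|h] := ltnP i j.
  by apply: cB => b; rewrite mem_cols; split; try (apply/andP; split; apply/eqP); lia.
have -> : cols j.+1 N = cols i.+2 N ++ [:: i.+1; i] ++ cols j.+1 i.
  rewrite (cols_cat (m := i.+2)); last by lia.
  congr (_ ++ _); rewrite (cols_cat (m := i)) ; last by lia.
  congr (_ ++ _); rewrite /cols; have -> : (i.+2 - i = 2)%N by lia.
  by [].
rewrite /Bs !big_cat /=; apply: commrM.
  by apply: cB => b; rewrite mem_cols; split; try (apply/andP; split; apply/eqP); lia.
apply: commrM; last first.
  by apply: cB => b; rewrite mem_cols; split; try (apply/andP; split; apply/eqP); lia.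
rewrite big_cons big_seq1 /GRing.comm Psi_tau.
have ji' : (j < i)%N by rewrite ltn_neqAle ji.
have -> : (1 + Ti) * tau * ((1 - T j i.+1) * (1 - T j i))
     = (1 + Ti) * ((1 - T j i) * (1 - T j i.+1)) * tau.
  rewrite -!mulrA; congr (_ * _); rewrite !mulrA; symmetry; rewrite -[RHS]mulrA.
  apply: twistM; apply: twistD; try exact: twist1; apply: twistN; first exact: T_tau_li.
  exact: T_tau_li1.
rewrite mulrA; congr (_ * _).
have br : (1 + Ti) * (1 + T j i.+1) * (1 + T j i) = (1 + T j i) * (1 + T j i.+1) * (1 + Ti).
  exact: T_braid.
have V b : (1 + T j b) * (1 - T j b) = 1 /\ (1 - T j b) * (1 + T j b) = 1.
  have := T_sq R j b; move: (T j b) => x sq; split.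
    have -> : (1 + x) * (1 - x) = 1 - x * x by ncr.
    by rewrite sq subr0.
  have -> : (1 - x) * (1 + x) = 1 - x * x by ncr.
  by rewrite sq subr0.
have [V1 V2] := V i; have [V3 V4] := V i.+1.
transitivity ((1 - T j i.+1) * ((1 - T j i) * ((1 + T j i) * (1 + T j i.+1) * (1 + Ti)))
   * ((1 - T j i) * (1 - T j i.+1))).
  by rewrite !mulrA -[_ * (1 - T j i) * (1 + T j i)]mulrA V2 mulr1 V4 mul1r.
rewrite -br -!mulrA; congr (_ * (_ * _)).
by rewrite (mulrA (1 + T j i)) V1 mul1r V3 mulr1.
Qed.
End PsiY.

(** * Dominant permutations *)

Lemma w0E n i : w0S n i = w0fun n i.
Proof. exact: mkSE. Qed.

Lemma bound_w0 n : (boundS (w0S n) <= n)%N.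
Proof. by apply: bound_le => i ni; rewrite w0E w0fun_id. Qed.

Lemma decreasing_w0 n (v : Sinf) : (boundS v <= n)%N ->
  (forall i, (i.+1 < n)%N -> (v i.+1 < v i)%N) -> v = w0S n.
Proof.
move=> vn dec; apply: Sinf_eqP => i; rewrite w0E /w0fun.
have [lt_in|] := ltnP i n; last first.
  by move=> ni; apply: bound_id; apply: leq_trans ni.
have up j : (j < n)%N -> (v j <= n - j.+1)%N.
  elim: j => [|j IHj] jn; first by have := lt_bound vn jn; lia.
  by have := dec j jn; have := IHj (ltnW jn); lia.
have lo j : (j < n)%N -> (n - j.+1 <= v j)%N.
  move=> jn; have -> : j = (n - (n - j.+1).+1)%N by lia.
  have : (n - j.+1 < n)%N by lia.
  elim: (n - j.+1)%N => [|d IHd] dn; first by lia.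
  have := dec (n - d.+2)%N; have -> : (n - d.+2).+1 = (n - d.+1)%N by lia.
  by have := IHd (ltnW dn); lia.
by apply/eqP; rewrite eqn_leq up ?lo.
Qed.

Lemma len_le n (v : Sinf) : (boundS v <= n)%N -> (len v <= n * n)%N.
Proof.
move=> /lenE ->; rewrite /inv2 -[X in (_ <= X * _)%N]card_ord -sum_nat_const.
apply: leq_sum => j _; rewrite -[X in (_ <= X)%N]card_ord -sum1_card.
by apply: leq_sum => l _; apply: leq_b1.
Qed.

Lemma len_asc (v : Sinf) i : (v i < v i.+1)%N -> len (tr v i i.+1) = (len v).+1.
Proof.
move=> asc; have := (@descentP (tr v i i.+1) i).2.
by rewrite trK trEl trEr => /(_ asc) ->.
Qed.

(** Downward induction from the longest permutation: as long as there is an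
    ascent, exchanging it increases the length. *)
Lemma down_ind n (P : Sinf -> Prop) : P (w0S n) ->
  (forall w i, (boundS w <= n)%N -> (i.+1 < n)%N -> (w i.+1 < w i)%N -> P w ->
     P (tr w i i.+1)) ->
  forall v : Sinf, (boundS v <= n)%N -> P v.
Proof.
move=> P0 PS v vn; have [d] := ubnP (n * n - len v); elim: d v vn => // d IHd v vn lt.
case: (boolP [exists i : 'I_n, (i.+1 < n)%N && (v i < v i.+1)%N]) => [/existsP[i /andP[lt_in asc]]|].
  rewrite -(trK v i i.+1).
  have wn : (boundS (tr v i i.+1) <= n)%N by apply: tr_bound => //; apply: ltnW.
  apply: PS => //; first by rewrite trEl trEr.
  apply: IHd => //.
  by have := len_le wn; rewrite (len_asc asc); rewrite /= in lt *; lia.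
rewrite negb_exists => /forallP h; suff -> : v = w0S n by [].
apply: decreasing_w0 => // i lt_in; have := h (Ordinal (ltnW lt_in)).
rewrite /= lt_in /= -leqNgt leq_eqVlt => /orP[/eqP /(@Sinf_inj v)|//].
by move/eqP; rewrite eqn_leq ltnn.
Qed.

Section Dominant.
Variables (R : comPzRingType) (x : nat -> R) (s iso : nat -> R -> R).
Hypothesis X : isosys x s iso.

Definition mono (n : nat) (c : nat -> nat) : R := \prod_(0 <= j < n) x j ^+ c j.

Lemma eq_mono n c c' : (forall j, (j < n)%N -> c j = c' j) -> mono n c = mono n c'.
Proof. by move=> h; apply: eq_big_nat => j /andP[_ jn]; rewrite h. Qed.

Lemma mono_step n i c c' : (i.+1 < n)%N -> c i = (c i.+1).+1 -> c' i = c i.+1 ->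
  (forall j, (j < n)%N -> j != i -> c' j = c j) -> iso i (mono n c) = mono n c'.
Proof.
move=> lt_in e e' h.
pose a : 'I_n := Ordinal (ltnW lt_in); pose b : 'I_n := Ordinal lt_in.
have ba : b != a by rewrite -val_eqE /= gtn_eqF.
pose r := \prod_(j < n | (j != a) && (j != b)) x j ^+ c j.
have spl d : (forall j, (j < n)%N -> j != i -> d j = c j) ->
    mono n d = x i ^+ d i * x i.+1 ^+ c i.+1 * r.
  move=> hd; rewrite /mono big_mkord (bigD1 a) //= (bigD1 b) //= mulrA.
  rewrite (hd i.+1) ?gtn_eqF //; congr (_ * _); apply: eq_bigr => j /andP[ja _].
  by rewrite hd.
rewrite (spl c) // (spl c') // e e'; apply: (iso_monomial X).
apply: (big_ind (fun z => s i z = z)) => [|f g hf hg|j /andP[ja jb]].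
- exact: (iso_s1 X).
- by rewrite (iso_sM X) hf hg.
by rewrite (sXXn X) (iso_sx X) /trfun -[_ == i]/(j == a) -[_ == i.+1]/(j == b) (negbTE ja) (negbTE jb).
Qed.

Variables (n : nat) (G : Sinf -> R).
Hypothesis G0 : G (w0S n.+1) = mono n.+1 (fun j => n.+1 - j.+1)%N.
Hypothesis GS : forall (w : Sinf) i, (boundS w <= n.+1)%N -> (i.+1 < n.+1)%N ->
  (w i.+1 < w i)%N -> G (tr w i i.+1) = iso i (G w).

(* From the longest permutation of n + 1 letters, the first value is moved
   to the right until position j. *)
Let f1 j i : nat := if (i < j)%N then (n - i.+1)%N else if i == j then n
  else if (i <= n)%N then (n - i)%N else i.
Let e1 j i : nat := if (i < j)%N then (n - i.+1)%N else (n - i)%N.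

Let path1 j : (j <= n)%N -> forall u : Sinf, u =1 f1 j -> G u = mono n.+1 (e1 j).
Proof.
elim: j => [|j IHj] jn u uE.
  have -> : u = w0S n.+1.
    apply: Sinf_eqP => i; rewrite uE w0E /f1 /w0fun ltn0 ltnS.
    by case: eqVneq => [->|_]; rewrite ?subSS ?subn0.
  by rewrite G0; apply: eq_mono => i _; rewrite /e1 ltn0 subSS.
have vE : tr u j j.+1 =1 f1 j.
  move=> i; rewrite trE uE /f1 /trfun; repeat case: ifP; lia.
have vn : (boundS (tr u j j.+1) <= n.+1)%N.
  by apply: bound_le => i ni; rewrite vE /f1; repeat case: ifP; lia.
rewrite -(trK u j j.+1) GS //; last by rewrite !vE /f1; repeat case: ifP; lia.
rewrite (IHj (ltnW jn) _ vE); apply: mono_step => //.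
- by rewrite /e1; repeat case: ifP; lia.
- by rewrite /e1; repeat case: ifP; lia.
- by move=> i _ ij; rewrite /e1; repeat case: ifP; lia.
Qed.

(** The polynomials do not depend on the number of letters. *)
Lemma w0_stable : G (w0S n) = mono n (fun j => n - j.+1)%N.
Proof.
rewrite (path1 (leqnn n)); last first.
  by move=> i; rewrite w0E /w0fun /f1; repeat case: ifP; lia.
rewrite /mono big_nat_recr //= {2}/e1 ltnn subnn expr0 mulr1.
by apply: eq_mono => j jn; rewrite /e1 jn.
Qed.

Variable m : nat.
Hypothesis mn : (m < n)%N.

(* Then the value to its right is moved to position l. *)
Let f2 l i : nat := if i == m then n else if i == l then (n - m.+1)%N
  else if (i < l)%N then (n - i.+1)%N else if (i <= n)%N then (n - i)%N else i.
Let e2 l i : nat := if i == m then (n - m)%N else if (i < l)%N then (n - i.+1)%N else (n - i)%N.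

Let path2 l : (m < l)%N -> (l <= n)%N -> forall u : Sinf, u =1 f2 l -> G u = mono n.+1 (e2 l).
Proof.
elim: l => [//|l IHl]; rewrite ltnS leq_eqVlt => /predU1P[<- _ u uE|ml ln u uE].
  rewrite (path1 (ltnW mn)).
    by apply: eq_mono => i _; rewrite /e1 /e2; repeat case: ifP; lia.
  by move=> i; rewrite uE /f1 /f2; repeat case: ifP; lia.
have vE : tr u l l.+1 =1 f2 l.
  move=> i; rewrite trE uE /f2 /trfun; repeat case: ifP; lia.
have vn : (boundS (tr u l l.+1) <= n.+1)%N.
  by apply: bound_le => i ni; rewrite vE /f2; repeat case: ifP; lia.
rewrite -(trK u l l.+1) GS //; last by rewrite !vE /f2; repeat case: ifP; lia.
rewrite (IHl ml (ltnW ln) _ vE); apply: mono_step => //.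
- by rewrite /e2; repeat case: ifP; lia.
- by rewrite /e2; repeat case: ifP; lia.
- by move=> i _ il; rewrite /e2; repeat case: ifP; lia.
Qed.

(** Both sides come from dominant permutations, whose polynomials are
    monomials; so do all intermediate steps from the longest permutation of [n
    + 1] letters. *)
Lemma G_w0_tr : G (tr (w0S n) m n) = x m * G (w0S n).
Proof.
rewrite (path2 mn (leqnn n)); last first.
  by move=> i; rewrite trE w0E /w0fun /trfun /f2; repeat case: ifP; lia.
rewrite w0_stable /mono big_nat_recr //= {2}/e2 gtn_eqF // ltnn subnn expr0 mulr1.
rewrite (bigD1_seq m) ?iota_uniq ?mem_index_iota //= [in RHS](bigD1_seq m) ?iota_uniq ?mem_index_iota //=.
rewrite mulrA; congr (_ * _).
  by rewrite /e2 eqxx -exprS; congr (_ ^+ _); lia.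
rewrite big_nat_cond [RHS]big_nat_cond; apply: eq_bigr => j /andP[/andP[_ jn] jm].
by rewrite /e2 (negbTE jm) jn.
Qed.
End Dominant.

(** * Multiplication by 1 - x m *)

Section Monk.
Variables (R : comPzRingType) (x : nat -> R) (s iso : nat -> R -> R).
Hypothesis X : isosys x s iso.
Variable G : Sinf -> R.
Hypothesis G0 : forall n, G (w0S n) = mono x n (fun j => n - j.+1)%N.
Hypothesis GS : forall (w : Sinf) i, (w i.+1 < w i)%N -> G (tr w i i.+1) = iso i (G w).

Lemma Psi_G i v : Psi R i G v = iso i (G v).
Proof.
rewrite PsiE; case: ifP => [/GS //|]; rewrite adj_neq => /negbFE asc.
rewrite -{1 2}(trK v i i.+1) GS; first by rewrite (iso_idem X).
by rewrite trEl trEr.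
Qed.

Lemma Psi_at i (F : Sinf -> R) (w : Sinf) : (w i.+1 < w i)%N -> Psi R i F w = F (tr w i i.+1).
Proof. by rewrite PsiE => ->. Qed.

Lemma Psi_nat (Q : op R) i v : (Q * Psi R i) G v = iso i (Q G v).
Proof.
rewrite opME (op_eq Q v (G := fun u => iso i (G u))); last by move=> u; apply: Psi_G.
by rewrite op_natP //; apply: (isoD X).
Qed.

Lemma Bs_stuck (m : nat) (r : seq nat) (F : Sinf -> R) (u : Sinf) :
  (forall b, b \in r -> cov u m b = false) -> Bs R m r F u = F u.
Proof.
rewrite /Bs; elim: r => [_|b r IHr h]; first by rewrite big_nil.
rewrite big_cons opME opBE op1E TE h ?mem_head // subr0; apply: IHr => c cr.
by apply: h; rewrite inE cr orbT.
Qed.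

Lemma cov_w0 n a b : (b < n)%N -> cov (w0S n) a b = false.
Proof.
move=> bn; apply/negP => /covP[ab]; rewrite !w0E /w0fun bn (ltn_trans ab bn); lia.
Qed.

(** At the longest permutation of [n] letters only the cover [(m, n)]
    contributes, and it leads to another dominant permutation. *)
Lemma monk_w0 n m : (m < n)%N -> Yop R m n.+1 G (w0S n) = (1 - x m) * G (w0S n).
Proof.
move=> mn; rewrite /Yop opME.
have PiE k F : Pi R k m F (w0S n) = F (w0S n).
  by elim: k => [//|k IHk]; rewrite [Pi _ _ _]/= opME opDE op1E TE cov_w0 // addr0.
rewrite PiE; have -> : cols m.+1 n.+1 = n :: cols m.+1 n.
  rewrite /cols; have -> : (n.+1 - m.+1 = (n - m.+1) + 1)%N by lia.
  by rewrite iotaD rev_cat /=; congr (_ :: _); lia.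
have vm : w0S n m = (n - m.+1)%N by rewrite w0E /w0fun mn.
have vn : w0S n n = n by rewrite w0E /w0fun ltnn.
rewrite /Bs big_cons opME opBE op1E TE -/(Bs R m _).
have -> : cov (w0S n) m n.
  apply/covP; rewrite vm vn; split=> //; first lia.
  by move=> c mc cn; rewrite w0E /w0fun cn; lia.
rewrite !Bs_stuck; first by rewrite (G_w0_tr X) ?G0 //; [ring|move=> w i _ _; apply: GS].
  move=> b; rewrite mem_cols => /andP[mb bn]; apply/negP => /covP[_ + _].
  rewrite trEl vn trEn; [|by rewrite gtn_eqF|by rewrite ltn_eqF].
  by rewrite w0E /w0fun bn; lia.
by move=> b; rewrite mem_cols => /andP[_ bn]; apply: cov_w0.
Qed.

(** A Monk formula for Grothendieck polynomials. In the downward induction, the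
    relations of [Yop] with [Psi] reproduce those of [1 - x m] with the isobaric
    operators. *)
Lemma monk n (v : Sinf) m : (boundS v <= n)%N -> (m < n)%N ->
  Yop R m n.+1 G v = (1 - x m) * G v.
Proof.
move=> vn; move: v vn m; apply: down_ind; first exact: monk_w0.
move=> w i wn lt_in d Pw m mn.
have iN : (i.+1 < n.+1)%N by apply: ltnW.
rewrite -(Psi_at (Yop R m n.+1 G) d) (GS d) -opME.
have [->|mi] := eqVneq m i.
  rewrite Psi_Yi // opBE Psi_nat !Pw // (iso_y' X).
  by rewrite addrK.
have [->|mi1] := eqVneq m i.+1.
  rewrite Psi_Yi1 // opDE Psi_nat !Pw ?(ltnW lt_in) //.
  by rewrite (iso_y X) subrK.
have mn1 : (m < n.+1)%N by apply: ltnW.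
rewrite Psi_Yj //.
by rewrite Psi_nat Pw // (isoZ X) // (sXyn X).
Qed.
End Monk.

Section Locality.
Variable A : zmodType.

(** Locality makes identities that hold for permutations of a bounded number of
    letters available inside products of operators. *)
Definition loc (b b' : nat) (Q : op A) : Prop :=
  forall F F' : Sinf -> A, (forall w : Sinf, (boundS w <= b')%N -> F w = F' w) ->
  forall v : Sinf, (boundS v <= b)%N -> Q F v = Q F' v.

Lemma loc1 b b' : (b <= b')%N -> loc b b' 1.
Proof. by move=> bb F F' h v vb; apply: h; apply: leq_trans vb bb. Qed.

Lemma locM b b' b'' Q Q' : loc b b' Q -> loc b' b'' Q' -> loc b b'' (Q * Q').
Proof. by move=> h h' F F' e v vb; rewrite !opME; apply: h => // w wb; apply: h'. Qed.

Lemma locD b b' Q Q' : loc b b' Q -> loc b b' Q' -> loc b b' (Q + Q').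
Proof. by move=> h h' F F' e v vb; rewrite !opDE (h F F') // (h' F F'). Qed.

Lemma locN b b' Q : loc b b' Q -> loc b b' (- Q).
Proof. by move=> h F F' e v vb; rewrite !opNE (h F F'). Qed.

Lemma loc_T (b c d : nat) : (d < b)%N -> loc b b (@T A c d).
Proof.
move=> db F F' h v vb; rewrite !TE; case: ifP => // cv; apply: h.
by apply: tr_bound => //; have /covP[cd _ _] := cv; apply: ltn_trans db.
Qed.

Lemma loc_T1 (b c : nat) : (c < b)%N -> loc b b.+1 (@T A c b).
Proof.
move=> cb F F' h v vb; rewrite !TE; case: ifP => // _; apply: h.
by apply: tr_bound => //; [apply: leq_trans vb _|apply: ltnW].
Qed.

Lemma cov_big (v : Sinf) b c d : (boundS v <= b)%N -> (c < b)%N -> (b < d)%N -> cov v c d = false.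
Proof.
move=> vb cb bd; apply/negP => /covP[_ _ /(_ b cb bd)].
have := lt_bound vb cb; rewrite (bound_id vb) (bound_id (leq_trans vb (ltnW bd))).
lia.
Qed.

Lemma loc_T0 (b c d : nat) : (c < b)%N -> (b < d)%N -> loc b b (@T A c d).
Proof. by move=> cb bd F F' h v vb; rewrite !TE (cov_big vb cb bd). Qed.

Lemma loc_Pi b k m : (m < b)%N -> loc b b (Pi A k m).
Proof.
move=> mb; elim: k => [|k IHk] /=; first exact: loc1.
by apply: locM IHk; apply: locD; [apply: loc1|apply: loc_T].
Qed.

Lemma loc_Bs b m (r : seq nat) : (forall c, c \in r -> loc b b (@T A m c)) -> loc b b (Bs A m r).
Proof.
rewrite /Bs; elim: r => [_|c r IHr h]; first by rewrite big_nil; apply: loc1.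
rewrite big_cons; apply: (@locM _ b).
  by apply: locD; [apply: loc1|apply/locN/h; rewrite mem_head].
by apply: IHr => d dr; apply: h; rewrite inE dr orbT.
Qed.
End Locality.

(** Of the columns at or beyond [b], only [b] itself has covers, and once it
    has been used the columns before it remain. *)
Lemma loc_Yop (R : comPzRingType) b m N : (m < b)%N -> (b < N)%N -> loc b b.+1 (Yop R m N).
Proof.
move=> mb bN; apply: (@locM _ _ b); first exact: loc_Pi.
have -> : cols m.+1 N = cols b.+1 N ++ b :: cols m.+1 b.
  rewrite (cols_cat (m := b.+1)); last by lia.
  congr (_ ++ _); rewrite /cols; have -> : (b.+1 - m.+1 = (b - m.+1) + 1)%N by lia.
  by rewrite iotaD rev_cat /=; congr (_ :: _); lia.
rewrite /Bs big_cat big_cons /=; apply: (@locM _ _ b).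
  by apply: loc_Bs => c; rewrite mem_cols => /andP[bc _]; apply: loc_T0.
apply: (@locM _ _ b.+1).
  by apply: locD; [apply: loc1|apply/locN/loc_T1].
by apply: loc_Bs => c; rewrite mem_cols => /andP[_ cb]; apply: loc_T; apply: ltnW.
Qed.

Section Naturality.
Variable R : comNzRingType.

Definition lift_op (Q : op R) (Q' : op {poly R}) : Prop :=
  forall F v, Q' (fun w => (F w)%:P) v = (Q F v)%:P.

Lemma lift1 : lift_op 1 1. Proof. by []. Qed.
Lemma liftM P P' Q Q' : lift_op P P' -> lift_op Q Q' -> lift_op (P * Q) (P' * Q').
Proof. by move=> h h' F v; rewrite !opME -h; apply: op_eq => w; apply: h'. Qed.
Lemma liftD P P' Q Q' : lift_op P P' -> lift_op Q Q' -> lift_op (P + Q) (P' + Q').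
Proof. by move=> h h' F v; rewrite !opDE h h' polyCD. Qed.
Lemma liftN P P' : lift_op P P' -> lift_op (- P) (- P').
Proof. by move=> h F v; rewrite !opNE h polyCN. Qed.
Lemma liftT a b : lift_op (@T R a b) (@T {poly R} a b).
Proof. by move=> F v; rewrite !TE; case: ifP => // _; rewrite polyC0. Qed.

Lemma lift_Yop m N : lift_op (Yop R m N) (Yop {poly R} m N).
Proof.
apply: liftM.
  elim: {1 3}m => [|k IHk] /=; first exact: lift1.
  by apply: liftM IHk; apply: liftD; [apply: lift1|apply: liftT].
rewrite /Bs; elim: (cols _ _) => [|c r IHr]; first by rewrite !big_nil; apply: lift1.
rewrite !big_cons; apply: liftM IHr; apply: liftD; first exact: lift1.
exact/liftN/liftT.
Qed.
End Naturality.

Section ZProduct.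
Variables (R : comNzRingType) (x : nat -> R) (s iso : nat -> R -> R).
Hypothesis X : isosys x s iso.
Variable G : Sinf -> R.
Hypothesis G0 : forall n, G (w0S n) = mono x n (fun j => n - j.+1)%N.
Hypothesis GS : forall (w : Sinf) i, (w i.+1 < w i)%N -> G (tr w i i.+1) = iso i (G w).

Definition Eprod (k : nat) : {poly R} := \prod_(i < k) ('X + (1 - 'X) * (1 - x i)%:P).

(** Each step of the recursion on [k] may extend the support by one letter,
    whence the bound on [b + k]. *)
Lemma Z_eq k n b (v : Sinf) : (k <= b)%N -> (b + k <= n)%N -> (boundS v <= b)%N ->
  Z 'X k n.+1 (fun w => (G w)%:P) v = Eprod k * (G v)%:P.
Proof.
elim: k b v => [|k IHk] b v kb bn vb; first by rewrite Z0 /Eprod big_ord0 mul1r.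
rewrite Z_rec; last by lia.
rewrite (IHk b) //; [|lia|lia].
have := @loc_Yop {poly R} b k n.+1 kb; have -> : (b < n.+1)%N by lia.
move=> /(_ isT) /(_ (Z 'X k n.+1 (fun w => (G w)%:P)) (fun w => Eprod k * (G w)%:P)) -> //; last first.
  by move=> w wb; apply: (IHk b.+1) => //; lia.
rewrite (@op_natP _ _ ( *%R (Eprod k))); last by move=> a c; rewrite mulrDr.
rewrite lift_Yop (monk X G0 GS); [|lia|lia].
rewrite /Eprod big_ord_recr /= polyCM; set P := \prod_(i < k) _.
move: (1 - x k)%:P => y; ring.
Qed.
End ZProduct.

(** * Existence of the Grothendieck polynomials *)

Section Existence.
Variables (R : comPzRingType) (x : nat -> R) (s iso : nat -> R -> R).
Hypothesis X : isosys x s iso.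

Section Level.
Variable n : nat.

Definition ascent (v : Sinf) : option 'I_n := [pick i : 'I_n | (i.+1 < n)%N && (v i < v i.+1)%N].

(** The polynomial of [v], computed along some chain of [d] descents from the
    longest permutation of [n] letters. *)
Fixpoint Gfuel (d : nat) (v : Sinf) : R :=
  if d is d'.+1 then
    if ascent v is Some i then iso i (Gfuel d' (tr v i i.+1))
    else mono x n (fun j => n - j.+1)%N
  else mono x n (fun j => n - j.+1)%N.

Definition Gn (v : Sinf) : R := Gfuel (n * n - len v) v.

Lemma Gn_asc (v : Sinf) (i : 'I_n) : (boundS v <= n)%N -> ascent v = Some i ->
  [/\ (i.+1 < n)%N, (v i < v i.+1)%N & Gn v = iso i (Gn (tr v i i.+1))].
Proof.
move=> vn e; have := e; rewrite /ascent; case: pickP => // j /andP[jn asc] [ej]; subst j.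
split=> //; have wn : (boundS (tr v i i.+1) <= n)%N by apply: tr_bound => //; apply: ltnW.
have := len_le wn; rewrite /Gn (len_asc asc) => h.
have -> : (n * n - len v = (n * n - (len v).+1).+1)%N by lia.
rewrite /= e; reflexivity.
Qed.

Lemma Gn_w0 : Gn (w0S n) = mono x n (fun j => n - j.+1)%N.
Proof.
rewrite /Gn; case: (_ - _)%N => //= d; rewrite /ascent; case: pickP => // i /andP[lt_in].
rewrite !w0E /w0fun lt_in ltn_ord; lia.
Qed.

(** The polynomial does not depend on the chain, by the commutation and braid
    relations of the isobaric operators. *)
Lemma Gn_step_asc (v : Sinf) i : (boundS v <= n)%N -> (i.+1 < n)%N -> (v i < v i.+1)%N ->
  Gn v = iso i (Gn (tr v i i.+1)).
Proof.
have [d] := ubnP (n * n - len v); elim: d v i => // d IHd v i lt vn lt_in asc.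
have bd (w : Sinf) j : (boundS w <= n)%N -> (j.+1 < n)%N -> (boundS (tr w j j.+1) <= n)%N.
  by move=> wn jn; apply: tr_bound => //; apply: ltnW.
have IH (w : Sinf) j : (len v < len w)%N -> (boundS w <= n)%N -> (j.+1 < n)%N -> (w j < w j.+1)%N ->
    Gn w = iso j (Gn (tr w j j.+1)).
  by move=> lw wn; apply: IHd => //; have := len_le wn; lia.
case e: (ascent v) => [j|]; last first.
  move: e; rewrite /ascent; case: pickP => // /(_ (Ordinal (ltnW lt_in))) /=.
  by rewrite lt_in asc.
have [jn ascj ->] := Gn_asc vn e.
have [-> //|ij] := eqVneq i j.
have far (a b : nat) : (a.+1 < b)%N -> (b.+1 < n)%N -> (v a < v a.+1)%N -> (v b < v b.+1)%N ->
    iso a (Gn (tr v a a.+1)) = iso b (Gn (tr v b b.+1)).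
  move=> ab bn aa ab'.
  have an : (a.+1 < n)%N by lia.
  have la := len_asc aa; have lb := len_asc ab'.
  rewrite (IH (tr v a a.+1) b) ?bd ?la //; last by rewrite !trEn //; apply/eqP; lia.
  rewrite (IH (tr v b b.+1) a) ?bd ?lb //; last by rewrite !trEn //; apply/eqP; lia.
  by rewrite (iso_comm X) // tr_comm //; apply/eqP; lia.
have near_ (a : nat) : (a.+2 < n)%N -> (v a < v a.+1)%N -> (v a.+1 < v a.+2)%N ->
    iso a (Gn (tr v a a.+1)) = iso a.+1 (Gn (tr v a.+1 a.+2)).
  move=> an aa ab.
  have an1 : (a.+1 < n)%N by apply: ltnW.
  have [n1 n2 n3 n4] : [/\ a.+2 != a, a.+2 != a.+1, a != a.+1 & a != a.+2].
    by split; apply/eqP; lia.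
  have n5 : a.+1 != a by apply/eqP; lia.
  have n6 : a.+1 != a.+2 by apply/eqP; lia.
  have l1 := len_asc aa; have l2 := len_asc ab.
  have a1 : (tr v a a.+1 a.+1 < tr v a a.+1 a.+2)%N by rewrite trEr trEn //; apply: ltn_trans ab.
  have b1 : (tr v a.+1 a.+2 a < tr v a.+1 a.+2 a.+1)%N by rewrite trEl trEn //; apply: ltn_trans ab.
  rewrite (IH (tr v a a.+1) a.+1) ?bd ?l1 //.
  rewrite (IH (tr v a.+1 a.+2) a) ?bd ?l2 //.
  have l3 := len_asc a1; have l4 := len_asc b1.
  rewrite (IH (tr (tr v a a.+1) a.+1 a.+2) a) ?bd //; first last.
  - by rewrite [X in (_ < X)%N]trEl !(trEn _ (i := a.+2)) // (trEn _ (i := a)) // trEl.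
  - by rewrite l3 l1 ltnW.
  rewrite (IH (tr (tr v a.+1 a.+2) a a.+1) a.+1) ?bd //; first last.
  - by rewrite [X in (X < _)%N]trEr !(trEn _ (i := a)) // (trEn _ (i := a.+2)) // trEr.
  - by rewrite l4 l2 ltnW.
  rewrite (iso_braid X); congr (iso _ (iso _ (iso _ (Gn _)))).
  by apply: Sinf_eqP => r; tr_lia.
move: ij; rewrite neq_ltn => /orP[].
  rewrite leq_eqVlt => /predU1P[e1|lt1]; last by apply/esym/far.
  by move: jn ascj; rewrite -e1 => jn ascj; apply/esym/near_.
rewrite leq_eqVlt => /predU1P[e1|lt1]; last exact: far.
by move: lt_in asc; rewrite -e1 => lt_in asc; apply: near_.
Qed.

Lemma Gn_step (w : Sinf) i : (boundS w <= n)%N -> (i.+1 < n)%N -> (w i.+1 < w i)%N ->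
  Gn (tr w i i.+1) = iso i (Gn w).
Proof.
move=> wn lt_in d; rewrite (Gn_step_asc (i := i)) ?trK ?trEl ?trEr //.
by apply: tr_bound => //; apply: ltnW.
Qed.
End Level.

Lemma Gn_stable n (v : Sinf) : (boundS v <= n)%N -> Gn n.+1 v = Gn n v.
Proof.
move: v; apply: down_ind => [|w i wn lt_in d e].
  by rewrite Gn_w0 (w0_stable X) ?Gn_w0 // => w i; apply: Gn_step.
rewrite !Gn_step ?e //; [exact: leqW|exact: ltnW].
Qed.

Definition Gall (v : Sinf) : R := Gn (boundS v) v.

Lemma GallE n (v : Sinf) : (boundS v <= n)%N -> Gall v = Gn n v.
Proof.
elim: n => [|n IHn]; first by rewrite leqn0 /Gall => /eqP ->.
rewrite leq_eqVlt => /predU1P[<- //|]; rewrite ltnS => vn.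
by rewrite Gn_stable // IHn.
Qed.

Lemma Gall_w0 n : Gall (w0S n) = mono x n (fun j => n - j.+1)%N.
Proof. by rewrite (GallE (bound_w0 n)) Gn_w0. Qed.

Lemma Gall_step (w : Sinf) i : (w i.+1 < w i)%N -> Gall (tr w i i.+1) = iso i (Gall w).
Proof.
move=> d; pose n := maxn (boundS w) i.+2.
have wn : (boundS w <= n)%N by rewrite leq_maxl.
have lt_in : (i.+1 < n)%N by rewrite leq_maxr.
rewrite !(@GallE n) // ?Gn_step //.
by apply: tr_bound => //; apply: ltnW.
Qed.
End Existence.

Lemma groth_spec : is_grothendieck groth.
Proof.
apply: epsilon_spec; exists (Gall varX isobaric); split=> [n|w i /descentP d].
  by rewrite (Gall_w0 ZX_isosys) /mono big_mkord.
exact: (Gall_step ZX_isosys).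
Qed.

(** * The list of all chains *)

Definition idS : Sinf := w0S 0.

Lemma idSE i : idS i = i.
Proof. by rewrite w0E. Qed.

Section ChainList.
Variables (k N : nat).
Implicit Types (v w : Sinf) (g : seq (nat * nat)).

Lemma kchainE v g w : kchain k v g w = okc k v g && (endS v g == w).
Proof.
elim: g v => [//|l g IHg] v.
by rewrite [kchain _ _ _ _]/= [okc _ _ _]/= kcoverE IHg -!andbA.
Qed.

Lemma pieri_chainE v w g : pieri_chain k v w g <-> [/\ okc k v g, good [::] g & endS v g = w].
Proof.
rewrite /pieri_chain kchainE; split=> [[/andP[ok /eqP e] P0 P1]|[ok gd e]].
  by split=> //; apply/(goodE ok).
by have [P0 P1] := (goodE ok).2 gd; split=> //; rewrite ok e eqxx.
Qed.

Definition chains v : seq (seq (nat * nat)) :=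
  [seq g <- words k N (fuel k N) | okc k v g && good [::] g].

Lemma size_okc v g : okc k v g -> all (mem (letters k N)) g -> (size g <= noninv k N v)%N.
Proof.
elim: g v => [//|l g IHg] v /= /and3P[_ cv ok] /andP[lL gL].
by apply: leq_ltn_trans (IHg _ ok gL) _; apply: noninv_tr.
Qed.

(** The columns of a chain decrease, so that only the first cover can extend
    the support of a permutation, by one letter. *)
Lemma chain_letters b v g : (boundS v <= b)%N -> (k <= b)%N -> (b < N)%N ->
  okc k v g -> good [::] g -> all (mem (letters k N)) g.
Proof.
move=> vb kb bN ok gd; have srt := good_sorted gd.
have okl : all (fun l : nat * nat => (l.1 < k <= l.2)%N) g.
  by elim: (g) (v) ok => [//|l g' IHg] u /= /and3P[-> _ /IHg].
case: g ok {gd} srt okl => [//|l g] /= /and3P[/andP[lk kl] cv _] srt okl.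
have lb : (l.2 <= b)%N.
  rewrite leqNgt; apply/negP => h; have := cov_big vb (leq_trans lk kb) h.
  by rewrite cv.
apply/andP; split; first by rewrite mem_letters lk kl /=; apply: leq_ltn_trans bN.
apply/allP => l' l'g; rewrite /= mem_letters; move/andP: okl => [_ /allP /(_ _ l'g) ->] /=.
have /(sorted_le srt) h : l'.2 \in unzip2 g by apply: map_f.
by apply: leq_ltn_trans bN; apply: leq_trans lb.
Qed.

Lemma mem_chains b v g : (boundS v <= b)%N -> (k <= b)%N -> (b < N)%N ->
  (g \in chains v) = okc k v g && good [::] g.
Proof.
move=> vb kb bN; rewrite mem_filter; case: (boolP (okc k v g && good [::] g)) => //= /andP[ok gd].
have gL := chain_letters vb kb bN ok gd.
by rewrite mem_words gL andbT; apply: leq_trans (size_okc ok gL) (noninv_fuel _ _ _).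
Qed.

Lemma chains_uniq v : uniq (chains v).
Proof. by rewrite filter_uniq // words_uniq. Qed.
End ChainList.

Section DecreasingChains.
Variable k : nat.

(** For [j = 0], the chain from the identity to the cycle [cycS k p]; other [j]
    occur in inductions. *)
Definition cycle_chain (j p : nat) : seq (nat * nat) := [seq ((k - i.+1)%N, k) | i <- iota j p].

Lemma cycle_chain_rcons p : cycle_chain 0 p.+1 = rcons (cycle_chain 0 p) ((k - p.+1)%N, k).
Proof.
have e : iota 0 p.+1 = rcons (iota 0 p) p by rewrite -addn1 iotaD cats1.
by rewrite /cycle_chain e map_rcons.
Qed.

Lemma cycS0 : cycS k 0 = idS.
Proof. by apply: Sinf_eqP => i; rewrite idSE mkSE /cycfun; repeat case: ifP; lia. Qed.

Lemma tr_cycS p : (p < k)%N -> tr (cycS k p) (k - p.+1)%N k = cycS k p.+1.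
Proof.
move=> pk; apply: Sinf_eqP => i; rewrite trE !mkSE /cycfun /trfun.
by repeat case: ifP; lia.
Qed.

Lemma endS_cat u g1 g2 : endS u (g1 ++ g2) = endS (endS u g1) g2.
Proof. exact: foldl_cat. Qed.

Lemma endS_cycle_chain p : (p <= k)%N -> endS idS (cycle_chain 0 p) = cycS k p.
Proof.
elim: p => [|p IHp] pk; first by rewrite cycS0.
by rewrite cycle_chain_rcons -cats1 endS_cat IHp ?(ltnW pk) //= tr_cycS.
Qed.

Lemma cov_cycS p a b : (p <= k)%N -> (a < k <= b)%N -> (0 < p -> b <= k)%N ->
  cov (cycS k p) a b = [&& (p < k)%N, a == (k - p.+1)%N & b == k].
Proof.
move=> pk /andP[ak kb] pb; apply/idP/idP => [/covP[ab]|/and3P[lt /eqP -> /eqP ->]].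
  rewrite !mkSE => lt h.
  have e : b = k.
    apply/eqP; rewrite eqn_leq kb andbT; case: (posnP p) => [p0|/pb //].
    rewrite leqNgt; apply/negP => lt'; have := h k ak lt'; move: lt.
    by rewrite !mkSE /cycfun p0; repeat case: ifP; lia.
  subst b; rewrite eqxx andbT.
  have a1 : (a < k - p)%N by move: lt; rewrite /cycfun; repeat case: ifP; lia.
  have [e|ne] := eqVneq a (k - p.+1)%N; first by lia.
  have := h (k - p.+1)%N; rewrite !mkSE /cycfun; repeat case: ifP; lia.
apply/covP; rewrite !mkSE /cycfun; split; [lia|repeat case: ifP; lia|move=> c c1 c2].
by rewrite mkSE /cycfun; repeat case: ifP; lia.
Qed.

Lemma okc_cycle_chain p : (p <= k)%N -> okc k idS (cycle_chain 0 p).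
Proof.
elim: p => [//|p IHp] pk; have pk' := ltnW pk.
have h : (k - p.+1 < k <= k)%N by lia.
rewrite cycle_chain_rcons -cats1 okc_cat IHp // endS_cycle_chain // /= h andbT /=.
by rewrite cov_cycS ?pk ?eqxx.
Qed.

Lemma good_cycle_chain j p U : (j + p <= k)%N -> all (fun r => (k - j <= r)%N) U ->
  [/\ good U (cycle_chain j p), ndesc (cycle_chain j p) = p.-1 & nrep U (cycle_chain j p) = 0%N].
Proof.
elim: p j U => [//|p IHp] j U jp /allP hU.
have [||h1 h2 h3] := IHp j.+1 ((k - j.+1)%N :: U); first by lia.
  by rewrite /= leqnn; apply/allP => r /hU; lia.
have jU : (k - j.+1)%N \notin U by apply/negP => /hU; lia.
rewrite /cycle_chain [iota _ _]/= map_cons -/(cycle_chain j.+1 p).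
split; first 1 last.
- rewrite [ndesc _]/= h2; case: (p) jp => [//|p'] jp /=.
  by rewrite /prec /= ltnn eqxx /=; lia.
- by rewrite /= (negbTE jU) h3.
rewrite [good _ _]/= h1 andbT; case: (p) jp => [//|p'] jp /=.
by rewrite jU andbT /desc /= eqxx; apply/orP; right; lia.
Qed.

Lemma good_cat U g1 g2 : good U (g1 ++ g2) -> good U g1.
Proof.
elim: g1 U => [//|l g IHg] U /= /andP[lk /IHg ->]; rewrite andbT.
by case: (g) lk.
Qed.

(** At [cycS k p] there is only one cover in a column at most [k], the one
    that leads to [cycS k p.+1]. *)
Lemma chain_from_id g : okc k idS g -> good [::] g -> exists2 p, (p <= k)%N & g = cycle_chain 0 p.
Proof.
elim/last_ind: g => [|g l IHg]; first by exists 0%N.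
rewrite -cats1 okc_cat => /andP[ok1 ok2] gd.
have [p pk e] := IHg ok1 (good_cat gd); subst g.
move: ok2; rewrite endS_cycle_chain //= andbT => /andP[lk]; rewrite cov_cycS //.
  move=> /and3P[lt /eqP e1 /eqP e2]; exists p.+1 => //.
  by rewrite cats1 cycle_chain_rcons; congr rcons; case: (l) e1 e2 => a b /= -> ->.
move=> p0; have := good_sorted gd; rewrite /unzip2 map_cat.
case: (p) p0 => // p' _ /= /sorted_le; apply.
by rewrite mem_cat mem_head orbT.
Qed.

Lemma forced_cycle_chain p : (p <= k)%N ->
  count (forced (cycle_chain 0 p)) (iota 0 (size (cycle_chain 0 p))) = p
  /\ count (a_repeats (cycle_chain 0 p)) (iota 0 (size (cycle_chain 0 p))) = 0%N.
Proof.
move=> pk; have [//|//|gd nd nr] := @good_cycle_chain 0 p [::].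
split; last by move: nr; rewrite nrepE.
case: p pk gd nd {nr} => [//|p] pk; move=> gd nd.
by have := @forced_count [::] ((k - 1)%N, k) (cycle_chain 1 p) gd; rewrite -[_ :: _]/(cycle_chain 0 p.+1) nd.
Qed.
End DecreasingChains.

(** * The product formula *)

Lemma csum_sum (R : comPzRingType) (t : R) (s : seq nat) (I : Type) (r : seq I)
    (f : I -> (nat -> bool) -> R) :
  csum t s (fun S => \sum_(i <- r) f i S) = \sum_(i <- r) csum t s (f i).
Proof.
elim: r => [|i r IHr].
  by rewrite big_nil -[RHS](csum0 t s); apply: csum_ext => S _; rewrite big_nil.
by rewrite big_cons -IHr -csumD; apply: csum_ext => S _; rewrite big_cons.
Qed.

Lemma Z_chains (R : comPzRingType) (t : R) (k N : nat) F v : (k <= N)%N ->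
  Z t k N F v = \sum_(g <- chains k N v) mean_wt t [::] g * F (endS v g).
Proof.
move=> kN; rewrite /Z (csum_ext t (fun S _ => As_wt S F v kN)) csum_sum.
rewrite big_filter [RHS]big_mkcond; apply: eq_big_seq => g.
rewrite mem_words => /andP[_ gL].
have -> : csum t (vals k v) (fun S => wt R S v g * F (endS v g))
    = csum t (vals k v) (fun S => wt R S v g) * F (endS v g).
  rewrite mulrC -[RHS]addr0 -[X in _ + X](mul0r (csum t (vals k v) (fun _ => 0))) -csum_lin.
  by apply: csum_ext => S _; rewrite mul0r addr0 mulrC.
case: (boolP (okc k v g)) => ok /=; last first.
  rewrite (_ : csum _ _ _ = 0) ?mul0r // -[RHS](csum0 t (vals k v)).
  apply: csum_ext => S _; apply: (@wt_not_chain _ k) => //.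
  by apply/allP => l /(allP gL) /=; rewrite mem_letters => /andP[].
by rewrite csum_wt //; case: ifPn => // /mean_wt0 ->; rewrite mul0r.
Qed.

Definition num_forced (g : seq (nat * nat)) : nat := count (forced g) (iota 0 (size g)).
Definition num_prohibited (g : seq (nat * nat)) : nat := count (a_repeats g) (iota 0 (size g)).

Section GeneratingFunction.
Variable R : comNzRingType.

(** The sum of [t ^ p] times the coefficient of a chain with [q] covers, [f]
    of them forced to be marked and [m] prohibited, in the product with the
    polynomial of [cycS k p]. *)
Definition chain_gf (q f m : nat) : {poly R} :=
  (-1) ^+ q * (- 'X) ^+ f * (1 - 'X) ^+ (q - f - m).

(** The binomial coefficient of a chain has a nonnegative upper index. *)
Lemma num_forced_prohibited_le g : good [::] g -> (num_forced g + num_prohibited g <= size g)%N.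
Proof.
case: g => [//|l g] gd.
rewrite /num_forced (forced_count gd) /num_prohibited -[count _ _](nrepE [::] (l :: g)).
exact: forced_prohibited_le.
Qed.

Lemma mean_wt_gf g : good [::] g ->
  - 'X * mean_wt 'X [::] g 
  = (1 - 'X) * chain_gf (size g) (num_forced g) (num_prohibited g) - (size g == 0)%N%:R.
Proof.
case: g => [_|l g gd].
  by rewrite /chain_gf /= !expr0 !mulr1; ring.
have h := num_forced_prohibited_le gd.
have [n [e ->]] := @mean_wtE {poly R} 'X [::] (l :: g) gd.
move: h e; rewrite /chain_gf /num_forced (forced_count gd) /num_prohibited.
rewrite -[count (a_repeats _) _](nrepE [::] (l :: g)) subr0.
move: (ndesc _) (nrep _ _) => D P /= h e.
have -> : ((size g).+1 - D.+1 - P = n.-1)%N by lia.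
case: n e => [|n] e; first by lia.
have -> : (size g).+1 = (n.+1 + P + D)%N by lia.
rewrite [n.+1.-1]/= (exprNn 'X D.+1) (exprD (-1) (n.+1 + P)%N D) (exprS (1 - 'X) n).
rewrite (exprS (-1) D) (exprS 'X D).
have : (-1) ^+ D * (-1) ^+ D = 1 :> {poly R} by rewrite -exprMn mulrNN mulr1 expr1n.
move: ((-1) ^+ D : {poly R}) ((-1) ^+ (n.+1 + P) : {poly R}) ('X ^+ D : {poly R}) ((1 - 'X) ^+ n : {poly R}).
move=> s1 s2 xD y s1s1.
transitivity (- 'X * (s2 * xD * ((1 - 'X) * y)) * (s1 * s1)); last by ring.
by rewrite s1s1 mulr1.
Qed.

Lemma oneBX_inj (a b : {poly R}) : (1 - 'X) * a = (1 - 'X) * b -> a = b.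
Proof.
move=> e; have l : GRing.lreg ('X - 1%:P : {poly R}).
  by apply: lreg_lead; rewrite lead_coefXsubC; apply: lreg1.
have e' : 'X - 1%:P = - (1 - 'X) :> {poly R} by rewrite opprB.
by apply: (l a b); rewrite /= e' !mulNr e.
Qed.

Lemma coef_oneBX n i : ((1 - 'X) ^+ n : {poly R})`_i = (-1) ^+ i * 'C(n, i)%:R.
Proof.
have -> : (1 - 'X) ^+ n = \poly_(j < n.+1) ((-1) ^+ j * 'C(n, j)%:R) :> {poly R}.
  rewrite exprDn poly_def; apply: eq_bigr => j _.
  by rewrite expr1n mul1r (exprNn 'X) -mulr_natr -mul_polyC polyCM polyC_exp polyCN polyC1 polyC_natr mulrAC.
rewrite coef_poly; case: ltnP => // h; rewrite bin_small ?mulr0 //.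
Qed.

Lemma coef_chain_gf q f m p : (chain_gf q f m)`_p =
  if (f <= p)%N then (-1) ^+ (q + p) * 'C(q - f - m, p - f)%:R else 0.
Proof.
rewrite /chain_gf (exprNn 'X f) -!mulrA mulrA -exprD.
have -> : (-1) ^+ (q + f) = ((-1) ^+ (q + f))%:P :> {poly R}.
  by rewrite polyC_exp polyCN polyC1.
rewrite coefCM coefXnM ltnNge; case: leqP => fp /=; last by rewrite mulr0.
rewrite coef_oneBX mulrA -exprD; congr (_ ^+ _ * _); lia.
Qed.
End GeneratingFunction.

Section Product.
Variables (R : comNzRingType) (x : nat -> R) (s iso : nat -> R -> R).
Hypothesis X : isosys x s iso.
Variable G : Sinf -> R.
Hypothesis G0 : forall n, G (w0S n) = mono x n (fun j => n - j.+1)%N.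
Hypothesis GS : forall (w : Sinf) i, (w i.+1 < w i)%N -> G (tr w i i.+1) = iso i (G w).

Local Notation cgf g := (chain_gf R (size g) (num_forced g) (num_prohibited g)).

(** The two evaluations of [Z]. The empty chain has the weight 1, which
    differs from the general pattern and produces the term 1 on the left. *)
Lemma Eprod_chains k n b v : (boundS v <= b)%N -> (k <= b)%N -> (b + k <= n)%N ->
  (1 - 'X * Eprod x k) * (G v)%:P
  = (1 - 'X) * \sum_(g <- chains k n.+1 v) cgf g * (G (endS v g))%:P.
Proof.
move=> vb kb bn; have Zv := Z_eq X G0 GS kb bn vb.
rewrite Z_chains in Zv; last by lia.
rewrite mulrBl mul1r -mulrA -Zv big_distrr /= [in RHS]big_distrr /=.
have h : \sum_(g <- chains k n.+1 v) (size g == 0)%N%:R * (G (endS v g))%:P = (G v)%:P :> {poly R}.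
  have nil_in : [::] \in chains k n.+1 v by rewrite (mem_chains _ vb kb) //; lia.
  rewrite (bigD1_seq [::]) ?chains_uniq //= mul1r big1 ?addr0 //.
  by case=> [//|l g] _; rewrite mul0r.
rewrite -{1}h -sumrB big_seq [RHS]big_seq; apply: eq_bigr => g.
rewrite mem_filter => /andP[/andP[_ gd] _].
have := mean_wt_gf R gd; move: (mean_wt _ _ _) (size g == 0)%N%:R (cgf g) (G _)%:P => a c d z e.
transitivity (c * z + (- 'X * a) * z); first by ring.
by rewrite e; ring.
Qed.

Lemma G_id : G idS = 1.
Proof. by rewrite G0 /mono big_geq. Qed.

(** The chains that start at the identity are the [cycle_chain k 0 p]. *)
Lemma Eprod_cycles k :
  1 - 'X * Eprod x k = (1 - 'X) * \sum_(p < k.+1) 'X^p * (G (cycS k p))%:P.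
Proof.
have idk : (boundS idS <= k)%N by apply: leq_trans (bound_w0 0) _.
have := @Eprod_chains k (k + k) k idS idk (leqnn k) (leqnn _).
rewrite G_id polyC1 mulr1 => ->; congr (_ * _).
rewrite (perm_big [seq cycle_chain k 0 p | p <- iota 0 k.+1]); last first.
  apply: uniq_perm; first exact: chains_uniq.
    rewrite map_inj_in_uniq ?iota_uniq // => p q _ _ /(congr1 size).
    by rewrite !size_map !size_iota.
  move=> g; rewrite (mem_chains _ idk) //; last by lia.
  apply/andP/mapP => [[ok gd]|[p]].
    have [p pk ->] := chain_from_id ok gd; exists p => //.
    by rewrite mem_iota.
  rewrite mem_iota /= add0n ltnS => pk ->; split; first exact: okc_cycle_chain.
  by have [] := @good_cycle_chain k 0 p [::].
rewrite big_map -[iota 0 k.+1]/(index_iota 0 k.+1) big_mkord; apply: eq_bigr => p _.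
have pk : (p <= k)%N by rewrite -ltnS.
have [h1 h2] := forced_cycle_chain pk.
rewrite /num_forced /num_prohibited h1 h2 endS_cycle_chain // size_map size_iota /chain_gf subnn expr0 mulr1.
by rewrite -exprMn mulrNN mul1r.
Qed.

(** Eliminates [Eprod] between the two preceding lemmas. *)
Lemma cycle_product k n b v p : (boundS v <= b)%N -> (k <= b)%N -> (b + k <= n)%N -> (p <= k)%N ->
  G v * G (cycS k p) = \sum_(g <- chains k n.+1 v) (cgf g)`_p * G (endS v g).
Proof.
move=> vb kb bn pk; have := Eprod_chains vb kb bn.
rewrite Eprod_cycles -mulrA => /oneBX_inj /(congr1 (fun P : {poly R} => P`_p)).
rewrite coefMC coef_sum [in RHS]coef_sum => e.
rewrite mulrC; have <- : \sum_(g <- chains k n.+1 v) (cgf g * (G (endS v g))%:P)`_p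
   = \sum_(g <- chains k n.+1 v) (cgf g)`_p * G (endS v g).
  by apply: eq_bigr => g _; rewrite coefMC.
rewrite -e; congr (_ * _).
rewrite (bigD1 (Ordinal (n := k.+1) (m := p) pk)) //= coefMC coefXn eqxx mul1r.
rewrite big1 ?addr0 // => j jp; rewrite coefMC coefXn.
by rewrite (_ : (p == j) = false) ?mul0r //; apply/negbTE; apply: contraNneq jp => e1; apply/eqP/val_inj.
Qed.
End Product.

Lemma the_chainE k v w g : pieri_chain k v w g -> the_chain k v w = g.
Proof.
move=> h; have := epsilon_spec (inhabits [::]) (pieri_chain k v w) (ex_intro _ g h).
rewrite -/(the_chain k v w); move: h => /pieri_chainE[ok gd e] /pieri_chainE[ok' gd' e'].
by apply: (chain_unique ok' ok gd' gd); rewrite e e'.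
Qed.

Lemma binz_nat (n m : nat) : binz n m = 'C(n, m)%:Z.
Proof.
rewrite /binz le0z_nat lez_nat /=.
by case: (leqP m n) => // h; rewrite bin_small.
Qed.

Lemma sign_dist (R : comNzRingType) (q p : nat) :
  ((-1 : int) ^ (q%:Z - p%:Z))%:~R = (-1) ^+ (q + p) :> R.
Proof.
have -> : (-1 : int) ^ (q%:Z - p%:Z) = (-1) ^+ (q + p).
  rewrite expN1r -signr_odd -[RHS]signr_odd oddD; congr (_ ^+ (_ : bool)).
  have [h|h] := leqP p q; first by rewrite subzn //= oddB.
  by rewrite distnC subzn ?(ltnW h) //= oddB ?(ltnW h) // addbC.
by rewrite rmorphXn rmorphN1.
Qed.

Lemma coef_chain_gf_int (R : comNzRingType) (q f m p : nat) : (f + m <= q)%N ->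
  (chain_gf R q f m)`_p
  = ((-1) ^ (q%:Z - p%:Z) * binz (q%:Z - f%:Z - m%:Z) (p%:Z - f%:Z))%:~R.
Proof.
move=> le; rewrite coef_chain_gf intrM sign_dist.
have fq : (f <= q)%N by lia.
have mq : (m <= q - f)%N by lia.
rewrite (subzn fq) (subzn mq); case: leqP => h; first by rewrite subzn // binz_nat.
by rewrite /binz Num.Theory.subr_ge0 lez_nat leqNgt h mulr0.
Qed.

Lemma scale_intZX (c : int) (G : ZX) : c *: G = c%:~R * G.
Proof. by rewrite -{1}[c]intz scaler_int mulrzl. Qed.

Theorem corollary16 (v : Sinf) (p k : nat) (hp : (1 <= p)%N) (hpk : (p <= k)%N) :
  exists W : {fset Sinf},
    (forall w : Sinf, w \in W <-> pieri k v w) /\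
    groth v * groth1 p k =
      \sum_(w <- W)
        ((-1) ^ ((len w)%:Z - (len v)%:Z - p%:Z) *
         binz ((len w)%:Z - (len v)%:Z - (nforced k v w)%:Z
                 - (nprohibited k v w)%:Z)
              (p%:Z - (nforced k v w)%:Z)) *: groth w.
Proof.
have [h0 hS] := groth_spec.
have G0 n : groth (w0S n) = mono varX n (fun j => n - j.+1)%N.
  exact: etrans (h0 n) (esym (big_mkord _ _)).
have GS (w : Sinf) i : (w i.+1 < w i)%N -> groth (tr w i i.+1) = isobaric i (groth w).
  by move/descentP; apply: hS.
pose b := maxn (boundS v) k.
have vb : (boundS v <= b)%N := leq_maxl _ _.
have kb : (k <= b)%N := leq_maxr _ _.
have bN : (b < (b + k).+1)%N by rewrite ltnS leq_addr.
pose cs := chains k (b + k).+1 v.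
have csP g : g \in cs = okc k v g && good [::] g := mem_chains g vb kb bN.
have endP g : g \in cs -> pieri_chain k v (endS v g) g.
  by rewrite csP => /andP[ok gd]; apply/pieri_chainE.
have Einj : {in cs &, injective (endS v)}.
  by move=> g g' /endP/the_chainE e1 /endP/the_chainE e2 e; rewrite -[LHS]e1 -[RHS]e2 e.
exists [fset w | w in map (endS v) cs]%fset; split=> [w|].
  rewrite in_fset; split=> [/mapP[g gc ->]|[g /pieri_chainE[ok gd <-]]].
    by exists g; apply: endP.
  by apply: map_f; rewrite csP ok gd.
rewrite (cycle_product ZX_isosys G0 GS vb kb (leqnn _) hpk).
rewrite (perm_big (map (endS v) cs)); last first.
  apply: uniq_perm; [exact: fset_uniq| |by move=> w; rewrite in_fset].
  by rewrite map_inj_in_uniq // chains_uniq.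
rewrite big_map; apply: eq_big_seq => g gc.
have := gc; rewrite csP => /andP[ok gd].
rewrite /nforced /nprohibited (the_chainE (endP g gc)) (okc_len ok) -/(num_forced g) -/(num_prohibited g).
have le := num_forced_prohibited_le gd.
have -> : (len v + size g)%N%:Z - (len v)%:Z = size g by rewrite PoszD addrC addKr.
rewrite scale_intZX; congr (_ * _); exact: coef_chain_gf_int.
Qed.
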